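(* Consider the rough differential equation $\mathrm dU_t=(AU_t+F(U_t))\,\mathrm dt+G(U_t)\,\mathrm d\mathbf W_t$ on $\mathcal X=\mathbb R^n$ under the assumptions of the context, with leading order terms $F_l,G_l$ of order $l<m$ of $F$ and $G$. For a suitably small truncation radius $R=R(\mathbf W)$ (depending on $\|W\|_\gamma$ and $\|\mathbb W\|_{2\gamma}$), let $\Gamma(\xi,\mathbf W)$ be the fixed point of the discretized Lyapunov–Perron map of the truncated equation. For $\xi\in\mathcal X^c$ define $$h(\xi,\mathbf W):=P^s\Gamma(\xi,\mathbf W)[-1,1]=\sum_{k=-\infty}^0S^s(-k)\Big(\int_0^1S^s(1-r)P^sF_R(\Gamma(\xi,\mathbf W)[k-1,\cdot])[r]\,\mathrm dr+\int_0^1S^s(1-r)P^sG_R(\Gamma(\xi,\mathbf W)[k-1,\cdot])[r]\,\mathrm d\Theta_{k-1}\mathbf W_r\Big)$$ and $$h^{app}(\xi,\mathbf W):=\sum_{k=-\infty}^0S^s(-k)\Big(\int_0^1S^s(1-r)P^sF_{R,l}(S^c(k-1+\cdot)\xi)[r]\,\mathrm dr+\int_0^1S^s(1-r)P^sG_{R,l}(S^c(k-1+\cdot)\xi)[r]\,\mathrm d\Theta_{k-1}\mathbf W_r\Big).$$ Then there is a constant $C[\|A\|_{\mathcal X},F,G]$, independent of $\xi$, such that $$\big\|h(\xi,\mathbf W)-h^{app}(\xi,\mathbf W),\,(h(\xi,\mathbf W)-h^{app}(\xi,\mathbf W))'\big\|_{\mathcal D^{2\gamma}_W}\le C[\|A\|_{\mathcal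 X},F,G]\,\|\xi\|_{\mathcal X}^{l}.$$ Here the vector $h(\xi,\mathbf W)-h^{app}(\xi,\mathbf W)\in\mathcal X^s$ is regarded as a (constant) controlled rough path.
   Context: **Rough paths.** $\gamma\in(1/3,1/2]$, $\mathcal V=\mathbb R^d$, and $\mathbf W=(W,\mathbb W)$ is a $\mathcal V$-valued $\gamma$-Hölder geometric rough path cocycle: $W$ is $\gamma$-Hölder, $\mathbb W$ is $2\gamma$-Hölder, Chen's relation $\mathbb W_{s,t}-\mathbb W_{s,u}-\mathbb W_{u,t}=W_{s,u}\otimes W_{u,t}$ holds, $\mathbf W$ is a limit of canonical lifts of smooth paths in rough path distance, and over a metric dynamical system $(\Omega,\mathcal F,\mathbb P,(\theta_t)_{t\in\mathbb R})$ one has $W_{s,s+t}(\omega)=W_t(\theta_s\omega)$, $\mathbb W_{s,s+t}(\omega)=\mathbb W_{0,t}(\theta_s\omega)$. Shift: $\Theta_\tau W_t=W_{t+\tau}-W_\tau$, $\Theta_\tau\mathbb W_{s,t}=\mathbb W_{s+\tau,t+\tau}$. $\mathbb Z^-=\{0,-1,-2,\dots\}$. A path $Y$ on $[0,1]$ with Gubinelli derivative $Y'$ is controlled, $(Y,Y')\in\mathcal D^{2\gamma}_W$, if $Y_t=Y_s+Y'_sW_{s,t}+R^Y_{s,t}$ with $Y,Y'$ $\gamma$-Hölder and $R^Y$ $2\gamma$-Hölder; $\|Y,Y'\|_{\mathcal D^{2\gamma}_W}=\|Y\|_\infty+\|Y'\|_\infty+\|Y'\|_\gamma+\|R^Y\|_{2\gamma}$.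 Integrals against $\mathbf W$ are controlled rough integrals. On the block with index $k-1$ paths are controlled by $\Theta_{k-1}W$ and the truncation radius is $R(\Theta_{k-1}\mathbf W)$. **Linear part.** $A$ is a matrix on $\mathcal X=\mathbb R^n=\mathcal X^c\oplus\mathcal X^s$, where $\mathcal X^c$ (resp. $\mathcal X^s$) is spanned by the generalized eigenvectors for eigenvalues on the imaginary axis (resp. with negative real part), and there are no other eigenvalues. $P^c,P^s$ are the associated projections, commuting with $S(t)=e^{tA}$; $S^{c/s}(t)=e^{tA}|_{\mathcal X^{c/s}}$. There are $M_c,M_s\ge1$ and $-\beta<0\le\nu<\beta$ with $\|S^c(t)x\|\le M_ce^{\nu t}\|x\|$ for $t\le0$ and $\|S^s(t)x\|\le M_se^{-\beta t}\|x\|$ for $t\ge0$. **Coefficients.** $F:\mathcal X\to\mathcal X$ is $C^m$ with $F(0)=\mathrm DF(0)=0$; $G:\mathcal X\to\mathcal L(\mathcal V,\mathcal X)$ is $C^{m+3}$ with $G(0)=\mathrm DG(0)=\mathrm D^2G(0)=0$. There are $l$-linear maps $F_l,G_l$ (leading order Taylor terms) with $l<m$ and $$F(U)=F_l(U,\dots,U)+\mathcal O(\|U\|_{\mathcal X}^{l+1}),\qquad G(U)=G_l(U,\dots,U)+\mathcal O(\|U\|_{\mathcal X}^{l+1})\quad\text{as }U\to0.$$ $\chi$ is a Lipschitz map of $\mathcal D^{2\gamma}_W([0,1];\mathcal X)$ to itself with $\chi(U)=U$ if $\|U,U'\|_{\mathcal D^{2\gamma}_W}\le1/2$ and $\chi(U)=0$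 if $\|U,U'\|_{\mathcal D^{2\gamma}_W}\ge1$; $\chi_R(U)=R\chi(U/R)$. For a controlled path $U$: $F_R(U)[t]=F(\chi_R(U)[t])$, $G_R(U)[t]=G(\chi_R(U)[t])$, $F_{R,l}(U)[t]=F_l(\chi_R(U)[t],\dots,\chi_R(U)[t])$, $G_{R,l}(U)[t]=G_l(\chi_R(U)[t],\dots,\chi_R(U)[t])$. **Lyapunov–Perron map.** Fix $-\beta<\eta<0$. $BC^\eta(\mathcal D^{2\gamma}_W)$ is the space of sequences $\mathbb U=(U^{j-1},(U^{j-1})')_{j\in\mathbb Z^-}$ of controlled rough paths on $[0,1]$ with $U_0^{j-1}=U_1^{j-2}$ and $\sup_je^{-\eta(j-1)}\|U^{j-1},(U^{j-1})'\|_{\mathcal D^{2\gamma}_W}<\infty$. For $\xi\in\mathcal X^c$, $j\in\mathbb Z^-$, $t\in[0,1]$, $$\begin{aligned}J(\mathbf W,\mathbb U,\xi)[j-1,t]=\;&S^c(t+j-1)\xi-\sum_{k=j+1}^0S^c(t+j-1-k)\Big(\int_0^1S^c(1-r)P^cF_R(U^{k-1})[r]\mathrm dr+\int_0^1S^c(1-r)P^cG_R(U^{k-1})[r]\mathrm d\Theta_{k-1}\mathbf W_r\Big)\\&-\int_t^1S^c(t-r)P^cF_R(U^{j-1})[r]\mathrm dr-\int_t^1S^c(t-r)P^cG_R(U^{j-1})[r]\mathrm d\Theta_{j-1}\mathbf W_r\\&+\sum_{k=-\infty}^{j-1}S^s(t+j-1-k)\Big(\int_0^1S^s(1-r)P^sF_R(U^{k-1})[r]\mathrm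 dr+\int_0^1S^s(1-r)P^sG_R(U^{k-1})[r]\mathrm d\Theta_{k-1}\mathbf W_r\Big)\\&+\int_0^tS^s(t-r)P^sF_R(U^{j-1})[r]\mathrm dr+\int_0^tS^s(t-r)P^sG_R(U^{j-1})[r]\mathrm d\Theta_{j-1}\mathbf W_r.\end{aligned}$$ It is a known result (under a suitable gap condition and for suitably small $R$, which is assumed) that $J(\mathbf W,\cdot,\xi)$ has a unique fixed point $\Gamma(\xi,\mathbf W)\in BC^\eta(\mathcal D^{2\gamma}_W)$, and $\Gamma(\xi,\mathbf W)[j-1,t]$ denotes its $(j-1)$-th entry at time $t$. *)

(* Defs.v *)
From HB Require Import structures.
From mathcomp Require Import all_boot all_order all_algebra complex.
From mathcomp Require Import all_classical all_reals all_analysis.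

Set Implicit Arguments.
Unset Strict Implicit.
Unset Printing Implicit Defensive.

Import Order.TTheory GRing.Theory Num.Theory.
Import numFieldNormedType.Exports.

Local Open Scope classical_set_scope.
Local Open Scope ring_scope.

(* Conventions.  X = R^n is 'cV[R]_n, V = R^d is 'cV[R]_d, L(V, X) is
   'M[R]_(n, d) and V (x) V is 'M[R]_d, with (v (x) w)_{ij} = v_i w_j.  These
   finite-dimensional spaces carry the library's sup norm, except that ||A|| is
   the induced operator norm op_norm.
   Paths are total functions on R; a controlled path on [0, 1] is only ever
   inspected on [0, 1].  Two-parameter maps are only inspected for s <= t. *)

Section Calculus.
Context {R : realType}.

Fixpoint Ck (V W : normedModType R) (k : nat) (f : V -> W) : Prop :=
  if k is k'.+1 then
    (forall x, differentiable f x) /\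
    (forall v, @Ck V W k' (fun x => 'd f x v))
  else continuous f.

Definition smooth_path (V : normedModType R) (w : R -> V) : Prop :=
  forall k t, derivable (derive1n k w) t 1.

Definition multilinear (U V : lmodType R) (l : nat)
    (f : ('I_l -> U) -> V) : Prop :=
  forall (i : 'I_l) (u : 'I_l -> U) (a : R) (x y : U),
    f [eta u with i |-> a *: x + y] =
    a *: f [eta u with i |-> x] + f [eta u with i |-> y].

Definition on_diag (U V : Type) (l : nat) (f : ('I_l -> U) -> V) : U -> V :=
  fun x => f (fun=> x).

Definition expmx (n : nat) (A : 'M[R]_n) : 'M[R]_n :=
  limn (fun N => \sum_(0 <= k < N) (k`!%:R)^-1 *: A ^+ k).

Definition op_norm (n : nat) (A : 'M[R]_n) : R :=
  sup [set `|A *m x| | x in [set x : 'cV[R]_n | `|x| <= 1]].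

Definition vint (n : nat) (a b : R) (f : R -> 'cV[R]_n) : 'cV[R]_n :=
  \col_i \int[lebesgue_measure]_(r in `[a, b]) (f r i 0).

End Calculus.

Section Spectral.
Context {R : realType}.

(* x lies in the span of the generalized eigenvectors of A for the eigenvalues
   in S.  Eigenvectors are columns, whereas the library's are rows: hence the
   transposes. *)
Definition spectral_subspace (n : nat) (A : 'M[R]_n) (S : set R[i])
    (x : 'cV[R]_n) : Prop :=
  let AC := (map_mx (real_complex R) A)^T in
  exists2 s : seq R[i],
    {in s, forall lam, eigenvalue AC lam /\ S lam} &
    ((map_mx (real_complex R) x)^T <= \sum_(lam <- s) geigenspace AC lam)%MS.

Definition center_space (n : nat) (A : 'M[R]_n) : 'cV[R]_n -> Prop :=
  spectral_subspace A [set lam | complex.Re lam = 0].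

Definition stable_space (n : nat) (A : 'M[R]_n) : 'cV[R]_n -> Prop :=
  spectral_subspace A [set lam | complex.Re lam < 0].

Record center_stable_splitting (n : nat) (A Pc Ps : 'M[R]_n) : Prop := {
  no_unstable : forall lam : R[i],
    eigenvalue (map_mx (real_complex R) A)^T lam -> complex.Re lam <= 0;
  proj_sum : Pc + Ps = 1%:M;
  proj_idem : Pc *m Pc = Pc;
  proj_center : forall x : 'cV[R]_n, center_space A x <-> Pc *m x = x;
  proj_stable : forall x : 'cV[R]_n, stable_space A x <-> Ps *m x = x }.

Record dichotomy (n : nat) (A : 'M[R]_n) (nu beta Mc Ms : R) : Prop := {
  center_bound : forall (t : R) (x : 'cV[R]_n), t <= 0 -> center_space A x ->
    `|expmx (t *: A) *m x| <= Mc * expR (nu * t) * `|x|;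
  stable_bound : forall (t : R) (x : 'cV[R]_n), 0 <= t -> stable_space A x ->
    `|expmx (t *: A) *m x| <= Ms * expR (- beta * t) * `|x| }.

End Spectral.

Section RoughPaths.
Context {R : realType}.

Definition incr (V : zmodType) (Y : R -> V) (s t : R) : V := Y t - Y s.

Definition holder_norm (V : normedModType R) (a b al : R) (f : R -> R -> V)
    : \bar R :=
  ereal_sup [set (`|f p.1 p.2| / ((p.2 - p.1) `^ al))%:E |
             p in [set p : R * R | [/\ a <= p.1, p.1 < p.2 & p.2 <= b]]].

Definition sup_norm (V : normedModType R) (Y : R -> V) : \bar R :=
  ereal_sup [set `|Y t|%:E | t in `[0, 1]].

Definition rpath (d : nat) : Type :=
  ((R -> 'cV[R]_d) * (R -> R -> 'M[R]_d))%type.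

Definition canonical_lift (d : nat) (w : R -> 'cV[R]_d) : rpath d :=
  (w, fun s t => \matrix_(i, j)
    \int[lebesgue_measure]_(r in `[s, t]) (incr w s r i 0 * derive1 w r j 0)).

Definition rp_dist (d : nat) (a b gamma : R) (W W' : rpath d) : \bar R :=
  (holder_norm a b gamma (fun s t => incr W.1 s t - incr W'.1 s t)%R +
   holder_norm a b (2 * gamma)%R (fun s t => W.2 s t - W'.2 s t)%R)%E.

(* On the whole line, Hoelder regularity and approximation are meant on every
   compact interval. *)
Record geometric_rough_path (d : nat) (gamma : R) (W : rpath d) : Prop := {
  rp_holder1 : forall T : R, 0 < T ->
    (holder_norm (- T) T gamma (incr W.1) < +oo)%E;
  rp_holder2 : forall T : R, 0 < T ->
    (holder_norm (- T) T (2 * gamma)%R W.2 < +oo)%E;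
  rp_chen : forall s u t : R, s <= u -> u <= t ->
    W.2 s t - W.2 s u - W.2 u t = incr W.1 s u *m (incr W.1 u t)^T;
  rp_geometric : forall T : R, 0 < T ->
    exists2 w : nat -> R -> 'cV[R]_d, (forall k, smooth_path (w k)) &
      rp_dist (- T) T gamma W (canonical_lift (w k)) @[k --> \oo] --> 0%E }.

Definition rp_shift (d : nat) (tau : R) (W : rpath d) : rpath d :=
  (fun t => W.1 (t + tau) - W.1 tau, fun s t => W.2 (s + tau) (t + tau)).

Record metric_dynamical_system (dsp : measure_display)
    (Om : measurableType dsp) (P : probability Om R)
    (theta : R -> Om -> Om) : Prop := {
  mds_meas : measurable_fun setT
    (fun p : (measurableTypeR R * Om)%type => theta p.1 p.2);
  mds_id : theta 0 = id;
  mds_flow : forall s t, theta (s + t) = theta s \o theta t;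
  mds_pres : forall t (E : set Om), measurable E ->
    P (theta t @^-1` E) = P E }.

Record rough_cocycle (Om : Type) (d : nat) (gamma : R)
    (theta : R -> Om -> Om) (W : Om -> rpath d) : Prop := {
  rc_rough : forall om, geometric_rough_path gamma (W om);
  rc_cocycle1 : forall om s t,
    incr (W om).1 s (s + t) = (W (theta s om)).1 t;
  rc_cocycle2 : forall om s t, 0 <= t ->
    (W om).2 s (s + t) = (W (theta s om)).2 0 t }.

(* A pair (Y, Y') of a path and its Gubinelli derivative. *)
Definition cpath (n d : nat) : Type :=
  ((R -> 'cV[R]_n) * (R -> 'M[R]_(n, d)))%type.

Definition remainder (n d : nat) (W : R -> 'cV[R]_d) (U : cpath n d)
    (s t : R) : 'cV[R]_n :=
  incr U.1 s t - U.2 s *m incr W s t.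

Definition Dnorm (n d : nat) (gamma : R) (W : R -> 'cV[R]_d) (U : cpath n d)
    : \bar R :=
  (sup_norm U.1 + sup_norm U.2 + holder_norm 0 1 gamma (incr U.2) +
   holder_norm 0 1 (2 * gamma)%R (remainder W U))%E.

Definition controlled (n d : nat) (gamma : R) (W : R -> 'cV[R]_d)
    (U : cpath n d) : Prop :=
  (holder_norm 0 1 gamma (incr U.1) < +oo)%E /\ (Dnorm gamma W U < +oo)%E.

Definition eq_cpath (n d : nat) (U V : cpath n d) : Prop :=
  forall t, 0 <= t <= 1 -> U.1 t = V.1 t /\ U.2 t = V.2 t.

Definition cst_cpath (n d : nat) (x : 'cV[R]_n) : cpath n d :=
  (fun=> x, fun=> 0).

(* The limit filter "mesh of the partition tends to 0". *)
Definition mesh_filter (a b : R) : set_system (seq R) :=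
  filter_from [set delta : R | 0 < delta]
    (fun delta => [set s | itv_partition a b s /\
       forall i, (i < size s)%N ->
         nth b (a :: s) i.+1 - nth b (a :: s) i < delta]).

(* Z' r v is the Gubinelli derivative of Z at r in direction v; its pairing
   with WW is sum_{ij} WW_{ij} Z'(e_i) e_j. *)
Definition rough_sum (n d : nat) (W : rpath d) (a b : R)
    (Z : R -> 'M[R]_(n, d)) (Z' : R -> 'cV[R]_d -> 'M[R]_(n, d)) (s : seq R)
    : 'cV[R]_n :=
  \sum_(k < size s)
    let u := nth b (a :: s) k in
    let v := nth b (a :: s) k.+1 in
    (Z u *m incr W.1 u v +
     \sum_(i < d) Z' u (delta_mx i 0) *m (row i (W.2 u v))^T).

Definition rough_int (n d : nat) (W : rpath d) (a b : R)
    (Z : R -> 'M[R]_(n, d)) (Z' : R -> 'cV[R]_d -> 'M[R]_(n, d))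
    : 'cV[R]_n :=
  lim (rough_sum W a b Z Z' s @[s --> mesh_filter a b]).

End RoughPaths.

Arguments rpath R d : clear implicits.
Arguments cpath R n d : clear implicits.

Section CutOff.
Context {R : realType}.

(* The space of controlled paths depends on the reference path W, so chi is a
   family of maps indexed by W; the Lipschitz constant does not depend on W. *)
Definition cut_off (n d : nat) (gamma : R)
    (chi : (R -> 'cV[R]_d) -> cpath R n d -> cpath R n d) : Prop :=
  exists2 L : R, 0 <= L &
  forall W : R -> 'cV[R]_d, (holder_norm 0 1 gamma (incr W) < +oo)%E ->
    [/\ forall U, controlled gamma W U -> controlled gamma W (chi W U),
        forall U V, controlled gamma W U -> controlled gamma W V ->
          (Dnorm gamma W (chi W U - chi W V)%R <= L%:E * Dnorm gamma W (U - V)%R)%E,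
        forall U, controlled gamma W U -> (Dnorm gamma W U <= (2^-1)%:E)%E ->
          eq_cpath (chi W U) U
      & forall U, controlled gamma W U -> (1%:E <= Dnorm gamma W U)%E ->
          eq_cpath (chi W U) 0].

End CutOff.

Section LyapunovPerron.
Context {R : realType} (n d : nat).
Variables (gamma : R) (A Pc Ps : 'M[R]_n).
Variable chi : (R -> 'cV[R]_d) -> cpath R n d -> cpath R n d.
(* The truncation radius, as a function of ||W||_gamma and ||WW||_{2 gamma}
   on [0, 1]. *)
Variable rad : R -> R -> R.

Definition radius (W : rpath R d) : R :=
  rad (fine (holder_norm 0 1 gamma (incr W.1)))
      (fine (holder_norm 0 1 (2 * gamma) W.2)).

Definition truncate (W : rpath R d) (U : cpath R n d) : cpath R n d :=
  radius W *: chi W.1 ((radius W)^-1 *: U).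

(* \int_a^b S(t - r) P f(chi_R(U)[r]) dr
   + \int_a^b S(t - r) P g(chi_R(U)[r]) dW_r,
   where g(Y) has the Gubinelli derivative v |-> Dg(Y) (Y' v). *)
Definition trunc_int (P : 'M[R]_n) (f : 'cV[R]_n -> 'cV[R]_n)
    (g : 'cV[R]_n -> 'M[R]_(n, d)) (W : rpath R d) (U : cpath R n d) (a b t : R)
    : 'cV[R]_n :=
  let Y := truncate W U in
  vint a b (fun r => expmx ((t - r) *: A) *m P *m f (Y.1 r)) +
  rough_int W a b
    (fun r => expmx ((t - r) *: A) *m P *m g (Y.1 r))
    (fun r v => expmx ((t - r) *: A) *m P *m 'd g (Y.1 r) (Y.2 r *m v)).

(* The sequences (U^{j-1})_{j in Z^-} are indexed by p : nat with j = - p, so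
   that entry p lives on the block of index j - 1 = - p.+1. *)
Definition block (W : rpath R d) (p : nat) : rpath R d := rp_shift (- p.+1%:R) W.

Definition BC (eta : R) (W : rpath R d) (U : nat -> cpath R n d) : Prop :=
  [/\ forall p, controlled gamma (block W p).1 (U p),
      forall p, (U p).1 0 = (U p.+1).1 1
    & (ereal_sup [set ((expR (- eta * - p.+1%:R))%:E *
                       Dnorm gamma (block W p).1 (U p))%E | p in setT]
       < +oo)%E].

Variables (F : 'cV[R]_n -> 'cV[R]_n) (G : 'cV[R]_n -> 'M[R]_(n, d)).

(* With k = - q, the time t + j - 1 - k is t - p.+1 + q. *)
Definition LP_path (W : rpath R d) (U : nat -> cpath R n d) (xi : 'cV[R]_n)
    (p : nat) (t : R) : 'cV[R]_n :=
  expmx ((t - p.+1%:R) *: A) *m xi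
  - \sum_(0 <= q < p) expmx ((t - p.+1%:R + q%:R) *: A) *m
      trunc_int Pc F G (block W q) (U q) 0 1 1
  - trunc_int Pc F G (block W p) (U p) t 1 t
  + limn (fun N => \sum_(p.+1 <= q < N)
      expmx ((t - p.+1%:R + q%:R) *: A) *m
        trunc_int Ps F G (block W q) (U q) 0 1 1)
  + trunc_int Ps F G (block W p) (U p) 0 t t.

(* The Gubinelli derivative of J(W, U, xi)[j - 1, .] is G_R(U^{j-1}), because
   Pc + Ps = 1. *)
Definition LP_map (W : rpath R d) (U : nat -> cpath R n d) (xi : 'cV[R]_n)
    (p : nat) : cpath R n d :=
  (LP_path W U xi p, fun t => G ((truncate (block W p) (U p)).1 t)).

Definition LP_fixed_point (eta : R) (W : rpath R d) (xi : 'cV[R]_n)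
    (U : nat -> cpath R n d) : Prop :=
  BC eta W U /\ forall p, eq_cpath (U p) (LP_map W U xi p).

Definition LP_unique_fixed_point (eta : R) (W : rpath R d) (xi : 'cV[R]_n)
    (U : nat -> cpath R n d) : Prop :=
  LP_fixed_point eta W xi U /\
  forall V, LP_fixed_point eta W xi V -> forall p, eq_cpath (V p) (U p).

End LyapunovPerron.

Section Manifold.
Context {R : realType} (n d : nat).
Variables (gamma : R) (A Ps : 'M[R]_n).
Variable chi : (R -> 'cV[R]_d) -> cpath R n d -> cpath R n d.
Variable rad : R -> R -> R.

(* Partial sums of sum_{k <= 0} S^s(- k) (...), with k = - q. *)
Definition stable_series (f : 'cV[R]_n -> 'cV[R]_n)
    (g : 'cV[R]_n -> 'M[R]_(n, d)) (W : rpath R d) (U : nat -> cpath R n d)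
    (N : nat) : 'cV[R]_n :=
  \sum_(0 <= q < N) expmx (q%:R *: A) *m
    trunc_int gamma A chi rad Ps f g (block W q) (U q) 0 1 1.

(* The path S^c(k - 1 + .) xi is smooth: its Gubinelli derivative is 0. *)
Definition center_orbit (xi : 'cV[R]_n) (q : nat) : cpath R n d :=
  (fun t => expmx ((t - q.+1%:R) *: A) *m xi, fun=> 0).

Definition center_manifold (Gam : 'cV[R]_n -> nat -> cpath R n d)
    (xi : 'cV[R]_n) : 'cV[R]_n :=
  Ps *m (Gam xi 0%N).1 1.

Definition center_manifold_app (l : nat) (Fl : ('I_l -> 'cV[R]_n) -> 'cV[R]_n)
    (Gl : ('I_l -> 'cV[R]_n) -> 'M[R]_(n, d)) (W : rpath R d) (xi : 'cV[R]_n)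
    : 'cV[R]_n :=
  limn (stable_series (on_diag Fl) (on_diag Gl) W (center_orbit xi)).

End Manifold.

(* Main.v *)
(** On each unit block the fixed point is the flow of [A] applied to a moving
    initial value plus a rough convolution, so its deviation from the center
    orbit [e^{tA} xi] is a weighted sum of sizes of the truncated coefficients
    over all blocks.  The radius may be taken smaller than any negative power of
    [w = 1 + |W|_gamma + |WW|_{2 gamma}], which makes the linear part of these
    sizes small.  A Gronwall argument then improves the a priori growth
    [e^{- eta q}] of the fixed point on block [q] to [x^q |xi|], with [x > 1] so
    close to [1] that [e^{- beta} x^l < 1].  If [l > 0], then [F] and [G] are at
    least quadratic at [0] and the deviation from the center orbit is
    [O(x^{2 q} |xi|^2)].  Hence replacing [F, G] by their leading terms and the
    fixed point by the center orbit changes the integrals on block [q] by a small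
    multiple of [(x^q |xi|)^l], and these errors are summable against
    [e^{- beta q}].  The radius absorbs all constants, so that [C = 1] works. *)

Require Import Defs.
From HB Require Import structures.
From mathcomp Require Import all_boot all_order all_algebra complex.
From mathcomp Require Import all_classical all_reals all_analysis.
From mathcomp Require Import ring lra zify.

Set Implicit Arguments.
Unset Strict Implicit.
Unset Printing Implicit Defensive.

Import Order.TTheory GRing.Theory Num.Theory.
Import numFieldNormedType.Exports.

Local Open Scope classical_set_scope.
Local Open Scope ring_scope.

(** All path estimates go through one predicate, [ctrl], in which a single number bounds the sup,
    derivative, Hoelder and remainder parts on [0, 1]. Its calculus loses only powers of [w], in
    total at most [w ^+ (2 * l + 3)] on a block. The radius is therefore [kap ^+ 2] with
    [w ^+ (2 * l + 3) * kap] below a constant. The square matters at the end: replacing the fixed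
    point by the center orbit costs D r^(l-1), where D is bounded both by the radius and, for l > 0,
    by a multiple of z^2 with z = x^q |xi|. Since the minimum of kap^2 and z^2 is at most kap z, a
    small factor kap appears at the exact power z^l, for small and large xi alike. The obstacle on
    the side of the coefficients is that G - G_l is only known to be O(|x|^(l+1)) pointwise, whereas
    composition with a controlled path involves its first two derivatives. An interpolation
    inequality for C^k functions supplies their orders of vanishing. The a priori growth of the
    fixed point has a prefactor unrelated to |xi|. Iterating the Gronwall step makes the term that
    carries it vanish in the limit. *)

Section MatrixNorm.
Context {R : realType}.

Lemma mxnorm_le (m n : nat) (M : 'M[R]_(m, n)) (B : R) :
  0 <= B -> (forall i j, `|M i j| <= B) -> `|M| <= B.
Proof.
move=> B0 h; rewrite [leLHS]/Num.norm/= mx_normrE.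
by apply/bigmax_leP; split => // -[i j] _; exact: h.
Qed.

Lemma mxnorm_coord (m n : nat) (M : 'M[R]_(m, n)) i j : `|M i j| <= `|M|.
Proof.
rewrite [leRHS]/Num.norm/= mx_normrE.
by apply/bigmax_geP; right => /=; exists (i, j).
Qed.

Lemma mulmx_norm (m n p : nat) (M : 'M[R]_(m, n)) (N : 'M[R]_(n, p)) :
  `|M *m N| <= n%:R * `|M| * `|N|.
Proof.
apply: mxnorm_le => [|i j]; first by rewrite !mulr_ge0.
rewrite mxE (le_trans (ler_norm_sum _ _ _))//.
rewrite (@le_trans _ _ (\sum_(k < n) `|M| * `|N|))//.
  by apply: ler_sum => k _; rewrite normrM ler_pM ?mxnorm_coord.
by rewrite sumr_const card_ord -[leLHS]mulr_natl mulrA.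
Qed.

Lemma trmx_norm (m n : nat) (M : 'M[R]_(m, n)) : `|M^T| <= `|M|.
Proof. by apply: mxnorm_le => // i j; rewrite mxE mxnorm_coord. Qed.

Lemma row_norm (m n : nat) (M : 'M[R]_(m, n)) i : `|row i M| <= `|M|.
Proof. by apply: mxnorm_le => // j k; rewrite mxE mxnorm_coord. Qed.

Lemma delta_mx_norm (m n : nat) i j : `|delta_mx i j : 'M[R]_(m, n)| <= 1.
Proof.
by apply: mxnorm_le => // k l; rewrite mxE; case: (_ && _); rewrite ?normr1 ?normr0.
Qed.

Lemma norm_mulmx_coord (m n : nat) (M : 'M[R]_(m, n)) (B : R) : 0 <= B ->
  (forall v : 'cV[R]_n, `|M *m v| <= B * `|v|) -> `|M| <= B.
Proof.
move=> B0 h; apply: mxnorm_le => // i j.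
have -> : M i j = (M *m delta_mx j 0) i (0 : 'I_1) by rewrite -colE mxE.
rewrite (le_trans (mxnorm_coord _ _ _))// (le_trans (h _))//.
by rewrite ler_piMr ?delta_mx_norm.
Qed.

End MatrixNorm.

Lemma powR_le {R : realType} (r x y : R) : 0 <= r -> 0 <= x -> x <= y ->
  x `^ r <= y `^ r.
Proof.
move=> r0 x0 xy; apply: ge0_ler_powR => //; rewrite nnegrE//.
exact: le_trans xy.
Qed.

(** * The sewing lemma: sums of an almost additive function over partitions *)

Section Sewing.
Context {R : realType} {m n : nat}.
Notation V := 'M[R]_(m, n).

Fixpoint psum (Xi : R -> R -> V) (a : R) (s : seq R) : V :=
  if s is x :: s' then Xi a x + psum Xi x s' else 0.

Lemma psum_cat Xi a s t : psum Xi a (s ++ t) = psum Xi a s + psum Xi (last a s) t.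
Proof. by elim: s a => [|x s ih] a /=; rewrite ?add0r// ih addrA. Qed.

Lemma path_lt_last (a : R) s : path <%R a s -> a <= last a s.
Proof. by move=> h; apply: (@itv_partition_le _ _ _ _ s); split. Qed.

Lemma powR_half (x th : R) : 0 <= x -> (x / 2) `^ th = 2^-1 `^ th * x `^ th.
Proof. by move=> x0; rewrite powRM ?invr_ge0// mulrC. Qed.

(** The solution c of c = 2 * 2^-th * c + 2, which stands for two pieces of half the length and two
    additivity defects. *)
Definition sew_cst (th : R) : R := 2 / (1 - 2 * 2^-1 `^ th).

Lemma sew_cst_gt0 th : 1 < th -> 0 < 1 - 2 * 2^-1 `^ th :> R.
Proof.
move=> th1; rewrite subr_gt0.
have -> : 2 * 2^-1 `^ th = 2^-1 `^ (th - 1) :> R.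
  rewrite powRB; last by rewrite invr_eq0 pnatr_eq0 implybT.
  by rewrite powRr1 ?invr_ge0// invrK mulrC.
have := @gt0_ltr_powR R (th - 1) _ (2^-1) 1; rewrite powR1; apply.
- by rewrite subr_gt0.
- by rewrite nnegrE invr_ge0.
- by rewrite nnegrE.
- by rewrite invf_lt1// ltr1n.
Qed.

Variables (Xi : R -> R -> V) (a0 b0 th K : R).
Hypothesis th1 : 1 < th.
Hypothesis K0 : 0 <= K.
Hypothesis delta_Xi : forall u w v, a0 <= u -> u <= w -> w <= v -> v <= b0 ->
  `|Xi u v - Xi u w - Xi w v| <= K * (v - u) `^ th.

Lemma sew_cst_ge0 : 0 <= sew_cst th.
Proof. by rewrite divr_ge0// ltW// sew_cst_gt0. Qed.

Let Xi_diag u : a0 <= u -> u <= b0 -> Xi u u = 0.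
Proof.
move=> au ub; have := delta_Xi au (lexx u) (lexx u) ub.
rewrite (subrr u) powR0 ?gt_eqF ?(lt_trans _ th1)// mulr0 subrr sub0r normrN.
by rewrite normr_le0 => /eqP.
Qed.

(** Bisection, by induction on the number of points. Let [x] be the first partition point beyond the
    midpoint and [p] its predecessor. The parts before [p] and after [x] have at most half the
    length, so each contributes the bound with a factor 2^-th; joining them through [p] and [x]
    costs two defects. *)
Lemma psum_bound s a : a0 <= a -> path <%R a s -> last a s <= b0 ->
  `|psum Xi a s - Xi a (last a s)| <= sew_cst th * K * (last a s - a) `^ th.
Proof.
have th0 : 0 <= th by rewrite ltW// (lt_trans _ th1).
elim: (size s) {-2}s (leqnn (size s)) a => {s}[|N ih] s.
  rewrite leqn0 size_eq0 => /eqP-> a a0a _ /= ab.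
  by rewrite Xi_diag// subrr normr0 mulr_ge0 ?powR_ge0// mulr_ge0// sew_cst_ge0.
move=> sN a a0a pas lb.
have [s0|s0] := eqVneq s [::].
  move: lb; rewrite s0 /= => ab.
  by rewrite Xi_diag// subrr normr0 mulr_ge0 ?powR_ge0// mulr_ge0// sew_cst_ge0.
set b := last a s; set mid := (a + b) / 2.
have ab : a < b.
  by apply: (@itv_partition_size_neq0 _ _ _ _ s); [rewrite lt0n size_eq0|split].
have hasm : has (fun x => mid < x) s.
  apply/hasP; exists b; last by rewrite /mid; lra.
  by rewrite /b; case: s s0 {sN pas lb b ab mid} => //= x s _; rewrite mem_last.
have [x [s1 [s2 [es mx hs1]]]] : exists x s1 s2,
    [/\ s = rcons s1 x ++ s2, mid < x & ~~ has (fun x => mid < x) s1].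
  by case: (split_find hasm) => x s1 s2 mx hs1; exists x, s1, s2.
clear hasm.
have [pas1 p1x pxs2] : [/\ path <%R a s1, last a s1 < x & path <%R x s2].
  move: pas; rewrite es cat_path rcons_path last_rcons.
  by move=> /andP[/andP[]].
have bE : b = last x s2 by rewrite /b es last_cat last_rcons.
set p := last a s1 in p1x.
have pm : p <= mid.
  rewrite /p; case: (lastP s1) hs1 => [_ /=|s1' y]; first by rewrite /mid; lra.
  by rewrite has_rcons negb_or -leNgt last_rcons => /andP[].
have ap : a <= p by exact: path_lt_last.
have xb : x <= b by rewrite bE path_lt_last.
have bb0 : b <= b0 by [].
have midE : mid = (a + b) / 2 by [].
have pE : p = last a s1 by [].
rewrite -/b; clearbody mid b p.
have s1N : (size s1 <= N)%N.
  by move: sN; rewrite es size_cat size_rcons addSn ltnS => /(leq_trans (leq_addr _ _)).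
have s2N : (size s2 <= N)%N.
  by move: sN; rewrite es size_cat size_rcons addSn ltnS => /(leq_trans (leq_addl _ _)).
have E1 : `|psum Xi a s1 - Xi a p| <= sew_cst th * K * (2^-1 `^ th * (b - a) `^ th).
  rewrite pE (le_trans (ih _ s1N _ a0a pas1 _))//; first by rewrite -pE (le_trans (ltW p1x))// (le_trans xb).
  apply: ler_wpM2l; first by rewrite mulr_ge0// sew_cst_ge0.
  rewrite -powR_half; last by lra.
  rewrite -pE; apply: powR_le; lra.
have E2 : `|psum Xi x s2 - Xi x b| <= sew_cst th * K * (2^-1 `^ th * (b - a) `^ th).
  rewrite bE (le_trans (ih _ s2N _ _ pxs2 _))//; rewrite -?bE//; first by lra.
  apply: ler_wpM2l; first by rewrite mulr_ge0// sew_cst_ge0.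
  rewrite -powR_half; last by lra.
  apply: powR_le; lra.
have E3 : `|Xi a b - Xi a p - Xi p b| <= K * (b - a) `^ th.
  by apply: delta_Xi; lra.
have E4 : `|Xi p b - Xi p x - Xi x b| <= K * (b - a) `^ th.
  rewrite (le_trans (delta_Xi _ _ _ _))//; [lra|exact: ltW|].
  by rewrite ler_wpM2l// ge0_ler_powR ?nnegrE; lra.
have -> : psum Xi a s - Xi a b = (psum Xi a s1 - Xi a p) + (psum Xi x s2 - Xi x b)
    - (Xi a b - Xi a p - Xi p b) - (Xi p b - Xi p x - Xi x b).
  rewrite es psum_cat last_rcons -cats1 psum_cat /= -pE addr0.
  by apply/matrixP => i j; rewrite !mxE; ring.
rewrite (le_trans (ler_normB _ _))// (le_trans (lerD (ler_normB _ _) (lexx _)))//.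
rewrite (le_trans (lerD (lerD (ler_normD _ _) (lexx _)) (lexx _)))//.
rewrite (le_trans (lerD (lerD (lerD E1 E2) E3) E4))//.
rewrite le_eqVlt; apply/orP; left; apply/eqP.
rewrite /sew_cst; set h := 2^-1 `^ th; field.
by rewrite gt_eqF// sew_cst_gt0.
Qed.

End Sewing.

Section SewingLimit.
Context {R : realType} {m n : nat}.
Notation V := 'M[R]_(m, n).
Variables (Xi : R -> R -> V) (a0 b0 th K : R).
Hypothesis th1 : 1 < th.
Hypothesis K0 : 0 <= K.
Hypothesis delta_Xi : forall u w v, a0 <= u -> u <= w -> w <= v -> v <= b0 ->
  `|Xi u v - Xi u w - Xi w v| <= K * (v - u) `^ th.

Let CK := sew_cst th * K.

Let CK0 : 0 <= CK.
Proof. by rewrite mulr_ge0// sew_cst_ge0. Qed.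

(** The basic sets that generate [mesh_filter]. *)
Definition fine_partition (a b delta : R) (s : seq R) :=
  itv_partition a b s /\
  forall i, (i < size s)%N -> nth b (a :: s) i.+1 - nth b (a :: s) i < delta.

Lemma fine_partition_cons a b delta x s :
  fine_partition a b delta (x :: s) -> x - a < delta /\ fine_partition x b delta s.
Proof.
move=> [ip h]; split; first exact: (h 0%N).
split; first exact: itv_partition_cons ip.
by move=> i si; exact: (h i.+1).
Qed.

(** On each interval of the coarse partition [psum_bound] costs the power [th] of its length, which
    is at most [delta] to the power [th - 1] times the length. The lengths add up to [b - a]. *)
Lemma refine_bound (delta : R) s a b s' : a0 <= a -> b <= b0 -> 0 < delta ->
  fine_partition a b delta s -> itv_partition a b s' -> {subset s <= s'} ->
  `|psum Xi a s' - psum Xi a s| <= CK * delta `^ (th - 1) * (b - a).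
Proof.
move=> + bb0 d0; elim: s a s' => [|x s ih] a s' aa0.
  move=> [/itv_partition_nil <- _] /itv_partitionxx ->.
  by rewrite !subrr normr0 mulr0.
move=> /fine_partition_cons[xa fs] is' ss'.
have xs' : x \in s' by rewrite ss'// mem_head.
case/splitPr: xs' is' ss' => p1 p2 [/=].
rewrite cat_path/= last_cat/= => /andP[pap1 /andP[p1x pxp2]] lp2 ss'.
have ap1 : path <%R a (rcons p1 x) by rewrite rcons_path pap1.
have ax : a <= x by have := path_lt_last ap1; rewrite last_rcons.
have xb : x <= b by rewrite -(eqP lp2) path_lt_last.
have ps : path <%R x s by case: fs => -[].
have ss2 : {subset s <= p2}.
  (* The points of [s] lie to the right of [x] and those of [p1] to the left, so a point of [s] can
     only occur in [p2]. *)
  move=> y ys; have xy : x < y by move: ps; rewrite (path_sortedE lt_trans) => /andP[/allP/(_ _ ys)].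
  have := ss' y; rewrite inE ys orbT => /(_ isT); rewrite mem_cat inE gt_eqF//= => /orP[yp1|//].
  have : y < x.
    move: ap1; rewrite -cats1 cat_path => /andP[_]/=; rewrite andbT => lx.
    move: pap1 lx => /[swap]; elim/last_ind: p1 yp1 {ss' p1x} => // p z ihp.
    rewrite mem_rcons inE last_rcons rcons_path => /orP[/eqP->//|yp] zx /andP[pp lz].
    by apply: ihp => //; exact: lt_trans zx.
  by rewrite ltNge (ltW xy).
have := ih x p2 (le_trans aa0 ax) fs _ ss2; rewrite /itv_partition pxp2 lp2 => /(_ (conj isT isT)) E2.
have lr : last a (rcons p1 x) = x by rewrite last_rcons.
have E1 : `|psum Xi a (rcons p1 x) - Xi a x| <= CK * (x - a) `^ th.
  have := psum_bound th1 K0 delta_Xi aa0 ap1; rewrite lr; apply.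
  exact: le_trans bb0.
have E1' : `|psum Xi a (rcons p1 x) - Xi a x| <= CK * delta `^ (th - 1) * (x - a).
  rewrite (le_trans E1)// -mulrA ler_wpM2l//.
  have [->|xan] := eqVneq x a.
    by rewrite subrr mulr0 powR0// gt_eqF// (lt_trans _ th1).
  have xa0 : 0 < x - a by rewrite subr_gt0 lt_neqAle eq_sym xan.
  rewrite -mulr_powRB1 ?(ltW xa0)//; last by rewrite (lt_trans _ th1).
  rewrite mulrC ler_wpM2r// ?(ltW xa0)// powR_le// ?subr_ge0 ?(ltW th1)//.
  exact: ltW.
have -> : psum Xi a (p1 ++ x :: p2) - psum Xi a (x :: s) =
    (psum Xi a (rcons p1 x) - Xi a x) + (psum Xi x p2 - psum Xi x s).
  rewrite -cat_rcons psum_cat lr /=; by apply/matrixP => i j; rewrite !mxE; ring.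
rewrite (le_trans (ler_normD _ _))// (le_trans (lerD E1' E2))//.
by rewrite -mulrDr (_ : x - a + (b - x) = b - a)//; ring.
Qed.

Lemma common_refinement (a b : R) s s' : itv_partition a b s -> itv_partition a b s' ->
  exists t, [/\ itv_partition a b t, {subset s <= t} & {subset s' <= t}].
Proof.
move=> [ps ls] [ps' ls']; pose t := sort <=%R (undup (s ++ s')).
have mt y : (y \in t) = (y \in s) || (y \in s').
  by rewrite mem_sort mem_undup mem_cat.
exists t; split; last 2 first.
- by move=> y; rewrite mt => ->.
- by move=> y; rewrite mt => ->; rewrite orbT.
have alt u y : path <%R a u -> y \in u -> a < y.
  by rewrite (path_sortedE lt_trans) => /andP[/allP h _] /h.
have leb u y : path <%R a u -> last a u == b -> y \in u -> y <= b.
  move=> pu /eqP<- yu; case/splitPr: yu pu => p1 p2.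
  by rewrite cat_path last_cat /= => /andP[_ /andP[_]] /path_lt_last.
have pt : path <%R a t.
  rewrite (path_sortedE lt_trans) sort_lt_sorted undup_uniq andbT.
  by apply/allP => y; rewrite mt => /orP[]; exact: alt.
split=> //; have [s0|s0] := eqVneq s [::].
  move: ls ls' ps'; rewrite s0 /= => /eqP ab ls' ps'.
  have /itv_partitionxx s'0 : itv_partition a a s' by rewrite {2}ab; split.
  by rewrite /t s0 s'0 /= ab.
have bs : b \in s by rewrite -(eqP ls); case: s s0 {ps ls mt pt t} => //= x s _; rewrite mem_last.
have bt : b \in t by rewrite mt bs.
(* No point of [t] can follow [b], because every point of either partition is at most [b]. *)
case/splitPr: bt pt mt => p1 p2; rewrite cat_path last_cat /= => /andP[_ /andP[_ pb]] mt.
case: p2 pb mt => // y p2 /= /andP[by_ _] mt.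
have : y <= b.
  have : y \in p1 ++ [:: b, y & p2] by rewrite mem_cat !inE eqxx !orbT.
  by rewrite mt => /orP[] ?; [exact: (leb s)|exact: (leb s')].
by rewrite leNgt by_.
Qed.

Lemma psum_cauchy (delta : R) a b s s' : a0 <= a -> b <= b0 -> 0 < delta ->
  fine_partition a b delta s -> fine_partition a b delta s' ->
  `|psum Xi a s - psum Xi a s'| <= 2 * (CK * delta `^ (th - 1) * (b - a)).
Proof.
move=> aa0 bb0 d0 fs fs'; have [t [ft st s't]] := common_refinement fs.1 fs'.1.
have E1 := refine_bound aa0 bb0 d0 fs ft st.
have E2 := refine_bound aa0 bb0 d0 fs' ft s't.
have -> : psum Xi a s - psum Xi a s' =
    (psum Xi a t - psum Xi a s') - (psum Xi a t - psum Xi a s).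
  by apply/matrixP => i j; rewrite !mxE; ring.
by rewrite (le_trans (ler_normB _ _))//; lra.
Qed.
End SewingLimit.

(** * The limit as the mesh tends to 0 *)

Section MeshFilter.
Context {R : realType}.
Variables (a b : R).

Lemma fine_partition_exists (delta : R) : a <= b -> 0 < delta ->
  exists s, fine_partition a b delta s.
Proof.
rewrite le_eqVlt => /predU1P[<- _|ab d0].
  by exists [::]; split.
have [N [N0 hN]] : exists N : nat, (0 < N)%N /\ (b - a) / N%:R < delta.
  exists (Num.bound ((b - a) / delta)).+1; split=> //.
  rewrite ltr_pdivrMr// mulrC -ltr_pdivrMr//.
  apply: lt_le_trans (archi_boundP _) _; last by rewrite ler_nat.
  by rewrite divr_ge0 ?subr_ge0 ?ltW.
set h := (b - a) / N%:R in hN.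
have h0 : 0 < h by rewrite divr_gt0 ?subr_gt0 ?ltr0n.
have bE : b = a + N%:R * h by rewrite /h mulrC divfK ?pnatr_eq0 -?lt0n// addrC subrK.
suff : forall M c, exists s, fine_partition c (c + M%:R * h) delta s.
  by rewrite bE; exact.
elim => [|M ih] c; first by exists [::]; rewrite mul0r addr0; split.
have [s [[ps ls] fs]] := ih (c + h); have eq : c + M.+1%:R * h = c + h + M%:R * h.
  by rewrite -natr1; ring.
exists (c + h :: s); rewrite eq; split.
  by split; rewrite //= ps ltrDl h0.
move=> [|i] /=; first by rewrite addrAC subrr add0r.
by rewrite ltnS; exact: fs.
Qed.

Global Instance mesh_filter_filter : Filter (mesh_filter a b).
Proof.
apply: filter_from_filter; first by exists 1 => /=.
move=> i j /= i0 j0; exists (Num.min i j); first by rewrite lt_min i0.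
move=> s [ips h]; split; split=> // k ks; have := h k ks; rewrite lt_min => /andP[] //.
Qed.

Lemma mesh_filter_proper : a <= b -> ProperFilter (mesh_filter a b).
Proof.
move=> ab; apply: filter_from_proper => d /= d0.
by have [s ?] := fine_partition_exists ab d0; exists s.
Qed.

End MeshFilter.

Section SewingLimit2.
Context {R : realType} {m n : nat}.
Notation V := 'M[R]_(m, n).
Variables (Xi : R -> R -> V) (a0 b0 th K : R).
Hypothesis th1 : 1 < th.
Hypothesis K0 : 0 <= K.
Hypothesis delta_Xi : forall u w v, a0 <= u -> u <= w -> w <= v -> v <= b0 ->
  `|Xi u v - Xi u w - Xi w v| <= K * (v - u) `^ th.

Lemma mesh_near (a b e : R) (f : seq R -> V) (l : V) : a <= b ->
  f s @[s --> mesh_filter a b] --> l -> 0 < e ->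
  exists2 delta : R, 0 < delta & forall s, fine_partition a b delta s -> `|l - f s| < e.
Proof.
move=> ab fl e0; move/cvgrPdist_lt: fl => /(_ _ e0).
by case=> delta /= d0 h; exists delta.
Qed.

Lemma sewing_cvg a b : a0 <= a -> a <= b -> b <= b0 ->
  cvg (psum Xi a s @[s --> mesh_filter a b]).
Proof.
move=> aa0 ab bb0; have PF := mesh_filter_proper ab.
apply/cauchy_cvgP; apply/cauchy_ballP => e e0.
(* The summand 1 makes [C] positive and the last inequality strict. The choice of [delta] solves
   delta^(th - 1) = e / C. *)
pose C := 2 * (sew_cst th * K * (b - a)) + 1.
have C1 : 0 < C.
  by rewrite ltr_pwDr// mulr_ge0// mulr_ge0 ?subr_ge0// mulr_ge0// sew_cst_ge0.
pose delta := (e / C) `^ (th - 1)^-1.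
have d0 : 0 < delta by rewrite powR_gt0// divr_gt0.
have dE : delta `^ (th - 1) = e / C.
  rewrite -powRrM mulVf ?powRr1//; first by rewrite divr_ge0// ltW.
  by rewrite subr_eq0 gt_eqF.
pose S := [set s | fine_partition a b delta s].
exists ([set psum Xi a s | s in S], [set psum Xi a s | s in S]) => /=.
  by split; exists delta => // s fs; exists s.
move=> [x y] /= [[s fs <-] [s' fs' <-]].
rewrite -ball_normE/=.
have := psum_cauchy th1 K0 delta_Xi aa0 bb0 d0 fs fs'.
rewrite dE => /le_lt_trans; apply.
have -> : 2 * (sew_cst th * K * (e / C) * (b - a)) = e * ((C - 1) / C).
  by rewrite /C; ring.
by rewrite gtr_pMr// ltr_pdivrMr// mul1r ltrBlDr ltrDl.
Qed.

Lemma sewing_bound a b (l : V) : a0 <= a -> a <= b -> b <= b0 ->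
  psum Xi a s @[s --> mesh_filter a b] --> l ->
  `|l - Xi a b| <= sew_cst th * K * (b - a) `^ th.
Proof.
move=> aa0 ab bb0 hl; apply/ler_addgt0Pr => e e0.
have [delta d0 hd] := mesh_near ab hl e0.
have [s fs] := fine_partition_exists ab d0.
have -> : l - Xi a b = (psum Xi a s - Xi a b) + (l - psum Xi a s).
  by apply/matrixP => i j; rewrite !mxE; ring.
rewrite (le_trans (ler_normD _ _))// lerD//; last exact: ltW (hd _ fs).
have [[ps /eqP ls] _] := fs.
by have := psum_bound th1 K0 delta_Xi aa0 ps; rewrite ls; apply.
Qed.

Lemma fine_partition_cat a b c (delta : R) s t :
  fine_partition a b delta s -> fine_partition b c delta t ->
  fine_partition a c delta (s ++ t).
Proof.
elim: s a => [|x s ih] a; first by move=> [/itv_partition_nil ->].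
move=> /[dup] [[[]]] /= /andP[ax _] _ _ /fine_partition_cons[xa fs] ft.
have [[pst lst] hst] := ih x fs ft; split; first by split=> //=; rewrite ax.
by move=> [|i] //=; rewrite ltnS; exact: hst.
Qed.

Lemma fine_partition_le a b (delta delta' : R) s : delta <= delta' ->
  fine_partition a b delta s -> fine_partition a b delta' s.
Proof.
move=> dd [h1 h2]; split=> // i /h2 /lt_le_trans; exact.
Qed.

(** Concatenating fine partitions of the two pieces gives a fine partition of the whole, whose sum
    splits accordingly. *)
Lemma sewing_additive a b c (l1 l2 l : V) : a <= b -> b <= c ->
  psum Xi a s @[s --> mesh_filter a b] --> l1 ->
  psum Xi b s @[s --> mesh_filter b c] --> l2 ->
  psum Xi a s @[s --> mesh_filter a c] --> l ->
  l = l1 + l2.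
Proof.
move=> ab bc h1 h2 h; apply/eqP; rewrite -subr_eq0 -normr_le0.
apply/ler_addgt0Pr => e e0; rewrite add0r.
have e3 : 0 < e / 3 by lra.
have [d1 d10 H1] := mesh_near ab h1 e3.
have [d2 d20 H2] := mesh_near bc h2 e3.
have [d3 d30 H3] := mesh_near (le_trans ab bc) h e3.
pose d := Num.min (Num.min d1 d2) d3.
have d0 : 0 < d by rewrite !lt_min d10 d20.
have [s fs] := fine_partition_exists ab d0.
have [t ft] := fine_partition_exists bc d0.
have {}H1 := H1 s (fine_partition_le _ fs); have {}H2 := H2 t (fine_partition_le _ ft).
have {}H3 := H3 _ (fine_partition_le _ (fine_partition_cat fs ft)).
have dd1 : d <= d1 by rewrite !ge_min lexx.
have dd2 : d <= d2 by rewrite !ge_min lexx orbT.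
have dd3 : d <= d3 by rewrite !ge_min lexx orbT.
have {}H1 := H1 dd1; have {}H2 := H2 dd2; have {}H3 := H3 dd3.
have ls : last a s = b by case: fs => -[_ /eqP].
move: H3; rewrite psum_cat ls => H3.
have -> : l - (l1 + l2) = (l - (psum Xi a s + psum Xi b t)) -
   (l1 - psum Xi a s) - (l2 - psum Xi b t).
  by apply/matrixP => i j; rewrite !mxE; ring.
rewrite (le_trans (ler_normB _ _))// (le_trans (lerD (ler_normB _ _) (lexx _)))//.
lra.
Qed.

End SewingLimit2.

(** * Controlled paths and the rough integral on [0, 1] *)

Section ControlledBounds.
Context {R : realType}.

(** A controlled path with one constant for all its seminorms. The derivative is given by its action
    on directions, so that the same record serves paths of scalars, of vectors in X and of matrices
    in L(V, X). *)
Record ctrl (d : nat) (E : normedModType R) (gamma : R) (W : R -> 'cV[R]_d) (B : R)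
    (Z : R -> E) (Z' : R -> 'cV[R]_d -> E) : Prop := {
  ctrl_sup : forall t, 0 <= t -> t <= 1 -> `|Z t| <= B;
  ctrl_sup' : forall t v, 0 <= t -> t <= 1 -> `|Z' t v| <= B * `|v|;
  ctrl_holder' : forall s t v, 0 <= s -> s <= t -> t <= 1 ->
    `|Z' t v - Z' s v| <= B * (t - s) `^ gamma * `|v|;
  ctrl_rem : forall s t, 0 <= s -> s <= t -> t <= 1 ->
    `|Z t - Z s - Z' s (W t - W s)| <= B * (t - s) `^ (2 * gamma) }.

(** One number [w] bounds both levels of the rough path; [1 <= w] allows its powers to be
    compared. *)
Record rough_on (d : nat) (gamma w : R) (W : rpath R d) : Prop := {
  rough_on_ge1 : 1 <= w;
  rough_on1 : forall s t, 0 <= s -> s <= t -> t <= 1 ->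
    `|W.1 t - W.1 s| <= w * (t - s) `^ gamma;
  rough_on2 : forall s t, 0 <= s -> s <= t -> t <= 1 ->
    `|W.2 s t| <= w * (t - s) `^ (2 * gamma);
  rough_on_chen : forall s u t, 0 <= s -> s <= u -> u <= t -> t <= 1 ->
    W.2 s t - W.2 s u - W.2 u t = incr W.1 s u *m (incr W.1 u t)^T }.

Lemma ctrl_ge0 d (E : normedModType R) gamma (W : R -> 'cV[R]_d) B (Z : R -> E) Z' :
  ctrl gamma W B Z Z' -> 0 <= B.
Proof. by move=> /ctrl_sup /(_ 0 (lexx _) ler01); exact: le_trans. Qed.

(** The derivative [Z'] is a bare function. Linearity in this form matches the coordinate sum in
    [rough_sum] with the value of [Z'] on an increment of the driving path. *)
Definition basis_linear (d : nat) (U : lmodType R) (f : 'cV[R]_d -> U) :=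
  forall x, f x = \sum_(i < d) x i 0 *: f (delta_mx i 0).

Lemma linear_basis_linear (d : nat) (U : lmodType R) (f : {linear 'cV[R]_d -> U}) :
  basis_linear f.
Proof.
move=> x; rewrite {1}(matrix_sum_delta x) linear_sum; apply: eq_bigr => i _.
by rewrite big_ord1 linearZ.
Qed.

Definition germ (n d : nat) (W : rpath R d) (Z : R -> 'M[R]_(n, d))
    (Z' : R -> 'cV[R]_d -> 'M[R]_(n, d)) (u v : R) : 'cV[R]_n :=
  Z u *m incr W.1 u v + \sum_(i < d) Z' u (delta_mx i 0) *m (row i (W.2 u v))^T.

Lemma rough_sumE n d (W : rpath R d) a b (Z : R -> 'M[R]_(n, d)) Z' s :
  rough_sum W a b Z Z' s = psum (germ W Z Z') a s.
Proof.
rewrite /rough_sum; elim: s a => [|x s ih] a; first by rewrite big_ord0.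
by rewrite big_ord_recl /= -ih.
Qed.

Lemma norm_sum_le (p q d : nat) (f : 'I_d -> 'M[R]_(p, q)) (c : R) :
  (forall i, `|f i| <= c) -> `|\sum_(i < d) f i| <= d%:R * c.
Proof.
move=> h; rewrite (le_trans (ler_norm_sum _ _ _))//.
rewrite (le_trans (ler_sum _ (fun i _ => h i)))//.
by rewrite sumr_const card_ord -[leLHS]mulr_natl.
Qed.

Lemma cvg_mulmx (T : Type) (F : set_system T) (FF : Filter F) (p m n : nat) (M : 'M[R]_(p, m))
    (f : T -> 'M[R]_(m, n)) (l : 'M[R]_(m, n)) :
  f x @[x --> F] --> l -> M *m f x @[x --> F] --> M *m l.
Proof.
move=> /cvgrPdist_lt fl; apply/cvgrPdist_lt => e e0.
pose c := m%:R * `|M| + 1.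
have c0 : 0 < c by rewrite ltr_pwDr// mulr_ge0.
have := fl (e / c) (divr_gt0 e0 c0); apply: filterS => x lx.
rewrite -mulmxBr (le_lt_trans (mulmx_norm _ _))//.
rewrite (@le_lt_trans _ _ (c * `|l - f x|))//.
  by rewrite ler_wpM2r// lerDl.
by rewrite mulrC -ltr_pdivlMr.
Qed.

Lemma powRM_le (x y z a b : R) : 0 <= a -> 0 < a + b -> 0 <= b ->
  0 <= x <= z -> 0 <= y <= z -> x `^ a * y `^ b <= z `^ (a + b).
Proof.
move=> a0 ab b0 /andP[x0 xz] /andP[y0 yz].
rewrite powRD; last by rewrite gt_eqF.
by rewrite ler_pM ?powR_ge0// powR_le.
Qed.

End ControlledBounds.

Section RoughIntegral.
Context {R : realType} {n d : nat}.
Variables (gamma w B : R) (W : rpath R d).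
Variables (Z : R -> 'M[R]_(n, d)) (Z' : R -> 'cV[R]_d -> 'M[R]_(n, d)).
Hypothesis gamma3 : 1 < 3 * gamma.
Hypothesis rW : rough_on gamma w W.
Hypothesis cZ : ctrl gamma W.1 B Z Z'.
Hypothesis linZ' : forall s, basis_linear (Z' s).

Let B0 : 0 <= B. Proof. exact: ctrl_ge0 cZ. Qed.
Let w0 : 0 <= w. Proof. by rewrite (le_trans _ (rough_on_ge1 rW)). Qed.
Let g0 : 0 <= gamma. Proof. by have := gamma3; lra. Qed.

Definition germ_cst : R := (d%:R + d%:R ^+ 2) * w * B.

(** By Chen's relation the defect consists of the remainder of [Z] times an increment of the path,
    of order 2 gamma + gamma, and of an increment of [Z'] paired with the second level, of order
    gamma + 2 gamma. *)
Lemma germ_delta (u m v : R) : 0 <= u -> u <= m -> m <= v -> v <= 1 ->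
  `|germ W Z Z' u v - germ W Z Z' u m - germ W Z Z' m v| <=
  germ_cst * (v - u) `^ (3 * gamma).
Proof.
move=> u0 um mv v1.
have m0 : 0 <= m by exact: le_trans um.
have m1 : m <= 1 by exact: le_trans v1.
pose D i := Z' m (delta_mx i 0) - Z' u (delta_mx i 0).
have -> : germ W Z Z' u v - germ W Z Z' u m - germ W Z Z' m v =
    - ((Z m - Z u - Z' u (W.1 m - W.1 u)) *m incr W.1 m v)
    - \sum_(i < d) D i *m (row i (W.2 m v))^T.
  have WE : W.2 u v = W.2 u m + W.2 m v + incr W.1 u m *m (incr W.1 m v)^T.
    rewrite -(rough_on_chen rW u0 um mv v1).
    by apply/matrixP => i j; rewrite !mxE; ring.
  rewrite (linZ' u (W.1 m - W.1 u)) /germ WE.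
  have -> : \sum_(i < d) Z' u (delta_mx i 0) *m
      (row i (W.2 u m + W.2 m v + incr W.1 u m *m (incr W.1 m v)^T))^T =
      \sum_(i < d) Z' u (delta_mx i 0) *m (row i (W.2 u m))^T +
      (\sum_(i < d) Z' u (delta_mx i 0) *m (row i (W.2 m v))^T +
      (\sum_i (W.1 m - W.1 u) i 0 *: Z' u (delta_mx i 0)) *m incr W.1 m v).
    rewrite mulmx_suml -!big_split /=; apply: eq_bigr => i _.
    have -> (X Y Z0 : 'M[R]_d) : (row i (X + Y + Z0))^T =
        (row i X)^T + (row i Y)^T + (row i Z0)^T.
      by apply/matrixP => j k; rewrite !mxE.
    rewrite !(mulmxDr (Z' u _)) -addrA; congr (_ + (_ + _)).
    rewrite row_mul trmx_mul trmxK -scalemxAl.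
    have -> : (row i (incr W.1 u m))^T = ((W.1 m - W.1 u) i 0)%:M.
      by apply/matrixP => j k; rewrite !mxE !ord1.
    by rewrite mul_mx_scalar scalemxAr.
  have -> : \sum_(i < d) D i *m (row i (W.2 m v))^T =
      \sum_(i < d) Z' m (delta_mx i 0) *m (row i (W.2 m v))^T -
      \sum_(i < d) Z' u (delta_mx i 0) *m (row i (W.2 m v))^T.
    by rewrite -sumrB; apply: eq_bigr => i _; rewrite mulmxBl.
  have -> : incr W.1 u v = incr W.1 u m + incr W.1 m v.
    by apply/matrixP => i j; rewrite !mxE; ring.
  rewrite !mulmxBl (mulmxDr (Z u)).
  have abel (a b c e f g h : 'cV[R]_n) :
      a + b + (c + (e + f)) - (a + c) - (g + h) = - (g - b - f) - (h - e).
    by apply/matrixP => i j; rewrite !mxE; ring.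
  exact: abel.
have E1 : `|(Z m - Z u - Z' u (W.1 m - W.1 u)) *m incr W.1 m v| <=
    d%:R * w * B * (v - u) `^ (3 * gamma).
  rewrite (le_trans (mulmx_norm _ _))// -mulrA -!(mulrA d%:R) ler_wpM2l//.
  rewrite (le_trans (ler_pM _ _ (ctrl_rem cZ u0 um m1) (rough_on1 rW m0 mv v1)))//.
  rewrite mulrACA (mulrC B) ler_wpM2l ?mulr_ge0//.
  have -> : 3 * gamma = 2 * gamma + gamma by ring.
  by apply: powRM_le; have := gamma3; lra.
have E2 i : `|D i *m (row i (W.2 m v))^T| <= d%:R * w * B * (v - u) `^ (3 * gamma).
  rewrite (le_trans (mulmx_norm _ _))// -mulrA -!(mulrA d%:R) ler_wpM2l//.
  have D1 : `|D i| <= B * (m - u) `^ gamma.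
    rewrite (le_trans (ctrl_holder' cZ _ u0 um m1))// ler_piMr ?delta_mx_norm//.
    by rewrite mulr_ge0// powR_ge0.
  have D2 : `|(row i (W.2 m v))^T| <= w * (v - m) `^ (2 * gamma).
    rewrite (le_trans (trmx_norm _))// (le_trans (row_norm _ _))//.
    exact: (rough_on2 rW m0 mv v1).
  rewrite (le_trans (ler_pM _ _ D1 D2))//.
  rewrite mulrACA (mulrC B) ler_wpM2l ?mulr_ge0//.
  have -> : 3 * gamma = gamma + 2 * gamma by ring.
  by apply: powRM_le; have := gamma3; lra.
rewrite (le_trans (ler_normB _ _))// normrN /germ_cst.
have E3 : `|\sum_(i < d) D i *m (row i (W.2 m v))^T| <=
    d%:R * (d%:R * w * B * (v - u) `^ (3 * gamma)).
  exact: norm_sum_le.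
rewrite (le_trans (lerD E1 E3))// le_eqVlt; apply/orP; left; apply/eqP; ring.
Qed.

Let gc0 : 0 <= germ_cst.
Proof. by rewrite /germ_cst !mulr_ge0// addr_ge0// exprn_ge0. Qed.

Lemma rough_int_cvg (a b : R) : 0 <= a -> a <= b -> b <= 1 ->
  rough_sum W a b Z Z' s @[s --> mesh_filter a b] --> rough_int W a b Z Z'.
Proof.
move=> a0 ab b1; rewrite /rough_int.
rewrite (_ : rough_sum W a b Z Z' = psum (germ W Z Z') a); last first.
  by apply/funext => s; rewrite rough_sumE.
exact: (sewing_cvg gamma3 gc0 germ_delta a0 ab b1).
Qed.

Lemma rough_int_germ (a b : R) : 0 <= a -> a <= b -> b <= 1 ->
  `|rough_int W a b Z Z' - germ W Z Z' a b| <=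
  sew_cst (3 * gamma) * germ_cst * (b - a) `^ (3 * gamma).
Proof.
move=> a0 ab b1; apply: (sewing_bound gamma3 gc0 germ_delta a0 ab b1).
have := rough_int_cvg a0 ab b1.
rewrite (_ : rough_sum W a b Z Z' = psum (germ W Z Z') a)//.
by apply/funext => s; rewrite rough_sumE.
Qed.

Lemma rough_int_additive (a b c : R) : 0 <= a -> a <= b -> b <= c -> c <= 1 ->
  rough_int W a c Z Z' = rough_int W a b Z Z' + rough_int W b c Z Z'.
Proof.
move=> a0 ab bc c1.
have h x y : 0 <= x -> x <= y -> y <= 1 ->
    psum (germ W Z Z') x s @[s --> mesh_filter x y] --> rough_int W x y Z Z'.
  move=> x0 xy y1; have := rough_int_cvg x0 xy y1.
  rewrite (_ : rough_sum W x y Z Z' = psum (germ W Z Z') x)//.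
  by apply/funext => s; rewrite rough_sumE.
apply: (sewing_additive ab bc (h _ _ _ _ _) (h _ _ _ _ _) (h _ _ _ _ _)) => //.
- exact: le_trans c1.
- exact: le_trans ab.
- exact: le_trans bc.
Qed.

Lemma rough_int_norm (a b : R) : 0 <= a -> a <= b -> b <= 1 ->
  `|rough_int W a b Z Z'| <=
  (d%:R + d%:R ^+ 2) * (1 + sew_cst (3 * gamma)) * (w * B).
Proof.
move=> a0 ab b1.
have ba1 x : 0 <= x -> (b - a) `^ x <= 1.
  move=> x0; have -> : 1 = 1 `^ x :> R by rewrite powR1.
  by apply: powR_le; lra.
have a1 : a <= 1 by exact: le_trans b1.
have G : `|germ W Z Z' a b| <= (d%:R + d%:R ^+ 2) * (w * B).
  rewrite (le_trans (ler_normD _ _))// mulrDl lerD//.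
    rewrite (le_trans (mulmx_norm _ _))// -mulrA ler_wpM2l// mulrC ler_pM//.
      rewrite (le_trans (rough_on1 rW a0 ab b1))// ler_piMr// ba1//.
    exact: (ctrl_sup cZ).
  rewrite expr2 -mulrA; apply: norm_sum_le => i.
  rewrite (le_trans (mulmx_norm _ _))// -mulrA ler_wpM2l//.
  rewrite mulrC ler_pM//.
    rewrite (le_trans (trmx_norm _))// (le_trans (row_norm _ _))//.
    rewrite (le_trans (rough_on2 rW a0 ab b1))// ler_piMr// ba1//.
    by rewrite mulr_ge0.
  rewrite (le_trans (ctrl_sup' cZ _ a0 a1))// ler_piMr// delta_mx_norm//.
have E := rough_int_germ a0 ab b1.
have c0 : 0 <= sew_cst (3 * gamma) by rewrite sew_cst_ge0.
have E' : `|rough_int W a b Z Z' - germ W Z Z' a b| <=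
    sew_cst (3 * gamma) * germ_cst.
  rewrite (le_trans E)//; apply: ler_piMr; first exact: mulr_ge0.
  by apply: ba1; have := gamma3; lra.
rewrite -[rough_int _ _ _ _ _](subrK (germ W Z Z' a b)).
rewrite (le_trans (ler_normD _ _))// (le_trans (lerD E' G))//.
rewrite /germ_cst le_eqVlt; apply/orP; left; apply/eqP; ring.
Qed.

End RoughIntegral.

Section RoughIntegralLinear.
Context {R : realType} {n d : nat}.
Variables (W : rpath R d).

Lemma rough_sum_mulmx m a b (M : 'M[R]_(m, n)) (Z : R -> 'M[R]_(n, d)) Z' s :
  rough_sum W a b (fun r => M *m Z r) (fun r v => M *m Z' r v) s =
  M *m rough_sum W a b Z Z' s.
Proof.
rewrite /rough_sum mulmx_sumr; apply: eq_bigr => k _.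
rewrite mulmxDr mulmxA mulmx_sumr; congr (_ + _).
by apply: eq_bigr => i _; rewrite mulmxA.
Qed.

Lemma rough_sumB a b (Z1 Z2 : R -> 'M[R]_(n, d)) Z1' Z2' s :
  rough_sum W a b (fun r => Z1 r - Z2 r) (fun r v => Z1' r v - Z2' r v) s =
  rough_sum W a b Z1 Z1' s - rough_sum W a b Z2 Z2' s.
Proof.
rewrite /rough_sum -sumrB; apply: eq_bigr => k _.
rewrite mulmxBl opprD addrACA -sumrB; congr (_ + _).
by apply: eq_bigr => i _; rewrite mulmxBl.
Qed.

Lemma mx_cvg_lim (T : Type) (F : set_system T) (FF : ProperFilter F) m p (f : T -> 'M[R]_(m, p))
  (l : 'M[R]_(m, p)) : f x @[x --> F] --> l -> lim (f x @[x --> F]) = l.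
Proof. by move=> h; apply: cvg_lim => //; exact: norm_hausdorff. Qed.

Lemma rough_int_mulmx m a b (M : 'M[R]_(m, n)) (Z : R -> 'M[R]_(n, d)) Z' :
  a <= b ->
  rough_sum W a b Z Z' s @[s --> mesh_filter a b] --> rough_int W a b Z Z' ->
  rough_int W a b (fun r => M *m Z r) (fun r v => M *m Z' r v) =
  M *m rough_int W a b Z Z'.
Proof.
move=> ab h; have PF := mesh_filter_proper ab.
apply: mx_cvg_lim; rewrite (_ : rough_sum _ _ _ _ _ =
  fun s => M *m rough_sum W a b Z Z' s); first exact: cvg_mulmx.
by apply/funext => s; rewrite rough_sum_mulmx.
Qed.

Lemma rough_intB a b (Z1 Z2 : R -> 'M[R]_(n, d)) Z1' Z2' : a <= b ->
  rough_sum W a b Z1 Z1' s @[s --> mesh_filter a b] --> rough_int W a b Z1 Z1' ->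
  rough_sum W a b Z2 Z2' s @[s --> mesh_filter a b] --> rough_int W a b Z2 Z2' ->
  rough_int W a b (fun r => Z1 r - Z2 r) (fun r v => Z1' r v - Z2' r v) =
  rough_int W a b Z1 Z1' - rough_int W a b Z2 Z2'.
Proof.
move=> ab h1 h2; have PF := mesh_filter_proper ab.
apply: mx_cvg_lim; rewrite (_ : rough_sum _ _ _ _ _ =
  fun s => rough_sum W a b Z1 Z1' s - rough_sum W a b Z2 Z2' s).
  exact: cvgB.
by apply/funext => s; rewrite rough_sumB.
Qed.

Lemma eq_rough_int a b (Z1 Z2 : R -> 'M[R]_(n, d)) Z1' Z2' :
  (forall r, Z1 r = Z2 r) -> (forall r v, Z1' r v = Z2' r v) ->
  rough_int W a b Z1 Z1' = rough_int W a b Z2 Z2'.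
Proof.
move=> /funext -> h; have -> // : Z1' = Z2'.
by apply/funext => r; apply/funext => v.
Qed.

End RoughIntegralLinear.

(** * Series of matrices and the matrix exponential *)

Section MatrixSeries.
Context {R : realType}.

Lemma series_mx_cvg p q (u : nat -> 'M[R]_(p, q)) (v : nat -> R) :
  (forall k, `|u k| <= v k) -> cvgn (series v) -> cvgn (series u).
Proof.
move=> uv /cvg_cauchy/cauchy_seriesP cv.
apply/cauchy_cvgP; apply/cauchy_seriesP => e e0.
have := cv e e0; apply: filterS => -[a b] /=; apply: le_lt_trans.
rewrite (le_trans (ler_norm_sum _ _ _))//.
rewrite (le_trans _ (ler_norm _))//.
by apply: ler_sum => k _.
Qed.

Lemma cvgn_norm_le p q (u : nat -> 'M[R]_(p, q)) (l : 'M[R]_(p, q)) c :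
  u x @[x --> \oo] --> l -> (forall k, `|u k| <= c) -> `|l| <= c.
Proof.
move=> ul h; apply/ler_addgt0Pr => e e0.
have /cvgrPdist_lt/(_ e e0)[N _ /(_ N (leqnn N)) /= lN] := ul.
rewrite -[l](subrK (u N)) addrC (le_trans (ler_normD _ _))// lerD//.
exact: ltW.
Qed.

Lemma mx_cvgn_lim p q (u : nat -> 'M[R]_(p, q)) (l : 'M[R]_(p, q)) :
  u x @[x --> \oo] --> l -> limn u = l.
Proof. exact: mx_cvg_lim. Qed.

(** The Cauchy product with its error: the index pairs with i + j < N assemble to the binomial
    expansion of s + t, and the rest of the square is the tail. With [g] in any module the identity
    applies both to the powers of a matrix and to their scalar majorants. *)
Lemma exp_double_sum (V : lmodType R) (s t : R) (g : nat -> V) N :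
  \sum_(0 <= i < N) \sum_(0 <= j < N)
     (i`!%:R^-1 * s ^+ i * (j`!%:R^-1 * t ^+ j)) *: g (i + j)%N =
  \sum_(0 <= k < N) (k`!%:R^-1 * (s + t) ^+ k) *: g k +
  \sum_(0 <= i < N) \sum_(0 <= j < N | ~~ (i + j < N)%N)
     (i`!%:R^-1 * s ^+ i * (j`!%:R^-1 * t ^+ j)) *: g (i + j)%N.
Proof.
set f := fun i j => (i`!%:R^-1 * s ^+ i * (j`!%:R^-1 * t ^+ j)).
under eq_bigr => i _ do rewrite (bigID (fun j => (i + j < N)%N)) /=.
rewrite big_split /=; congr (_ + _).
have E i : (i < N)%N -> \sum_(0 <= j < N | (i + j < N)%N) f i j *: g (i + j)%N =
    \sum_(0 <= k < N | (i <= k)%N) f i (k - i)%N *: g k.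
  move=> iN; transitivity (\sum_(i <= k < N) f i (k - i)%N *: g k); last first.
    by rewrite (@big_nat_widenl _ _ _ i 0 N xpredT).
  have := @big_addn V 0 +%R 0 N i xpredT (fun k => f i (k - i)%N *: g k).
  rewrite add0n => ->.
  rewrite (@big_nat_widen _ _ _ 0 (N - i) N) ?leq_subr//.
  apply: eq_big => [j|j _]; first by rewrite /= ltn_subRL.
  by rewrite addnK addnC.
rewrite big_nat; under eq_bigr => i iN do rewrite E//.
rewrite -big_nat (exchange_big_dep_nat xpredT)//=; apply: eq_big_nat => k kN.
rewrite -scaler_suml; congr (_ *: _).
rewrite addrC exprDn mulr_sumr.
rewrite -(big_mkord xpredT (fun i => (k`!%:R)^-1 * (t ^+ (k - i) * s ^+ i *+ 'C(k, i)))).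
rewrite (@big_nat_widen _ _ _ 0 k.+1 N)//.
apply: eq_big => [i|i ik]; first by rewrite /= ltnS.
rewrite /f -[_ *+ 'C(k, i)]mulr_natl.
have -> : 'C(k, i)%:R = (k`!%:R / (i`!%:R * (k - i)`!%:R)) :> R.
  by rewrite -(bin_fact ik) !natrM mulfK// mulf_neq0// pnatr_eq0 -lt0n fact_gt0.
by field; rewrite !pnatr_eq0 -!lt0n !fact_gt0.
Qed.

End MatrixSeries.

Section MatrixExponential.
Context {R : realType} {n : nat}.
Implicit Types A B : 'M[R]_n.

Definition exp_term A (k : nat) : 'M[R]_n := (k`!%:R)^-1 *: A ^+ k.

Let c A : R := n%:R * `|A|.

Lemma expr_mx_norm A k : `|A ^+ k| <= c A ^+ k.
Proof.
elim: k => [|k ih].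
  rewrite !expr0; apply: mxnorm_le => // i j.
  by rewrite mxE; case: (_ == _); rewrite ?normr1 ?normr0.
rewrite !exprS (le_trans (mulmx_norm _ _))// ler_wpM2l// /c mulr_ge0//.
Qed.

Lemma exp_term_norm A k : `|exp_term A k| <= exp_coeff (c A) k.
Proof.
rewrite normrZ /exp_coeff /= mulrC ger0_norm ?invr_ge0// ler_wpM2r ?invr_ge0//.
exact: expr_mx_norm.
Qed.

Lemma expmx_cvg A : series (exp_term A) x @[x --> \oo] --> expmx A.
Proof. by apply: series_mx_cvg (exp_term_norm A) (is_cvg_series_exp_coeff _). Qed.
Arguments expmx_cvg : clear implicits.

Lemma exp_series_le (x : R) N : 0 <= x -> series (exp_coeff x) N <= expR x.
Proof.
move=> x0; apply: nondecreasing_cvgn_le (is_cvg_series_exp_coeff x) N.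
by apply: nondecreasing_series => k _ _; rewrite divr_ge0// exprn_ge0.
Qed.

Lemma expmx_norm A : `|expmx A| <= expR (c A).
Proof.
apply: (cvgn_norm_le (expmx_cvg A)) => N.
rewrite (le_trans _ (exp_series_le N _))//; last by rewrite mulr_ge0.
rewrite (le_trans (ler_norm_sum _ _ _))//; apply: ler_sum => k _.
exact: exp_term_norm.
Qed.

Lemma expmx_sub1_norm A : `|expmx A - 1%:M| <= c A * expR (c A).
Proof.
have cA0 : 0 <= c A by rewrite mulr_ge0.
have h : (series (exp_term A) x.+1 - 1%:M) @[x --> \oo] --> expmx A - 1%:M.
  by apply: cvgB; [rewrite (cvg_shiftS (series (exp_term A)) )|exact: cvg_cst]; exact: expmx_cvg.
apply: (cvgn_norm_le h) => N.
rewrite /series/= big_nat_recl// [exp_term A 0]/exp_term expr0 fact0 invr1 scale1r.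
rewrite addrC addKr (le_trans (ler_norm_sum _ _ _))//.
rewrite (@le_trans _ _ (expR (c A) - 1))//.
  have := exp_series_le N.+1 cA0.
  rewrite /series/= big_nat_recl// {1}/exp_coeff/= expr0 fact0 divr1 -lerBrDl.
  by apply: le_trans; apply: ler_sum => k _; exact: exp_term_norm.
(* The inequality 1 - c <= e^-c, multiplied by e^c, gives e^c - 1 <= c e^c. *)
have := expR_ge1Dx (- c A); rewrite expRN => h1.
have : (1 - c A) * expR (c A) <= 1.
  by rewrite -ler_pdivlMr ?expR_gt0// div1r.
by rewrite mulrBl mul1r; lra.
Qed.

(** By [exp_double_sum] the partial sums fail to be multiplicative by a tail, dominated term by term
    by the tail of the scalar series at |s| c and |t| c. The scalar tail tends to 0 because [expR]
    is multiplicative. *)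
Lemma expmxD A (s t : R) : expmx ((s + t) *: A) = expmx (s *: A) *m expmx (t *: A).
Proof.
have TE (r : R) k : exp_term (r *: A) k = (k`!%:R^-1 * r ^+ k) *: A ^+ k.
  rewrite /exp_term -scalerA; congr (_ *: _).
  elim: k => [|k ih]; first by rewrite !expr0 scale1r.
  by rewrite !exprS ih -!mulmxE -scalemxAl -scalemxAr scalerA.
apply/eqP; rewrite eq_sym -subr_eq0 -normr_le0.
pose x := `|s| * c A; pose y := `|t| * c A.
have cA0 : 0 <= c A by rewrite mulr_ge0.
have key N : `|series (exp_term (s *: A)) N *m series (exp_term (t *: A)) N -
      series (exp_term ((s + t) *: A)) N| <=
    series (exp_coeff x) N * series (exp_coeff y) N - series (exp_coeff (x + y)) N.
  have -> : series (exp_coeff (x + y)) N =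
      \sum_(0 <= k < N) (k`!%:R^-1 * (`|s| + `|t|) ^+ k) *: (c A ^+ k : R^o).
    by apply: eq_bigr => k _; rewrite /exp_coeff /= -mulrDl exprMn /GRing.scale/=; ring.
  have -> : series (exp_coeff x) N * series (exp_coeff y) N =
      \sum_(0 <= i < N) \sum_(0 <= j < N) (i`!%:R^-1 * `|s| ^+ i *
         (j`!%:R^-1 * `|t| ^+ j)) *: (c A ^+ (i + j) : R^o).
    rewrite /series/= mulr_suml; apply: eq_bigr => i _.
    rewrite mulr_sumr; apply: eq_bigr => j _.
    rewrite /exp_coeff /= /x /y; move: (c A) => cA.
    by rewrite !exprMn exprD /GRing.scale/=; ring.
  have -> : series (exp_term (s *: A)) N *m series (exp_term (t *: A)) N =
      \sum_(0 <= i < N) \sum_(0 <= j < N) (i`!%:R^-1 * s ^+ i *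
         (j`!%:R^-1 * t ^+ j)) *: A ^+ (i + j).
    rewrite /series/= mulmx_suml; apply: eq_bigr => i _.
    rewrite mulmx_sumr; apply: eq_bigr => j _.
    by rewrite !TE -scalemxAl -scalemxAr scalerA exprD.
  have -> : series (exp_term ((s + t) *: A)) N =
      \sum_(0 <= k < N) (k`!%:R^-1 * (s + t) ^+ k) *: A ^+ k.
    by apply: eq_bigr => k _; rewrite TE.
  rewrite !exp_double_sum [X in `|X|]addrAC subrr add0r.
  rewrite [leRHS]addrAC subrr add0r.
  rewrite (le_trans (ler_norm_sum _ _ _))//; apply: ler_sum => i _.
  rewrite (le_trans (ler_norm_sum _ _ _))//; apply: ler_sum => j _.
  rewrite normrZ !normrM !normfV !normrX !normr_nat ler_wpM2l ?expr_mx_norm//.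
have lim0 : (series (exp_coeff x) N * series (exp_coeff y) N -
    series (exp_coeff (x + y)) N) @[N --> \oo] --> 0.
  have h z := is_cvg_series_exp_coeff z.
  rewrite -[X in _ --> X](subrr (expR (x + y))).
  apply: cvgB; last exact: h.
  by rewrite expRD; apply: cvgM; exact: h.
have limM : (series (exp_term (s *: A)) N *m series (exp_term (t *: A)) N -
      series (exp_term ((s + t) *: A)) N) @[N --> \oo] -->
   expmx (s *: A) *m expmx (t *: A) - expmx ((s + t) *: A).
  apply: cvgB; last exact: expmx_cvg.
  have d1 : (series (exp_term (s *: A)) N *m (series (exp_term (t *: A)) N - expmx (t *: A)))
     @[N --> \oo] --> (0 : 'M[R]_n).
    apply/cvgrPdist_lt => e e0.
    pose C := n%:R * expR (c (s *: A)) + 1.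
    have C0 : 0 < C by rewrite ltr_pwDr// mulr_ge0// expR_ge0.
    have /cvgrPdist_lt/(_ (e / C) (divr_gt0 e0 C0)) := expmx_cvg (t *: A).
    apply: filterS => N; rewrite sub0r normrN -normrN opprB => hN.
    rewrite (le_lt_trans (mulmx_norm _ _))//.
    rewrite (@le_lt_trans _ _ (C * `|series (exp_term (t *: A)) N - expmx (t *: A)|))//.
      rewrite ler_wpM2r// /C (@le_trans _ _ (n%:R * expR (c (s *: A))))// ?lerDl//.
      rewrite ler_wpM2l// (le_trans _ (exp_series_le N _))//; last by rewrite mulr_ge0.
      rewrite (le_trans (ler_norm_sum _ _ _))//; apply: ler_sum => k _.
      exact: exp_term_norm.
    by rewrite mulrC -ltr_pdivlMr.
  have d2 : (series (exp_term (s *: A)) N *m expmx (t *: A)) @[N --> \oo] -->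
      expmx (s *: A) *m expmx (t *: A).
    apply/cvgrPdist_lt => e e0.
    pose C := n%:R * `|expmx (t *: A)| + 1.
    have C0 : 0 < C by rewrite ltr_pwDr// mulr_ge0.
    have /cvgrPdist_lt/(_ (e / C) (divr_gt0 e0 C0)) := expmx_cvg (s *: A).
    apply: filterS => N hN; rewrite -mulmxBl (le_lt_trans (mulmx_norm _ _))//.
    rewrite mulrAC (@le_lt_trans _ _ (C * `|expmx (s *: A) - series (exp_term (s *: A)) N|))//.
      by rewrite ler_wpM2r// lerDl.
    by rewrite mulrC -ltr_pdivlMr.
  rewrite (_ : (fun N => _) = (fun N => series (exp_term (s *: A)) N *m
     (series (exp_term (t *: A)) N - expmx (t *: A)) +
     series (exp_term (s *: A)) N *m expmx (t *: A))); last first.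
    by apply/funext => N; rewrite -mulmxDr subrK.
  by rewrite -[X in _ --> X]add0r; exact: cvgD.
apply/ler_addgt0Pr => e e0; rewrite add0r.
have e2 : 0 < e / 2 by rewrite divr_gt0.
have /cvgrPdist_lt/(_ _ e2)[N1 _ h1] := limM.
have /cvgrPdist_lt/(_ _ e2)[N2 _ h2] := lim0.
have {}h1 := h1 (maxn N1 N2) (leq_maxl _ _); have {}h2 := h2 (maxn N1 N2) (leq_maxr _ _).
move: h1 h2 => /=; set N := maxn N1 N2; rewrite sub0r normrN => h1 h2.
have h3 := le_lt_trans (le_trans (key N) (ler_norm _)) h2.
set a := series _ _ *m _ - _ in h1 h3.
rewrite -[X in `|X|](subrK a) (le_trans (ler_normD _ _))//; lra.
Qed.

Lemma expmx0 A : expmx (0 *: A) = 1%:M.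
Proof.
apply/eqP; rewrite -subr_eq0 -normr_le0 (le_trans (expmx_sub1_norm _))//.
by rewrite scale0r /c normr0 mulr0 mul0r.
Qed.

Lemma expmx_comm A B : A *m B = B *m A -> expmx A *m B = B *m expmx A.
Proof.
move=> AB.
have h1 : (B *m series (exp_term A) N) @[N --> \oo] --> B *m expmx A.
  by apply: cvg_mulmx; exact: expmx_cvg.
apply/eqP; rewrite -subr_eq0 -normr_le0; apply/ler_addgt0Pr => e e0; rewrite add0r.
have TB N : series (exp_term A) N *m B = B *m series (exp_term A) N.
  rewrite /series/= mulmx_suml mulmx_sumr; apply: eq_bigr => k _.
  rewrite /exp_term -scalemxAl -scalemxAr; congr (_ *: _).
  elim: k => [|k ih]; first by rewrite !expr0 mul1mx mulmx1.
  by rewrite exprS -mulmxE -mulmxA ih mulmxA AB -mulmxA.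
pose C := 2 * (n%:R * `|B|) + 1.
have C0 : 0 < C by rewrite ltr_pwDr// !mulr_ge0.
have /cvgrPdist_lt/(_ (e / C) (divr_gt0 e0 C0))[N _ /(_ N (leqnn N)) /= hN] := expmx_cvg A.
have -> : expmx A *m B - B *m expmx A = (expmx A - series (exp_term A) N) *m B -
    B *m (expmx A - series (exp_term A) N).
  by rewrite mulmxBl mulmxBr TB opprB addrA subrK.
rewrite (le_trans (ler_normB _ _))// (le_trans (lerD (mulmx_norm _ _) (mulmx_norm _ _)))//.
set z := `|_ - _| in hN *.
have -> : n%:R * z * `|B| + n%:R * `|B| * z = (C - 1) * z by rewrite /C; ring.
rewrite (@le_trans _ _ (C * z))//; first by apply: ler_wpM2r; [exact: normr_ge0|rewrite gerBl].
by rewrite mulrC -ler_pdivlMr// ltW.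
Qed.

Lemma expmx_lipschitz A : exists2 C : R, 0 <= C &
  forall s t : R, `|s| <= 1 -> `|t| <= 1 ->
    `|expmx (t *: A)| <= C /\ `|expmx (t *: A) - expmx (s *: A)| <= C * `|t - s|.
Proof.
have cA0 : 0 <= c A by rewrite mulr_ge0.
pose M := expR (2 * c A).
have M0 : 0 <= M by exact: expR_ge0.
have cE (r : R) : c (r *: A) = `|r| * c A by rewrite /c normrZ; ring.
have bd (t : R) : `|t| <= 1 -> `|expmx (t *: A)| <= M.
  move=> t1; rewrite (le_trans (expmx_norm _))// ler_expR cE.
  by rewrite ler_wpM2r// (le_trans t1)// ler1n.
have d0 : 0 <= n%:R * M * (c A * M) by rewrite !mulr_ge0.
exists (M + n%:R * M * (c A * M)); first by rewrite addr_ge0.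
move=> s t s1 t1; split; first by rewrite (le_trans (bd _ t1))// lerDl.
have -> : expmx (t *: A) - expmx (s *: A) =
    expmx (s *: A) *m (expmx ((t - s) *: A) - 1%:M).
  by rewrite mulmxBr mulmx1 -expmxD (addrC s) subrK.
rewrite (le_trans (mulmx_norm _ _))//.
have ts2 : `|t - s| <= 2 by rewrite (le_trans (ler_normB _ _))//; lra.
have E : `|expmx ((t - s) *: A) - 1%:M| <= `|t - s| * (c A * M).
  rewrite (le_trans (expmx_sub1_norm _))// cE -mulrA.
  by rewrite ler_wpM2l// ler_wpM2l// ler_expR ler_wpM2r.
rewrite (@le_trans _ _ (n%:R * M * (`|t - s| * (c A * M))))//.
  by apply: ler_pM => //; rewrite ler_wpM2l// bd.
rewrite mulrDl mulrCA mulrC [leRHS]addrC lerDl mulr_ge0//.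
Qed.

End MatrixExponential.

(** * Continuity on [0, 1] and the Lebesgue integral of vector paths *)

Section VectorIntegral.
Context {R : realType}.

(** Continuity of the restriction to [0, 1]: nothing is known about a controlled path outside that
    interval. *)
Definition cont01 (p q : nat) (f : R -> 'M[R]_(p, q)) : Prop :=
  forall t, 0 <= t <= 1 -> forall e : R, 0 < e ->
  exists2 del : R, 0 < del &
  forall s, 0 <= s <= 1 -> `|t - s| < del -> `|f t - f s| < e.

Lemma cont01_mulmx p q r (M : R -> 'M[R]_(p, q)) (f : R -> 'M[R]_(q, r)) :
  cont01 M -> cont01 f -> cont01 (fun t => M t *m f t).
Proof.
move=> cM cf t t01 e e0.
pose C := q%:R * (`|M t| + `|f t| + 1) + 1.
have C0 : 0 < C by rewrite ltr_pwDr// !mulr_ge0// !addr_ge0.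
have e2 : 0 < Num.min 1 (e / (2 * C)) by rewrite lt_min ltr01 divr_gt0// mulr_gt0.
have [d1 d10 h1] := cM t t01 _ e2.
have [d2 d20 h2] := cf t t01 _ e2.
exists (Num.min d1 d2); first by rewrite lt_min d10.
move=> s s01; rewrite lt_min => /andP[/(h1 _ s01) + /(h2 _ s01)].
rewrite !lt_min => /andP[_ H1] /andP[H21 H2].
have -> : M t *m f t - M s *m f s = M t *m (f t - f s) + (M t - M s) *m f s.
  by rewrite mulmxBr mulmxBl addrA subrK.
have fs : `|f s| <= `|f t| + 1.
  rewrite -[f s](subKr (f t)) (le_trans (ler_normB _ _))// lerD2l ltW//.
rewrite (le_lt_trans (ler_normD _ _))//.
rewrite (le_lt_trans (lerD (mulmx_norm _ _) (mulmx_norm _ _)))//.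
have E1 : q%:R * `|M t| * `|f t - f s| <= q%:R * `|M t| * (e / (2 * C)).
  by rewrite ler_wpM2l ?mulr_ge0// ltW.
have E2 : q%:R * `|M t - M s| * `|f s| <= q%:R * (e / (2 * C)) * (`|f t| + 1).
  by rewrite ler_pM ?mulr_ge0// ler_wpM2l// ltW.
rewrite (le_lt_trans (lerD E1 E2))//.
have zE : C * (e / (2 * C)) = e / 2 by field; rewrite gt_eqF.
have z0 : 0 < e / (2 * C) by rewrite divr_gt0// mulr_gt0.
move: (e / (2 * C)) zE z0 => z zE z0.
have -> : q%:R * `|M t| * z + q%:R * z * (`|f t| + 1) = C * z - z by rewrite /C; ring.
rewrite zE; lra.
Qed.

Lemma cont01_comp p q r k (f : R -> 'M[R]_(p, q)) (g : 'M[R]_(p, q) -> 'M[R]_(r, k)) :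
  continuous g -> cont01 f -> cont01 (g \o f).
Proof.
move=> cg cf t t01 e e0.
have /cvgrPdist_lt/(_ e e0) := cg (f t).
rewrite -nbhs_nearE => /nbhs_ballP[d /= d0 hd].
have [del del0 h] := cf t t01 d d0.
exists del => // s s01 /(h _ s01) fts; apply: (hd (f s)).
by rewrite -ball_normE.
Qed.

Lemma cont01B p q (f g : R -> 'M[R]_(p, q)) :
  cont01 f -> cont01 g -> cont01 (fun t => f t - g t).
Proof.
move=> cf cg t t01 e e0; have e2 : 0 < e / 2 by rewrite divr_gt0.
have [d1 d10 h1] := cf t t01 _ e2.
have [d2 d20 h2] := cg t t01 _ e2.
exists (Num.min d1 d2); first by rewrite lt_min d10.
move=> s s01; rewrite lt_min => /andP[/(h1 _ s01) H1 /(h2 _ s01) H2].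
have -> : f t - g t - (f s - g s) = (f t - f s) - (g t - g s).
  by apply/matrixP => i j; rewrite !mxE; ring.
rewrite (le_lt_trans (ler_normB _ _))//; lra.
Qed.

Lemma cont01_holder p q (f : R -> 'M[R]_(p, q)) (B a : R) : 0 < a ->
  (forall s t, 0 <= s -> s <= t -> t <= 1 -> `|f t - f s| <= B * (t - s) `^ a) ->
  cont01 f.
Proof.
move=> a0 h t t01 e e0.
have B0 : 0 <= B.
  have := h 0 1 (lexx _) ler01 (lexx _); rewrite subr0 powR1 mulr1.
  exact: le_trans.
have C0 : 0 < B + 1 by rewrite ltr_wpDl.
(* The solution of (B + 1) del^a = e; adding 1 avoids a division by 0. *)
exists ((e / (B + 1)) `^ a^-1); first by rewrite powR_gt0// divr_gt0.
have key (s u : R) : 0 <= s -> s <= u -> u <= 1 -> u - s < (e / (B + 1)) `^ a^-1 ->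
    `|f u - f s| < e.
  move=> s0 su u1 us; rewrite (le_lt_trans (h _ _ s0 su u1))//.
  rewrite (@le_lt_trans _ _ ((B + 1) * (u - s) `^ a))//.
    by rewrite ler_wpM2r ?powR_ge0// lerDl.
  rewrite mulrC -ltr_pdivlMr//.
  have -> : e / (B + 1) = ((e / (B + 1)) `^ a^-1) `^ a.
    by rewrite -powRrM mulVf ?gt_eqF// powRr1// ltW// divr_gt0.
  by apply: gt0_ltr_powR; rewrite ?nnegrE ?subr_ge0 ?powR_ge0.
move=> s /andP[s0 s1] ts; have /andP[t0 t1] := t01.
have [st|/ltW st] := leP s t.
  by apply: key => //; rewrite ger0_norm ?subr_ge0 in ts.
by rewrite -normrN opprB; apply: key => //; rewrite ler0_norm ?subr_le0// opprB in ts.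
Qed.

Notation mu := (@lebesgue_measure R).

Lemma cont01_integrable n (f : R -> 'cV[R]_n) i a b : cont01 f -> 0 <= a -> b <= 1 ->
  mu.-integrable `[a, b] (EFin \o (fun r => f r i 0)).
Proof.
move=> cf a0 b1.
have sub : `[a, b]%classic `<=` `[0, 1]%classic.
  by apply: subset_itvScc.
apply: (@integrableS _ _ _ mu `[0, 1] `[a, b]) => //.
apply: continuous_compact_integrable; first exact: segment_compact.
apply/subspace_continuousP => t /=; rewrite in_itv/= => t01.
apply/cvgrPdist_lt => e e0; have [d d0 h] := cf t t01 e e0.
rewrite /within/= -nbhs_nearE; apply/nbhs_ballP; exists d => //= s ts.
rewrite in_itv/= => s01.
have := mxnorm_coord (f t - f s) i 0; rewrite !mxE => /le_lt_trans; apply.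
by apply: h => //; move: ts; rewrite /ball/=.
Qed.

Lemma vint_additive n (f : R -> 'cV[R]_n) a b c : cont01 f ->
  0 <= a -> a <= b -> b <= c -> c <= 1 -> vint a c f = vint a b f + vint b c f.
Proof.
move=> cf a0 ab bc c1; apply/matrixP => i j; rewrite !mxE.
have ic := cont01_integrable i cf a0 c1.
have := @Rintegral_itvB R (fun r => f r i 0) (BLeft a) (BRight c) b ic.
rewrite !bnd_simp => /(_ ab bc) h.
rewrite -[LHS](subrK (\int[mu]_(r in `[a, b]) f r i 0)) h addrC; congr (_ + _).
rewrite Rintegral_itv_obnd_cbnd//; apply: integrableS ic => //.
by apply: subset_itvr; rewrite bnd_simp.
Qed.

Lemma vintB n (f g : R -> 'cV[R]_n) a b : cont01 f -> cont01 g -> 0 <= a -> b <= 1 ->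
  vint a b (fun r => f r - g r) = vint a b f - vint a b g.
Proof.
move=> cf cg a0 b1; apply/matrixP => i j; rewrite !mxE.
under eq_Rintegral => x _ do rewrite !mxE.
by rewrite RintegralB//; exact: cont01_integrable.
Qed.

(** Integrability of the sum is part of the conclusion because additivity of the integral asks for
    it in the induction step. *)
Lemma Rintegral_sum (I : Type) (r : seq I) (g : I -> R -> R) (D : set R) :
  measurable D -> (forall k, mu.-integrable D (EFin \o g k)) ->
  mu.-integrable D (EFin \o (fun x => \sum_(k <- r) g k x)) /\
  \int[mu]_(x in D) (\sum_(k <- r) g k x) = \sum_(k <- r) \int[mu]_(x in D) g k x.
Proof.
move=> mD ig; elim: r => [|k r [ih1 ih2]].
  split.
    rewrite (_ : _ \o _ = cst 0%E); first exact: integrable0.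
    by apply/funext => x /=; rewrite big_nil.
  rewrite big_nil; under eq_Rintegral => x _ do rewrite big_nil.
  by rewrite Rintegral_cst// mul0r.
split.
  rewrite (_ : _ \o _ = (EFin \o g k) \+ (EFin \o (fun x => (\sum_(k <- r) g k x)%R)))%E.
    exact: integrableD.
  by apply/funext => x /=; rewrite big_cons.
rewrite big_cons -ih2 -RintegralD//.
by apply: eq_Rintegral => x _; rewrite big_cons.
Qed.

Lemma vint_mulmx n m (M : 'M[R]_(m, n)) (f : R -> 'cV[R]_n) a b : cont01 f ->
  0 <= a -> b <= 1 -> vint a b (fun r => M *m f r) = M *m vint a b f.
Proof.
move=> cf a0 b1; apply/matrixP => i j; rewrite !mxE.
under eq_Rintegral => x _ do rewrite !mxE.
have intk k : mu.-integrable `[a, b] (EFin \o (fun r => M i k * f r k 0)).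
  have := cont01_integrable k cf a0 b1 => h.
  rewrite (_ : _ \o _ = (fun x => (M i k)%:E * (EFin \o (fun r => f r k ord0)) x)%E)//.
  exact: integrableZl.
have [_ ->] := Rintegral_sum (index_enum 'I_n) (measurable_itv `[a, b]) intk.
apply: eq_bigr => k _; rewrite !mxE RintegralZl//.
exact: cont01_integrable.
Qed.

Lemma vint_norm n (f : R -> 'cV[R]_n) a b B : cont01 f ->
  0 <= a -> a <= b -> b <= 1 -> 0 <= B -> (forall r, a <= r -> r <= b -> `|f r| <= B) ->
  `|vint a b f| <= B * (b - a).
Proof.
move=> cf a0 ab b1 B0 h; apply: mxnorm_le => [|i j]; first by rewrite mulr_ge0// subr_ge0.
rewrite mxE; have ic := cont01_integrable i cf a0 b1.
rewrite (le_trans (le_normr_Rintegral _ ic))//.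
have -> : B * (b - a) = \int[mu]_(x in `[a, b]) (cst B x).
  rewrite Rintegral_cst//= lebesgue_measure_itv/= lte_fin.
  have [//|ba] := ltP a b; have -> : b = a by apply/eqP; rewrite eq_le ab ba.
  by rewrite subrr.
apply: le_Rintegral => //.
- rewrite (_ : _ \o _ = abse \o (EFin \o (fun r => f r i 0))); first exact: integrable_abse.
  by apply/funext.
- have cc : cont01 (fun=> const_mx B : 'cV[R]_n).
    by move=> t _ e e0; exists 1 => // s _ _; rewrite subrr normr0.
  have := cont01_integrable i cc a0 b1.
  by rewrite (_ : _ \o _ = EFin \o cst B)//; apply/funext => x /=; rewrite mxE.
- move=> x /=; rewrite in_itv/= => /andP[ax xb].
  by rewrite (le_trans (mxnorm_coord _ _ _))// h.
Qed.

End VectorIntegral.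

(** * Integrals over one block against a Lipschitz kernel *)

Section Convolution.
Context {R : realType}.

Lemma powR_le_exp (x a b : R) : 0 <= x -> x <= 1 -> 0 < a -> a <= b -> x `^ b <= x `^ a.
Proof.
rewrite le_eqVlt => /predU1P[<- _ a0 ab|x0 x1 a0 ab].
  by rewrite !powR0 ?gt_eqF// (lt_le_trans a0).
by apply: ger_powR => //; rewrite x0.
Qed.

Lemma le_powR_exp (x a : R) : 0 <= x -> x <= 1 -> 0 < a -> a <= 1 -> x <= x `^ a.
Proof. by move=> x0 x1 a0 a1; rewrite -[leLHS]powRr1// powR_le_exp. Qed.

Definition lip01 (p q : nat) (C : R) (E : R -> 'M[R]_(p, q)) : Prop :=
  forall s t, 0 <= s -> s <= t -> t <= 1 ->
  `|E s| <= C /\ `|E t - E s| <= C * (t - s).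

Lemma lip01_ge0 p q (C : R) (E : R -> 'M[R]_(p, q)) : lip01 C E -> 0 <= C.
Proof.
by move=> /(_ 0 0 (lexx _) (lexx _) ler01)[+ _]; exact: le_trans.
Qed.

Lemma lip01_cont p q (C : R) (E : R -> 'M[R]_(p, q)) : lip01 C E -> cont01 E.
Proof.
move=> h; apply: (@cont01_holder _ _ _ _ C 1) => // s t s0 st t1.
by rewrite powRr1 ?subr_ge0//; have [] := h s t s0 st t1.
Qed.

Lemma lip01_mulr p q r (C : R) (E : R -> 'M[R]_(p, q)) (P : 'M[R]_(q, r)) :
  lip01 C E -> lip01 (q%:R * `|P| * C) (fun t => E t *m P).
Proof.
move=> h s t s0 st t1; have [h1 h2] := h s t s0 st t1; split.
  by rewrite (le_trans (mulmx_norm _ _))// mulrAC ler_wpM2l// mulr_ge0.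
rewrite -mulmxBl (le_trans (mulmx_norm _ _))// mulrAC -[leRHS]mulrA.
by apply: ler_wpM2l; rewrite ?mulr_ge0.
Qed.

Lemma expmx_lip01 n (A : 'M[R]_n) :
  exists2 C : R, lip01 C (fun r => expmx (r *: A)) & lip01 C (fun r => expmx ((- r) *: A)).
Proof.
have [C C0 h] := expmx_lipschitz A; exists C => s t s0 st t1.
- have s1 : `|s| <= 1 by rewrite ger0_norm// (le_trans st).
  have t1' : `|t| <= 1 by rewrite ger0_norm// (le_trans s0).
  have [h1 _] := h s s s1 s1; have [_ h2] := h s t s1 t1'; split=> //.
  by rewrite (le_trans h2)// ger0_norm// subr_ge0.
- have s1 : `|- s| <= 1 by rewrite normrN ger0_norm// (le_trans st).
  have t1' : `|- t| <= 1 by rewrite normrN ger0_norm// (le_trans s0).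
  have [h1 _] := h _ _ s1 s1; have [_ h2] := h _ _ s1 t1'; split=> //.
  by rewrite (le_trans h2)// opprK addrC -normrN opprB ger0_norm// subr_ge0.
Qed.

(** The kernel acts as a controlled path with derivative 0: as 2 gamma <= 1, its Lipschitz
    increments are of the order of a remainder. *)
Lemma ctrl_mulmx d p q r gamma (W : R -> 'cV[R]_d) (C B : R)
    (E : R -> 'M[R]_(p, q)) (Z : R -> 'M[R]_(q, r)) Z' :
  0 < gamma -> 2 * gamma <= 1 -> lip01 C E -> ctrl gamma W B Z Z' ->
  ctrl gamma W (2 * q%:R * C * B) (fun t => E t *m Z t) (fun t v => E t *m Z' t v).
Proof.
move=> g0 g1 lE cZ; have C0 := lip01_ge0 lE; have B0 := ctrl_ge0 cZ.
have qCB0 : 0 <= q%:R * C * B by rewrite !mulr_ge0.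
have dE : 2 * q%:R * C * B = q%:R * C * B + q%:R * C * B by ring.
have cmp (s t : R) : 0 <= s -> s <= t -> t <= 1 ->
    t - s <= (t - s) `^ gamma /\ t - s <= (t - s) `^ (2 * gamma).
  move=> s0 st t1; split; apply: le_powR_exp; lra.
split.
- move=> t t0 t1; rewrite (le_trans (mulmx_norm _ _))//.
  have [h1 _] := lE t t t0 (lexx _) t1.
  rewrite (@le_trans _ _ (q%:R * C * B))//; last by rewrite dE lerDl.
  by rewrite -!mulrA ler_wpM2l// ler_pM// (ctrl_sup cZ).
- move=> t v t0 t1; rewrite (le_trans (mulmx_norm _ _))//.
  have [h1 _] := lE t t t0 (lexx _) t1.
  rewrite (@le_trans _ _ (q%:R * C * B * `|v|))//; last by rewrite ler_wpM2r// dE lerDl.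
  by rewrite -!mulrA ler_wpM2l// ler_pM// (ctrl_sup' cZ).
- move=> s t v s0 st t1; have t0 := le_trans s0 st.
  have [h1 h2] := lE s t s0 st t1; have [c1 c2] := cmp s t s0 st t1.
  have -> : E t *m Z' t v - E s *m Z' s v =
      (E t - E s) *m Z' t v + E s *m (Z' t v - Z' s v).
    by rewrite mulmxBr mulmxBl addrA subrK.
  rewrite (le_trans (ler_normD _ _))// dE !mulrDl lerD//.
    rewrite (le_trans (mulmx_norm _ _))// -!mulrA ler_wpM2l//.
    rewrite (@le_trans _ _ (C * (t - s) `^ gamma * (B * `|v|)))//; last first.
      by rewrite le_eqVlt; apply/orP; left; apply/eqP; ring.
    apply: ler_pM => //; last exact: (ctrl_sup' cZ).
    by rewrite (le_trans h2)// ler_wpM2l.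
  rewrite (le_trans (mulmx_norm _ _))// -!mulrA ler_wpM2l// ler_pM//.
  by rewrite mulrA (ctrl_holder' cZ).
- move=> s t s0 st t1; have t0 := le_trans s0 st.
  have [h1 h2] := lE s t s0 st t1; have [c1 c2] := cmp s t s0 st t1.
  have -> : E t *m Z t - E s *m Z s - E s *m Z' s (W t - W s) =
      (E t - E s) *m Z t + E s *m (Z t - Z s - Z' s (W t - W s)).
    rewrite !mulmxBr mulmxBl.
    have abel (a b c e : 'M[R]_(p, r)) : a - b - c = a - e + (e - b - c).
      by apply/matrixP => i j; rewrite !mxE; ring.
    exact: abel.
  rewrite (le_trans (ler_normD _ _))// dE (mulrDl (q%:R * C * B)) lerD//.
    rewrite (le_trans (mulmx_norm _ _))// -!mulrA ler_wpM2l//.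
    rewrite (@le_trans _ _ (C * (t - s) `^ (2 * gamma) * B))//; last first.
      by rewrite le_eqVlt; apply/orP; left; apply/eqP; ring.
    apply: ler_pM => //; last exact: (ctrl_sup cZ).
    by rewrite (le_trans h2)// ler_wpM2l.
  rewrite (le_trans (mulmx_norm _ _))// -!mulrA ler_wpM2l// ler_pM//.
  exact: (ctrl_rem cZ).
Qed.

Lemma ctrl_incr d (E : normedModType R) gamma w (W : rpath R d) (B : R) (Z : R -> E) Z' s t :
  0 < gamma -> rough_on gamma w W -> ctrl gamma W.1 B Z Z' -> 0 <= s -> s <= t -> t <= 1 ->
  `|Z t - Z s| <= 2 * (w * B) * (t - s) `^ gamma.
Proof.
move=> g0 rW cZ s0 st t1; have B0 := ctrl_ge0 cZ; have w1 := rough_on_ge1 rW.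
rewrite -[Z t - Z s](subrK (Z' s (W.1 t - W.1 s))) (le_trans (ler_normD _ _))//.
have E1 : `|Z t - Z s - Z' s (W.1 t - W.1 s)| <= w * B * (t - s) `^ gamma.
  rewrite (le_trans (ctrl_rem cZ s0 st t1))// ler_pM ?powR_ge0//.
    by rewrite ler_peMl.
  by apply: powR_le_exp => //; lra.
have E2 : `|Z' s (W.1 t - W.1 s)| <= w * B * (t - s) `^ gamma.
  rewrite (le_trans (ctrl_sup' cZ _ s0 (le_trans st t1)))// (mulrC w) -mulrA ler_wpM2l//.
  exact: (rough_on1 rW).
by rewrite (le_trans (lerD E1 E2))// -mulrDl -mulr2n mulr_natl.
Qed.

(** A drift [phi] bounded by [b1] together with a noise coefficient controlled with constant [b2].
    The size of the block integral is then measured by [b1 + w * b2]. *)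
Record integrand (n d : nat) (gamma w : R) (W : rpath R d) (b1 b2 : R)
    (phi : R -> 'cV[R]_n) (Z : R -> 'M[R]_(n, d)) (Z' : R -> 'cV[R]_d -> 'M[R]_(n, d)) : Prop := {
  ig_gamma3 : 1 < 3 * gamma;
  ig_gamma2 : 2 * gamma <= 1;
  ig_rough : rough_on gamma w W;
  ig_cont : cont01 phi;
  ig_sup : forall t, 0 <= t -> t <= 1 -> `|phi t| <= b1;
  ig_ctrl : ctrl gamma W.1 b2 Z Z';
  ig_lin : forall s, basis_linear (Z' s) }.

Definition bint (n d m : nat) (W : rpath R d) (E : R -> 'M[R]_(m, n)) (phi : R -> 'cV[R]_n)
    (Z : R -> 'M[R]_(n, d)) (Z' : R -> 'cV[R]_d -> 'M[R]_(n, d)) (a b : R) : 'cV[R]_m :=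
  vint a b (fun r => E r *m phi r) +
  rough_int W a b (fun r => E r *m Z r) (fun r v => E r *m Z' r v).

Lemma basis_linear_mulmx n d m p (M : 'M[R]_(m, n)) (f : 'cV[R]_d -> 'M[R]_(n, p)) :
  basis_linear f -> basis_linear (fun v => M *m f v).
Proof.
move=> lf x; rewrite {1}lf mulmx_sumr; apply: eq_bigr => i _.
by rewrite scalemxAr.
Qed.

Section BlockIntegral.
Variables (n d m : nat) (gamma w b1 b2 C : R) (W : rpath R d) (E : R -> 'M[R]_(m, n)).
Variables (phi : R -> 'cV[R]_n) (Z : R -> 'M[R]_(n, d)) (Z' : R -> 'cV[R]_d -> 'M[R]_(n, d)).
Hypothesis lE : lip01 C E.
Hypothesis ig : integrand gamma w W b1 b2 phi Z Z'.

Let g0 : 0 < gamma. Proof. by have := ig_gamma3 ig; lra. Qed.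
Let C0 : 0 <= C. Proof. exact: lip01_ge0 lE. Qed.
Let w1 : 1 <= w. Proof. exact: rough_on_ge1 (ig_rough ig). Qed.
Let w0 : 0 <= w. Proof. exact: le_trans w1. Qed.
Let b10 : 0 <= b1. Proof. exact: le_trans (ig_sup ig (lexx 0) ler01). Qed.
Let b20 : 0 <= b2. Proof. exact: ctrl_ge0 (ig_ctrl ig). Qed.

Let cEZ : ctrl gamma W.1 (2 * n%:R * C * b2) (fun r => E r *m Z r) (fun r v => E r *m Z' r v).
Proof. exact: ctrl_mulmx g0 (ig_gamma2 ig) lE (ig_ctrl ig). Qed.

Let lEZ s : basis_linear (fun v => E s *m Z' s v).
Proof. exact: basis_linear_mulmx (ig_lin ig s). Qed.

Let cphi : cont01 (fun r => E r *m phi r).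
Proof. exact: cont01_mulmx (lip01_cont lE) (ig_cont ig). Qed.

Lemma bint_rough_cvg a b : 0 <= a -> a <= b -> b <= 1 ->
  rough_sum W a b (fun r => E r *m Z r) (fun r v => E r *m Z' r v) s
    @[s --> mesh_filter a b] -->
  rough_int W a b (fun r => E r *m Z r) (fun r v => E r *m Z' r v).
Proof. exact: (rough_int_cvg (ig_gamma3 ig) (ig_rough ig) cEZ lEZ). Qed.

Lemma bint_additive a b c : 0 <= a -> a <= b -> b <= c -> c <= 1 ->
  bint W E phi Z Z' a c = bint W E phi Z Z' a b + bint W E phi Z Z' b c.
Proof.
move=> a0 ab bc c1; rewrite /bint (vint_additive cphi a0 ab bc c1).
rewrite (rough_int_additive (ig_gamma3 ig) (ig_rough ig) cEZ lEZ a0 ab bc c1).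
by rewrite addrACA.
Qed.

Lemma bint_mulmx p (M : 'M[R]_(p, m)) a b : 0 <= a -> a <= b -> b <= 1 ->
  bint W (fun r => M *m E r) phi Z Z' a b = M *m bint W E phi Z Z' a b.
Proof.
move=> a0 ab b1'; rewrite /bint mulmxDr -(rough_int_mulmx _ ab (bint_rough_cvg a0 ab b1')).
congr (_ + _).
  rewrite -(vint_mulmx M cphi a0 b1'); congr (vint a b _).
  by apply/funext => r; rewrite mulmxA.
by apply: eq_rough_int => [r|r v]; rewrite mulmxA.
Qed.

Definition bint_cst : R :=
  n%:R * C + (d%:R + d%:R ^+ 2) * (1 + sew_cst (3 * gamma)) * (2 * n%:R * C).

Let phi_bd r : 0 <= r -> r <= 1 -> `|E r *m phi r| <= n%:R * C * b1.
Proof.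
move=> r0 r1; rewrite (le_trans (mulmx_norm _ _))// -!mulrA ler_wpM2l// ler_pM//.
  by have [] := lE r0 (lexx r) r1.
exact: (ig_sup ig).
Qed.

Let vint_bd a b : 0 <= a -> a <= b -> b <= 1 ->
  `|vint a b (fun r => E r *m phi r)| <= n%:R * C * b1 * (b - a).
Proof.
move=> a0 ab b1'; apply: vint_norm => //; first by rewrite !mulr_ge0.
by move=> r ar rb; rewrite phi_bd ?(le_trans a0)// (le_trans rb).
Qed.

Lemma bint_norm a b : 0 <= a -> a <= b -> b <= 1 ->
  `|bint W E phi Z Z' a b| <= bint_cst * (b1 + w * b2).
Proof.
move=> a0 ab b1'; rewrite (le_trans (ler_normD _ _))//.
have E1 : `|vint a b (fun r => E r *m phi r)| <= n%:R * C * b1.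
  rewrite (le_trans (vint_bd a0 ab b1'))//.
  apply: ler_piMr; [by rewrite !mulr_ge0|lra].
have E2 := rough_int_norm (ig_gamma3 ig) (ig_rough ig) cEZ lEZ a0 ab b1'.
have s0 : 0 <= sew_cst (3 * gamma) by rewrite sew_cst_ge0// (ig_gamma3 ig).
rewrite (le_trans (lerD E1 E2))// /bint_cst.
set S := (d%:R + _) * _.
have S0 : 0 <= S by rewrite /S !mulr_ge0// addr_ge0// exprn_ge0.
have -> : S * (w * (2 * n%:R * C * b2)) = S * (2 * n%:R * C) * (w * b2) by ring.
have : 0 <= w * b2 by rewrite mulr_ge0.
move: (w * b2) => z z0.
have : 0 <= S * (2 * n%:R * C) by rewrite mulr_ge0// !mulr_ge0.
move: (S * _) => Q Q0.
have : 0 <= n%:R * C by rewrite mulr_ge0.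
move: (n%:R * C) => P P0.
have := mulr_ge0 Q0 b10; have := mulr_ge0 P0 z0; rewrite mulrDr !mulrDl; lra.
Qed.

(** The drift, the second-level part of the germ and the sewing error are all of order 2 gamma at
    least. What remains is the first-order term, from which the Gubinelli derivative of the
    convolution is read off. *)
Lemma bint_local s t : 0 <= s -> s <= t -> t <= 1 ->
  `|bint W E phi Z Z' s t - E s *m Z s *m (W.1 t - W.1 s)| <=
  bint_cst * (b1 + w * b2) * (t - s) `^ (2 * gamma).
Proof.
move=> s0 st t1.
have ts1 : t - s <= (t - s) `^ (2 * gamma).
  by apply: le_powR_exp; have := ig_gamma2 ig; have := g0; lra.
have ts3 : (t - s) `^ (3 * gamma) <= (t - s) `^ (2 * gamma).
  by apply: powR_le_exp; have := g0; lra.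
have ts0 : 0 <= (t - s) `^ (2 * gamma) by exact: powR_ge0.
have E1 : `|vint s t (fun r => E r *m phi r)| <= n%:R * C * b1 * (t - s) `^ (2 * gamma).
  by rewrite (le_trans (vint_bd s0 st t1))// ler_wpM2l// !mulr_ge0.
have s0' : 0 <= sew_cst (3 * gamma) by rewrite sew_cst_ge0// (ig_gamma3 ig).
have c20 : 0 <= 2 * n%:R * C * b2 by rewrite !mulr_ge0.
pose S : R := d%:R + d%:R ^+ 2.
have S0 : 0 <= S by rewrite addr_ge0// exprn_ge0.
have E2 : `|rough_int W s t (fun r => E r *m Z r) (fun r v => E r *m Z' r v) -
    germ W (fun r => E r *m Z r) (fun r v => E r *m Z' r v) s t| <=
    sew_cst (3 * gamma) * (S * w * (2 * n%:R * C * b2)) * (t - s) `^ (2 * gamma).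
  have := rough_int_germ (ig_gamma3 ig) (ig_rough ig) cEZ lEZ s0 st t1.
  by move/le_trans; apply; apply: ler_wpM2l ts3; rewrite mulr_ge0// mulr_ge0// mulr_ge0.
have E3 : `|germ W (fun r => E r *m Z r) (fun r v => E r *m Z' r v) s t -
   E s *m Z s *m (W.1 t - W.1 s)| <=
   S * w * (2 * n%:R * C * b2) * (t - s) `^ (2 * gamma).
  rewrite /germ addrC addrA addNr add0r.
  have h i : `|E s *m Z' s (delta_mx i 0) *m (row i (W.2 s t))^T| <=
      d%:R * (w * (2 * n%:R * C * b2) * (t - s) `^ (2 * gamma)).
    rewrite (le_trans (mulmx_norm _ _))// -mulrA ler_wpM2l//.
    rewrite (@le_trans _ _ (2 * n%:R * C * b2 * (w * (t - s) `^ (2 * gamma))))//; last first.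
      by rewrite le_eqVlt; apply/orP; left; apply/eqP; ring.
    apply: ler_pM => //.
      rewrite (le_trans (ctrl_sup' cEZ _ s0 (le_trans st t1)))// ler_piMr//.
      exact: delta_mx_norm.
    rewrite (le_trans (trmx_norm _))// (le_trans (row_norm _ _))//.
    exact: (rough_on2 (ig_rough ig)).
  rewrite (le_trans (norm_sum_le h))//.
  set T := (t - s) `^ _ in ts0 *.
  have -> : S * w * (2 * n%:R * C * b2) * T = d%:R * (w * (2 * n%:R * C * b2) * T) +
     d%:R * (d%:R * (w * (2 * n%:R * C * b2) * T)) by rewrite /S; ring.
  by rewrite lerDr mulr_ge0// mulr_ge0// mulr_ge0.
set g := germ _ _ _ _ _ in E2 E3.
have -> : bint W E phi Z Z' s t - E s *m Z s *m (W.1 t - W.1 s) =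
    vint s t (fun r => E r *m phi r) +
    (rough_int W s t (fun r => E r *m Z r) (fun r v => E r *m Z' r v) - g) +
    (g - E s *m Z s *m (W.1 t - W.1 s)).
  rewrite /bint; have abel (a b c e : 'cV[R]_m) : a + b - c = a + (b - e) + (e - c).
    by apply/matrixP => i j; rewrite !mxE; ring.
  exact: abel.
rewrite (le_trans (ler_normD _ _))// (le_trans (lerD (ler_normD _ _) (lexx _)))//.
rewrite (le_trans (lerD (lerD E1 E2) E3))// -!mulrDl ler_wpM2r//.
rewrite /bint_cst -/S.
rewrite -?addrA.
have -> : sew_cst (3 * gamma) * (S * w * (2 * n%:R * C * b2)) + S * w * (2 * n%:R * C * b2) =
  (S * (1 + sew_cst (3 * gamma)) * (2 * n%:R * C)) * (w * b2) by ring.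
have : 0 <= w * b2 by rewrite mulr_ge0.
move: (w * b2) => z z0.
have : 0 <= S * (1 + sew_cst (3 * gamma)) * (2 * n%:R * C).
  by rewrite mulr_ge0 ?mulr_ge0// addr_ge0.
move: (S * _ * _) => Q Q0.
have : 0 <= n%:R * C by rewrite mulr_ge0.
move: (n%:R * C) => P P0.
have := mulr_ge0 Q0 b10; have := mulr_ge0 P0 z0; rewrite mulrDr !mulrDl; lra.
Qed.

End BlockIntegral.
End Convolution.

(** * Convolution with the semigroup as a controlled path *)

Section BlockFlow.
Context {R : realType} {n d : nat}.
Implicit Types (W : rpath R d) (phi : R -> 'cV[R]_n) (Z : R -> 'M[R]_(n, d))
  (dZ : R -> 'cV[R]_d -> 'M[R]_(n, d)) (a b t C : R).

Lemma bint_sub_kernel gamma w W b1 b2 phi Z dZ m (C1 C2 : R) (E1 E2 : R -> 'M[R]_(m, n)) a b :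
  integrand gamma w W b1 b2 phi Z dZ -> lip01 C1 E1 -> lip01 C2 E2 ->
  0 <= a -> a <= b -> b <= 1 ->
  bint W (fun r => E1 r - E2 r) phi Z dZ a b =
  bint W E1 phi Z dZ a b - bint W E2 phi Z dZ a b.
Proof.
move=> ig l1 l2 a0 ab b1'; rewrite /bint opprD addrACA.
have cf1 := cont01_mulmx (lip01_cont l1) (ig_cont ig).
have cf2 := cont01_mulmx (lip01_cont l2) (ig_cont ig).
rewrite -(vintB cf1 cf2 a0 b1').
rewrite -(rough_intB ab (bint_rough_cvg l1 ig a0 ab b1') (bint_rough_cvg l2 ig a0 ab b1')).
congr (_ + _).
  by congr (vint a b _); apply/funext => r; rewrite mulmxBl.
by apply: eq_rough_int => [r|r v]; rewrite mulmxBl.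
Qed.

Lemma bint_sub_integrand gamma w W b1 b2 b1' b2' phi Z dZ phi2 Z2 dZ2 m C (E : R -> 'M[R]_(m, n)) a b :
  integrand gamma w W b1 b2 phi Z dZ -> integrand gamma w W b1' b2' phi2 Z2 dZ2 ->
  lip01 C E -> 0 <= a -> a <= b -> b <= 1 ->
  bint W E (fun r => phi r - phi2 r) (fun r => Z r - Z2 r) (fun r v => dZ r v - dZ2 r v) a b =
  bint W E phi Z dZ a b - bint W E phi2 Z2 dZ2 a b.
Proof.
move=> ig ig2 l1 a0 ab b1''; rewrite /bint opprD addrACA.
have cf1 := cont01_mulmx (lip01_cont l1) (ig_cont ig).
have cf2 := cont01_mulmx (lip01_cont l1) (ig_cont ig2).
rewrite -(vintB cf1 cf2 a0 b1'').
rewrite -(rough_intB ab (bint_rough_cvg l1 ig a0 ab b1'') (bint_rough_cvg l1 ig2 a0 ab b1'')).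
congr (_ + _).
  by congr (vint a b _); apply/funext => r; rewrite mulmxBr.
by apply: eq_rough_int => [r|r v]; rewrite mulmxBr.
Qed.

Variable A : 'M[R]_n.

Definition flow (P : 'M[R]_n) (t r : R) : 'M[R]_n := expmx ((t - r) *: A) *m P.

(** The group property turns a convolution into e^{tA} applied to an integral with a kernel
    independent of [t], to which additivity in the endpoints applies. *)
Lemma flow_factor P t : flow P t = (fun r => expmx (t *: A) *m flow P 0 r).
Proof. by apply/funext => r; rewrite /flow sub0r mulmxA -expmxD. Qed.

Lemma flow_lip01 P : exists C, lip01 C (flow P 0).
Proof.
have [C _ h] := expmx_lip01 A; exists (n%:R * `|P| * C).
rewrite (_ : flow P 0 = fun r => expmx (- r *: A) *m P).
  exact: lip01_mulr.
by apply/funext => r; rewrite /flow sub0r.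
Qed.

Lemma bint_flow gamma w W b1 b2 phi Z dZ P a b t :
  integrand gamma w W b1 b2 phi Z dZ -> 0 <= a -> a <= b -> b <= 1 ->
  bint W (flow P t) phi Z dZ a b = expmx (t *: A) *m bint W (flow P 0) phi Z dZ a b.
Proof.
move=> ig a0 ab b1'; have [C lC] := flow_lip01 P.
by rewrite {1}flow_factor (bint_mulmx lC ig).
Qed.

(** The constant is chosen before the rough path, hence uniform over all blocks. *)
Lemma bint_flow_bound (gamma : R) P : 1 < 3 * gamma -> exists2 K : R, 0 <= K &
  forall w W b1 b2 phi Z dZ, integrand gamma w W b1 b2 phi Z dZ ->
  `|bint W (flow P 1) phi Z dZ 0 1| <= K * (b1 + w * b2).
Proof.
move=> g3; have [C lC] := flow_lip01 P.
have C0 := lip01_ge0 lC.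
pose K := n%:R * `|expmx (1 *: A)| * @bint_cst R n d gamma C.
have s0 : 0 <= sew_cst (3 * gamma) by rewrite sew_cst_ge0.
have K0 : 0 <= @bint_cst R n d gamma C.
  by rewrite /bint_cst addr_ge0 ?mulr_ge0// addr_ge0// exprn_ge0.
exists K; first by rewrite mulr_ge0// mulr_ge0.
move=> w W b1 b2 phi Z dZ ig.
rewrite (bint_flow P 1 ig)// (le_trans (mulmx_norm _ _))// /K -[leRHS]mulrA.
by apply: ler_wpM2l (bint_norm lC ig _ _ _) => //; rewrite mulr_ge0.
Qed.

(** The center integral over [t, 1] is the one over [0, 1] minus the one over [0, t]. The latter
    recombines with the stable integral into the full kernel, so that on a block the Lyapunov-Perron
    map becomes a full convolution with a corrected initial value. *)
Lemma bint_flow_split gamma w W b1 b2 phi Z dZ Pc Ps t :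
  integrand gamma w W b1 b2 phi Z dZ -> Pc + Ps = 1%:M -> 0 <= t -> t <= 1 ->
  - bint W (flow Pc t) phi Z dZ t 1 + bint W (flow Ps t) phi Z dZ 0 t =
  expmx (t *: A) *m (bint W (flow 1%:M 0) phi Z dZ 0 t - bint W (flow Pc 0) phi Z dZ 0 1).
Proof.
move=> ig PcPs t0 t1; have [C lC] := flow_lip01 Pc.
have [C1 lC1] := flow_lip01 1%:M.
rewrite (bint_flow Pc t ig t0 t1 (lexx 1)) (bint_flow Ps t ig (lexx 0) t0 t1).
rewrite (bint_additive lC ig (lexx 0) t0 t1 (lexx 1)).
have -> : flow Ps 0 = (fun r => flow 1%:M 0 r - flow Pc 0 r).
  apply/funext => r; rewrite /flow -mulmxBr; congr (_ *m _).
  by rewrite -PcPs addrC addKr.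
rewrite (bint_sub_kernel ig lC1 lC)// -mulmxN -mulmxDr; congr (_ *m _).
by apply/matrixP => i j; rewrite !mxE; ring.
Qed.

(** The derivative is [Z] itself, because e^{sA} cancels the kernel e^{-sA} in the local
    expansion. *)
Lemma bint_flow_ctrl (gamma : R) : 1 < 3 * gamma -> exists2 K : R, 0 <= K &
  forall w W b1 b2 phi Z dZ (v : 'cV[R]_n), integrand gamma w W b1 b2 phi Z dZ ->
  ctrl gamma W.1 (K * (`|v| + (b1 + w * b2)))
    (fun t => expmx (t *: A) *m (v + bint W (flow 1%:M 0) phi Z dZ 0 t))
    (fun t x => Z t *m x).
Proof.
move=> g3; have [C1 lC1] := flow_lip01 1%:M; have [C2 lC2 _] := expmx_lip01 A.
have C10 := lip01_ge0 lC1; have C20 := lip01_ge0 lC2.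
pose Q := @bint_cst R n d gamma C1.
have s0 : 0 <= sew_cst (3 * gamma) by rewrite sew_cst_ge0.
have Q0 : 0 <= Q by rewrite /Q/bint_cst addr_ge0 ?mulr_ge0// addr_ge0// exprn_ge0.
have nC0 : 0 <= n%:R * C2 by rewrite mulr_ge0.
(* The three summands cover the size of the path and the increments of e^{tA}, the local expansion
   of the integral, and the derivative [Z], whose increments carry the factor 2 w b2. *)
pose K := n%:R * C2 * (1 + Q) + n%:R * C2 * Q + 2 * d%:R.
have K0 : 0 <= K by rewrite /K !addr_ge0// !mulr_ge0// addr_ge0.
exists K => // w W b1 b2 phi Z dZ v ig.
have w1 := rough_on_ge1 (ig_rough ig).
have w0 : 0 <= w by exact: le_trans w1.
have b10 : 0 <= b1 by exact: le_trans (ig_sup ig (lexx 0) ler01).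
have b20 : 0 <= b2 by exact: ctrl_ge0 (ig_ctrl ig).
have g0 : 0 < gamma by lra.
have wb0 : 0 <= w * b2 by rewrite mulr_ge0.
set N := b1 + w * b2; have N0 : 0 <= N by rewrite addr_ge0.
have b2N : b2 <= N.
  by rewrite (@le_trans _ _ (w * b2))// ?ler_peMl// lerDr.
have wb2N : w * b2 <= N by rewrite lerDr.
set V := `|v| + N; have V0 : 0 <= V by rewrite addr_ge0.
have NV : N <= V by rewrite lerDr.
pose I t := bint W (flow 1%:M 0) phi Z dZ 0 t.
have Ibd t : 0 <= t -> t <= 1 -> `|v + I t| <= (1 + Q) * V.
  move=> t0 t1; rewrite (le_trans (ler_normD _ _))//.
  have h := bint_norm lC1 ig (lexx 0) t0 t1.
  rewrite mulrDl mul1r lerD ?lerDl//.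
  by rewrite (le_trans h)// ler_wpM2l.
have KV : n%:R * C2 * (1 + Q) * V + n%:R * C2 * Q * V + 2 * d%:R * V = K * V.
  by rewrite /K; ring.
have x1 : 0 <= n%:R * C2 * (1 + Q) * V by rewrite !mulr_ge0// addr_ge0.
have x2 : 0 <= n%:R * C2 * Q * V by rewrite !mulr_ge0.
have x3 : 0 <= 2 * d%:R * V by rewrite !mulr_ge0.
have dV : d%:R * V <= 2 * d%:R * V.
  by rewrite ler_wpM2r// ler_peMl// ler1n.
split.
- move=> t t0 t1; rewrite (le_trans (mulmx_norm _ _))//.
  have [h1 _] := lC2 t t t0 (lexx t) t1.
  rewrite (@le_trans _ _ (n%:R * C2 * (1 + Q) * V))//; last by rewrite -KV; lra.
  by rewrite -!mulrA ler_wpM2l// ler_pM// Ibd.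
- move=> t x t0 t1; rewrite (le_trans (mulmx_norm _ _))// ler_wpM2r//.
  rewrite (@le_trans _ _ (d%:R * V))//; last by rewrite -KV; lra.
  by rewrite ler_wpM2l// (le_trans (ctrl_sup (ig_ctrl ig) t0 t1))// (le_trans b2N).
- move=> s t x s_0 st t1; rewrite -mulmxBl (le_trans (mulmx_norm _ _))// ler_wpM2r//.
  have h := ctrl_incr g0 (ig_rough ig) (ig_ctrl ig) s_0 st t1.
  rewrite (@le_trans _ _ (2 * d%:R * V * (t - s) `^ gamma))//; last first.
    by rewrite ler_wpM2r ?powR_ge0// -KV; lra.
  rewrite (@le_trans _ _ (d%:R * (2 * (w * b2) * (t - s) `^ gamma)))// ?ler_wpM2l//.
  rewrite mulrA ler_wpM2r ?powR_ge0// mulrCA -mulrA ler_wpM2l// ler_wpM2l//.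
  exact: le_trans NV.
- move=> s t s_0 st t1.
  have t0 := le_trans s_0 st.
  have [_ h2] := lC2 s t s_0 st t1; have [h1 _] := lC2 s s s_0 (lexx s) (le_trans st t1).
  have ts1 : t - s <= (t - s) `^ (2 * gamma).
    by have g2 := ig_gamma2 ig; apply: le_powR_exp; clear -g0 g2 t1 st s_0; lra.
  have IE : I t = I s + bint W (flow 1%:M 0) phi Z dZ s t.
    exact: (bint_additive lC1 ig (lexx 0) s_0 st t1).
  have loc := bint_local lC1 ig s_0 st t1.
  set B := bint W _ _ _ _ s t in IE loc.
  have fE : expmx (s *: A) *m (flow 1%:M 0 s *m Z s *m (W.1 t - W.1 s)) =
      Z s *m (W.1 t - W.1 s).
    by rewrite /flow mulmx1 sub0r !mulmxA -expmxD subrr expmx0 mul1mx.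
  have -> : expmx (t *: A) *m (v + I t) - expmx (s *: A) *m (v + I s) -
      Z s *m (W.1 t - W.1 s) =
      (expmx (t *: A) - expmx (s *: A)) *m (v + I t) +
      expmx (s *: A) *m (B - flow 1%:M 0 s *m Z s *m (W.1 t - W.1 s)).
    have id (Et Es : 'M[R]_n) (u It Is D f x : 'cV[R]_n) : It = Is + D -> Es *m f = x ->
        Et *m (u + It) - Es *m (u + Is) - x = (Et - Es) *m (u + It) + Es *m (D - f).
      move=> -> <-; rewrite !(mulmxBr, mulmxBl, mulmxDr).
      by apply/matrixP => i j; rewrite ![in LHS]mxE ![in RHS]mxE; ring.
    exact: id.
  rewrite (le_trans (ler_normD _ _))// -KV.
  set T := (t - s) `^ _ in ts1 loc *.
  have T0 : 0 <= T by exact: powR_ge0.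
  have E1 : `|(expmx (t *: A) - expmx (s *: A)) *m (v + I t)| <=
      n%:R * C2 * (1 + Q) * V * T.
    rewrite (le_trans (mulmx_norm _ _))//.
    rewrite (@le_trans _ _ (n%:R * (C2 * T) * ((1 + Q) * V)))//; last first.
      by rewrite le_eqVlt; apply/orP; left; apply/eqP; ring.
    rewrite -!mulrA ler_wpM2l// mulrA.
    by apply: ler_pM (Ibd t t0 t1) => //; rewrite (le_trans h2)// ler_wpM2l.
  have E2 : `|expmx (s *: A) *m (B - flow 1%:M 0 s *m Z s *m (W.1 t - W.1 s))| <=
      n%:R * C2 * Q * V * T.
    rewrite (le_trans (mulmx_norm _ _))// -!mulrA ler_wpM2l//.
    rewrite ler_pM//; rewrite (le_trans loc)// -mulrA ler_wpM2l// ler_wpM2r//.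
  rewrite (le_trans (lerD E1 E2))// -mulrDl ler_wpM2r//; lra.
Qed.

End BlockFlow.

(** * Orders of vanishing at 0 and how differentiation changes them *)

Section DifferentiabilityClass.
Context {R : realType} {U E : normedModType R}.
Implicit Types (f : U -> E) (k : nat).

Lemma Ck_continuous k f : Ck k f -> continuous f.
Proof. by case: k => // k [df _] x; exact: differentiable_continuous. Qed.

Lemma Ck_pred k f : Ck k.+1 f -> Ck k f.
Proof.
elim: k f => [|k ih] f; first by move=> [df _] x; exact: differentiable_continuous.
by move=> [df h]; split => // v; apply: ih; exact: h.
Qed.

Lemma Ck_le k l f : (k <= l)%N -> Ck l f -> Ck k f.
Proof.
move=> /subnKC <-; elim: (l - k)%N => [|j ih]; first by rewrite addn0.
by rewrite addnS => /Ck_pred.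
Qed.

Lemma Ck_diff k f (x : U) : Ck k.+1 f -> differentiable f x.
Proof. by move=> [h _]; exact: h. Qed.

End DifferentiabilityClass.

Section ScalarCalculus.
Context {R : realType} {n : nat}.
Local Notation V := 'cV[R]_n.
Implicit Types (f g : V -> R) (x y v : V) (k : nat).

Definition ddir (v : V) (f : V -> R) : V -> R := fun x => 'd f x v.

Lemma is_derive_line f x v t : differentiable f (x + t *: v) ->
  is_derive t 1 (fun t => f (x + t *: v)) (ddir v f (x + t *: v)).
Proof.
move=> df; have dv := @diff_derivable _ _ _ _ _ v df.
have E : (fun h : R => h^-1 *: ((((fun t => f (x + t *: v)) : R -> R) \o shift t) (h *: (1 : R)) -
      f (x + t *: v))) = (fun h : R => h^-1 *: ((f \o shift (x + t *: v)) (h *: v) - f (x + t *: v))).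
  apply/funext => h /=; congr (_ *: (f _ - _)).
  by rewrite scalerDl addrCA; congr (_ + (_ + _)); rewrite /GRing.scale/= mulr1.
apply: DeriveDef; first by rewrite /derivable E.
by rewrite /derive E -/(derive f (x + t *: v) v) deriveE.
Qed.

Lemma mvt_line f x v (T : R) : (forall y, differentiable f y) -> 0 <= T ->
  exists2 c, 0 <= c <= T & f (x + T *: v) - f x = ddir v f (x + c *: v) * T.
Proof.
move=> df T0.
have [||c /[!in_itv]/= c0T] := @MVT_segment R (fun t => f (x + t *: v))
  (fun t => ddir v f (x + t *: v)) 0 T T0.
- by move=> t _; apply: is_derive_line.
- apply: derivable_within_continuous => t _.
  by have := is_derive_line (df (x + t *: v)) => -[].
by rewrite scale0r addr0 subr0 => E; exists c.
Qed.

Lemma Ck_ddir k f v : Ck k.+1 f -> Ck k (ddir v f).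
Proof. by move=> [_ h]; exact: h. Qed.

Lemma Ck_iter_ddir j k f v : Ck (j + k)%N f -> Ck k (iter j (ddir v) f).
Proof.
elim: j k f => [//|j ih] k f; rewrite addSnnS => /ih h /=.
exact: Ck_ddir.
Qed.

Definition taylor_poly f v x k : {poly R} :=
  \poly_(j < k) (iter j (ddir v) f x / j`!%:R).

Lemma deriv_taylor_poly f v x k :
  (taylor_poly f v x k.+1)^`()%R = taylor_poly (ddir v f) v x k.
Proof.
apply/polyP => j; rewrite coef_deriv !coef_poly ltnS.
case: ltnP => jk; last by rewrite mul0rn.
by rewrite -iterSr -[LHS]mulr_natr factS natrM invfM mulrA mulrAC divfK// pnatr_eq0.
Qed.

(** Differentiating the remainder along the line gives the remainder of the derivative; the mean
    value theorem then adds one power of t at each step of the induction. The factor 1/(k+1)! is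
    given away. *)
Lemma taylor_bound k f v x (T K : R) : Ck k.+1 f ->
  (forall c, 0 <= c -> c <= T -> `|iter k.+1 (ddir v) f (x + c *: v)| <= K) ->
  forall t, 0 <= t -> t <= T ->
  `|f (x + t *: v) - (taylor_poly f v x k.+1).[t]| <= K * t ^+ k.+1.
Proof.
elim: k f => [|k ih] f Cf h t t0 tT.
  have [c /andP[c0 ct] E] := mvt_line x v (fun y => Ck_diff y Cf) t0.
  have -> : (taylor_poly f v x 1).[t] = f x.
    by rewrite horner_poly big_ord1 expr0 mulr1 fact0 divr1.
  rewrite E normrM (ger0_norm t0) expr1 ler_wpM2r//; apply: h => //.
  exact: le_trans tT.
pose psi t := f (x + t *: v) - (taylor_poly f v x k.+2).[t].
pose dpsi t := ddir v f (x + t *: v) - (taylor_poly (ddir v f) v x k.+1).[t].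
have dd (u : R) : is_derive u (1 : R) psi (dpsi u).
  apply: is_deriveB; first by apply: is_derive_line; apply: Ck_diff Cf.
  apply: DeriveDef; first exact: derivable_horner.
  by rewrite -derive1E -derivE deriv_taylor_poly.
have [|c /[!in_itv]/= /andP[c0 ct]] := @MVT_segment R psi dpsi 0 t t0.
  by apply: derivable_within_continuous => u _; case: (dd u).
have -> : psi 0 = 0.
  rewrite /psi scale0r addr0 horner_poly big_ord_recl/= expr0 mulr1 fact0 divr1.
  rewrite big1 ?addr0 ?subrr// => i _; by rewrite expr0n mulr0.
rewrite !subr0 -/(psi t) => ->.
rewrite normrM (ger0_norm t0) exprSr mulrA ler_wpM2r//.
have K0 : 0 <= K.
  have T0 : 0 <= T by exact: le_trans tT.
  by apply: le_trans (h 0 (lexx _) T0).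
apply: le_trans (ih (ddir v f) (Ck_ddir v Cf) _ c c0 (le_trans ct tT)) _.
  by move=> u u0 uT; rewrite -iterSr; exact: h.
by rewrite ler_wpM2l// lerXn2r// nnegrE.
Qed.

Definition bigO0 (f : V -> R) (k : nat) : Prop :=
  exists K : R, \forall x \near (0 : V), `|f x| <= K * `|x| ^+ k.

Lemma bigO0_pos f k : bigO0 f k -> exists K rho : R, [/\ 0 <= K, 0 < rho &
  forall x, `|x| <= rho -> `|f x| <= K * `|x| ^+ k].
Proof.
move=> [K]; rewrite -nbhs_nearE => /nbhs_ballP[e /= e0 h].
exists `|K|, (e / 2); split=> //; first by rewrite divr_gt0.
move=> x xe; rewrite (le_trans (h x _))//.
  rewrite -ball_normE/= sub0r normrN (le_lt_trans xe)//.
  by rewrite ltr_pdivrMr// ltr_pMr// ltr1n.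
by rewrite ler_wpM2r ?exprn_ge0// ler_norm.
Qed.

Lemma bigO0_intro f k (K rho : R) : 0 < rho ->
  (forall x, `|x| <= rho -> `|f x| <= K * `|x| ^+ k) -> bigO0 f k.
Proof.
move=> r0 h; exists K; rewrite -nbhs_nearE; apply/nbhs_ballP; exists rho => //= x.
by rewrite -ball_normE/= sub0r normrN => /ltW /h.
Qed.

Lemma bigO0_fin (I : finType) (g : I -> V -> R) k : (forall i, bigO0 (g i) k) ->
  exists K rho : R, [/\ 0 <= K, 0 < rho &
  forall i x, `|x| <= rho -> `|g i x| <= K * `|x| ^+ k].
Proof.
move=> h; have /choice[Kf hK] : forall i, exists K : R, \forall x \near (0 : V),
    `|g i x| <= K * `|x| ^+ k by [].
have : \forall x \near (0 : V), forall i, `|g i x| <= Kf i * `|x| ^+ k.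
  exact: (@filter_forall _ _ (fun i x => `|g i x| <= Kf i * `|x| ^+ k) _ _ hK).
rewrite -nbhs_nearE => /nbhs_ballP[e /= e0 he].
exists (\sum_i `|Kf i|), (e / 2); split; rewrite ?sumr_ge0 ?divr_gt0//.
move=> i x xe; rewrite (le_trans (he x _ i))//.
  rewrite -ball_normE/= sub0r normrN (le_lt_trans xe)//.
  by rewrite ltr_pdivrMr// ltr_pMr// ltr1n.
rewrite ler_wpM2r ?exprn_ge0// (le_trans (ler_norm _))//.
by rewrite (bigD1 i)//= lerDl sumr_ge0.
Qed.

Lemma bigO0_cont f : continuous f -> bigO0 f 0.
Proof.
move=> cf; exists (`|f 0| + 1).
have /cvgrPdist_lt/(_ 1 ltr01) := cf 0; apply: filterS => x hx.
rewrite expr0 mulr1 -[f x](subKr (f 0)) (le_trans (ler_normB _ _))// lerD2l ltW//.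
Qed.

Lemma ddir_basis f x v : ddir v f x = \sum_(a < n) v a 0 * ddir (delta_mx a 0) f x.
Proof.
exact: (linear_basis_linear ('d f x) v).
Qed.

Lemma ddir_bound f x v (K : R) : (forall a, `|ddir (delta_mx a 0) f x| <= K) ->
  `|ddir v f x| <= n%:R * K * `|v|.
Proof.
move=> h; rewrite ddir_basis (le_trans (ler_norm_sum _ _ _))//.
rewrite (@le_trans _ _ (\sum_(a < n) `|v| * K))//.
  by apply: ler_sum => a _; rewrite normrM ler_pM// mxnorm_coord.
by rewrite sumr_const card_ord -[leLHS]mulr_natl mulrCA -mulrA mulrC -mulrA mulrCA.
Qed.

(** The mean value theorem on the segment from 0 to x, all of whose points have norm at most |x|. *)
Lemma bigO0_integrate f k : f 0 = 0 -> (forall x, differentiable f x) ->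
  (forall a, bigO0 (ddir (delta_mx a 0) f) k) -> bigO0 f k.+1.
Proof.
move=> f0 df h; have [K [rho [K0 r0 hK]]] := bigO0_fin h.
apply: (@bigO0_intro _ _ (n%:R * K) rho r0) => x xr.
have [c /andP[c0 c1]] := mvt_line 0 x df ler01.
rewrite scale1r !add0r f0 subr0 mulr1 => ->.
have cx : `|c *: x| <= `|x| by rewrite normrZ ger0_norm// ler_piMl.
rewrite (le_trans (@ddir_bound _ _ _ (K * `|x| ^+ k) _))//.
  move=> a; rewrite (le_trans (hK a _ (le_trans cx xr)))// ler_wpM2l//.
  by rewrite lerXn2r// nnegrE.
by rewrite exprSr !mulrA.
Qed.

(** The nodes 0, ..., k are distinct, so the Vandermonde matrix is invertible. These weights extract
    the coefficient of degree 1 of a polynomial of degree at most k from its values at the nodes. *)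
Lemma vandermonde_weights k : exists c : 'I_k.+1 -> R,
  forall j, (j <= k)%N -> \sum_(i < k.+1) c i * i%:R ^+ j = (j == 1)%:R.
Proof.
pose a : 'rV[R]_k.+1 := \row_i i%:R.
pose M := Vandermonde k.+1 a.
have uM : M \in unitmx.
  rewrite unitmxE unitfE det_Vandermonde; apply/prodf_neq0 => i _.
  apply/prodf_neq0 => j ij; rewrite !mxE subr_eq0 eqr_nat.
  by rewrite neq_ltn ij orbT.
pose e : 'cV[R]_k.+1 := \col_i (i == 1 :> nat)%:R.
exists (fun i => (invmx M *m e) i 0) => j jk.
have /matrixP/(_ (Ordinal (jk : (j < k.+1)%N)) 0) : M *m (invmx M *m e) = e.
  by rewrite mulKVmx.
rewrite [LHS]mxE [RHS]mxE /= => <-; apply: eq_bigr => i _.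
by rewrite mulrC; congr (_ * _); rewrite !mxE.
Qed.

(* Landau-type inequality: interpolating between the size of f and that of its
   derivative of order k + 1, a bound O(|x|^(k+1)) can be differentiated.  The
   Vandermonde weights extract the linear coefficient of the Taylor polynomial
   from its values at 0, h, ..., k h. *)
Lemma bigO0_ddir f k v : Ck k.+1 f -> bigO0 f k.+1 -> bigO0 (ddir v f) k.
Proof.
case: k => [|k'].
  by move=> Cf _; apply: bigO0_cont; exact: (Ck_ddir v Cf).
set k := k'.+1 => Cf Of.
have [K [rho [K0 r0 hK]]] := bigO0_pos Of.
have cD : continuous (iter k.+1 (ddir v) f).
  by apply: (@Ck_iter_ddir k.+1 0); rewrite addn0.
have [K1 [rho1 [K10 r10 hK1]]] := bigO0_pos (bigO0_cont cD).
have [c hc] := vandermonde_weights k.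
pose U := 1 + k%:R * `|v|.
have U1 : 1 <= U by rewrite lerDl mulr_ge0.
have U0 : 0 < U by exact: lt_le_trans U1.
pose del := Num.min rho rho1 / U.
have del0 : 0 < del by rewrite divr_gt0// lt_min r0.
(* The first summand bounds [f] along the line and the second the Taylor remainder, both relative to
   h^(k+1). *)
pose K2 := K * U ^+ k.+1 + K1 * k%:R ^+ k.+1.
pose K3 := \sum_(i < k.+1) `|c i| * K2.
have K20 : 0 <= K2 by rewrite addr_ge0// mulr_ge0// exprn_ge0// ltW.
have K30 : 0 <= K3 by rewrite sumr_ge0// => i _; rewrite mulr_ge0.
have key x h : 0 < h -> `|x| <= h -> h <= del -> `|ddir v f x| <= K3 * h ^+ k.
  move=> h0 xh hd.
  have hU : h * U <= Num.min rho rho1 by rewrite -ler_pdivlMr.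
  have xt t : 0 <= t -> t <= k%:R * h -> `|x + t *: v| <= h * U.
    move=> t0 tk; rewrite (le_trans (ler_normD _ _))// normrZ ger0_norm//.
    rewrite /U mulrDr mulr1 lerD// mulrCA mulrA ler_wpM2r//.
  have B t : 0 <= t -> t <= k%:R * h -> `|(taylor_poly f v x k.+1).[t]| <= K2 * h ^+ k.+1.
    move=> t0 tk; have T := @taylor_bound k f v x (k%:R * h) K1 Cf _ t t0 tk.
    have {}T : `|f (x + t *: v) - (taylor_poly f v x k.+1).[t]| <= K1 * t ^+ k.+1.
      apply: T => u u0 uk; have := hK1 (x + u *: v); rewrite expr0 mulr1; apply.
      by rewrite (le_trans (xt _ u0 uk))// (le_trans hU)// ge_min lexx orbT.
    rewrite -[_.[t]](subKr (f (x + t *: v))) (le_trans (ler_normB _ _))//.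
    rewrite /K2 mulrDl lerD//.
      rewrite (le_trans (hK _ _))//.
        by rewrite (le_trans (xt _ t0 tk))// (le_trans hU)// ge_min lexx.
      rewrite -mulrA ler_wpM2l// -exprMn lerXn2r// ?nnegrE ?mulr_ge0 ?(ltW h0) ?(ltW U0)//.
      by rewrite mulrC xt.
    rewrite (le_trans T)// -mulrA ler_wpM2l// -exprMn lerXn2r// nnegrE//.
    by rewrite mulr_ge0// ltW.
  have E : h * ddir v f x = \sum_(i < k.+1) c i * (taylor_poly f v x k.+1).[i%:R * h].
    transitivity (\sum_(i < k.+1) \sum_(j < k.+1)
        (iter j (ddir v) f x / j`!%:R * h ^+ j) * (c i * i%:R ^+ j)); last first.
      apply: eq_bigr => i _; rewrite horner_poly mulr_sumr; apply: eq_bigr => j _.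
      by rewrite exprMn; ring.
    rewrite exchange_big /=.
    under eq_bigr => j _ do rewrite -mulr_sumr (hc j (ltn_ord j)).
    rewrite (bigD1 (Ordinal (isT : (1 < k.+1)%N)))//= big1 ?addr0.
      by rewrite mulr1 expr1 (_ : 1`! = 1)%N// divr1 mulrC.
    move=> j; rewrite -val_eqE/= => /negbTE ->.
    by rewrite mulr0.
  have : h * `|ddir v f x| <= h * (K3 * h ^+ k).
    rewrite -{1}(ger0_norm (ltW h0)) -normrM E (le_trans (ler_norm_sum _ _ _))//.
    rewrite mulrCA -exprS /K3 mulr_suml; apply: ler_sum => i _.
    rewrite normrM -mulrA ler_wpM2l// B//.
      by rewrite mulr_ge0// ltW.
    by rewrite ler_wpM2r ?(ltW h0)// ler_nat -ltnS.
  by rewrite ler_pM2l.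
apply: (@bigO0_intro _ _ K3 del del0) => x xd.
(* In [key] the scale [h] may be any small positive number above |x|. For x nonzero it is |x|; at
   the origin it is made arbitrarily small. *)
have [x0|x0] := eqVneq x 0; last by apply: key => //; rewrite normr_gt0.
rewrite x0 normr0 expr0n mulr0; apply/ler_addgt0Pr => e e0; rewrite add0r.
pose h := Num.min del (Num.min 1 (e / (K3 + 1))).
have h0 : 0 < h by rewrite !lt_min del0 ltr01 divr_gt0// ltr_wpDl.
have h1 : h <= 1 by rewrite !ge_min lexx !orbT.
have hd : h <= del by rewrite !ge_min lexx.
have he : h <= e / (K3 + 1) by rewrite !ge_min lexx !orbT.
have := key 0 h h0; rewrite normr0 => /(_ (ltW h0) hd)/le_trans; apply.
rewrite (@le_trans _ _ ((K3 + 1) * h))//; last by rewrite mulrC -ler_pdivlMr// ltr_wpDl.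
apply: ler_pM => //; rewrite ?exprn_ge0 ?(ltW h0)// ?lerDl//.
by rewrite /k exprS ler_piMr ?(ltW h0)// exprn_ile1// ltW.
Qed.

End ScalarCalculus.

(** * Sums, products and compositions of controlled paths *)

Section ControlledAlgebra.
Context {R : realType} {d : nat}.
Implicit Types (W : R -> 'cV[R]_d) (B : R).

Lemma ctrl_ext (E : normedModType R) gamma W B (Z1 Z2 : R -> E) Z1' Z2' :
  (forall t, Z1 t = Z2 t) -> (forall t v, Z1' t v = Z2' t v) ->
  ctrl gamma W B Z1 Z1' -> ctrl gamma W B Z2 Z2'.
Proof.
move=> /funext -> h; rewrite (_ : Z1' = Z2')//.
by apply/funext => t; apply/funext => v.
Qed.

Lemma ctrl_le (E : normedModType R) gamma W B1 B2 (Z : R -> E) Z' :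
  B1 <= B2 -> ctrl gamma W B1 Z Z' -> ctrl gamma W B2 Z Z'.
Proof.
move=> B12 [h1 h2 h3 h4]; split.
- by move=> t t0 t1; rewrite (le_trans (h1 t t0 t1)).
- by move=> t v t0 t1; rewrite (le_trans (h2 t v t0 t1))// ler_wpM2r.
- move=> s t v s0 st t1; rewrite (le_trans (h3 s t v s0 st t1))// ler_wpM2r//.
  by rewrite ler_wpM2r// powR_ge0.
- move=> s t s0 st t1; rewrite (le_trans (h4 s t s0 st t1))//.
  by rewrite ler_wpM2r// powR_ge0.
Qed.

Lemma ctrl0 (E : normedModType R) gamma W : ctrl gamma W 0 (fun=> 0 : E) (fun _ _ => 0).
Proof.
by split=> *; rewrite ?subrr ?normr0 ?mul0r.
Qed.

Lemma ctrl_cst (E : normedModType R) gamma W (x : E) : ctrl gamma W `|x| (fun=> x) (fun _ _ => 0).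
Proof.
split=> *; rewrite ?subrr ?normr0 ?mulr_ge0 ?powR_ge0//.
Qed.

Lemma ctrlD (E : normedModType R) gamma W B1 B2 (Z1 Z2 : R -> E) Z1' Z2' :
  ctrl gamma W B1 Z1 Z1' -> ctrl gamma W B2 Z2 Z2' ->
  ctrl gamma W (B1 + B2) (fun t => Z1 t + Z2 t) (fun t v => Z1' t v + Z2' t v).
Proof.
move=> [h1 h2 h3 h4] [k1 k2 k3 k4]; split.
- by move=> t t0 t1; rewrite (le_trans (ler_normD _ _))// lerD ?h1 ?k1.
- by move=> t v t0 t1; rewrite (le_trans (ler_normD _ _))// mulrDl lerD ?h2 ?k2.
- move=> s t v s0 st t1; rewrite opprD addrACA (le_trans (ler_normD _ _))// !mulrDl.
  by rewrite lerD ?h3 ?k3.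
- move=> s t s0 st t1; have -> : Z1 t + Z2 t - (Z1 s + Z2 s) -
       (Z1' s (W t - W s) + Z2' s (W t - W s)) = (Z1 t - Z1 s - Z1' s (W t - W s)) +
     (Z2 t - Z2 s - Z2' s (W t - W s)).
    have abel (a b c e f g : E) : a + b - (c + e) - (f + g) = (a - c - f) + (b - e - g).
      by rewrite [in LHS]opprD [in LHS]addrACA [in LHS]opprD [LHS]addrACA.
    exact: abel.
  by rewrite (le_trans (ler_normD _ _))// mulrDl lerD ?h4 ?k4.
Qed.

Lemma ctrlZ (E : normedModType R) gamma W B (c : R) (Z : R -> E) Z' :
  ctrl gamma W B Z Z' -> ctrl gamma W (`|c| * B) (fun t => c *: Z t) (fun t v => c *: Z' t v).
Proof.
move=> [h1 h2 h3 h4]; split.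
- by move=> t t0 t1; rewrite normrZ ler_wpM2l ?h1.
- by move=> t v t0 t1; rewrite normrZ -mulrA ler_wpM2l ?h2.
- by move=> s t v s0 st t1; rewrite -scalerBr normrZ -!mulrA ler_wpM2l// mulrA h3.
- by move=> s t s0 st t1; rewrite -!scalerBr normrZ -mulrA ler_wpM2l// h4.
Qed.

Lemma ctrlB (E : normedModType R) gamma W B1 B2 (Z1 Z2 : R -> E) Z1' Z2' :
  ctrl gamma W B1 Z1 Z1' -> ctrl gamma W B2 Z2 Z2' ->
  ctrl gamma W (B1 + B2) (fun t => Z1 t - Z2 t) (fun t v => Z1' t v - Z2' t v).
Proof.
move=> h1 h2; have h3 := ctrlZ (-1) h2; have := ctrlD h1 h3.
rewrite normrN1 mul1r; apply: ctrl_ext => *; by rewrite scaleN1r.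
Qed.

Lemma ctrl_sum (E : normedModType R) gamma W (n : nat) (B : 'I_n -> R)
    (Z : 'I_n -> R -> E) Z' :
  (forall a, ctrl gamma W (B a) (Z a) (Z' a)) ->
  ctrl gamma W (\sum_(a < n) B a) (fun t => \sum_(a < n) Z a t) (fun t v => \sum_(a < n) Z' a t v).
Proof.
elim: n B Z Z' => [|n ih] B Z Z' h.
  rewrite big_ord0; apply: ctrl_ext (ctrl0 E gamma W) => *; by rewrite big_ord0.
rewrite big_ord_recl.
apply: ctrl_ext (ctrlD (h ord0) (ih _ _ _ (fun a => h (lift ord0 a)))) => *;
  by rewrite big_ord_recl.
Qed.

Lemma ctrl_entries p q gamma W B (Z : R -> 'M[R]_(p, q)) (Z' : R -> 'cV[R]_d -> 'M[R]_(p, q)) : 0 <= B ->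
  (forall i j, ctrl gamma W B (fun t => Z t i j : R) (fun t v => Z' t v i j)) ->
  ctrl gamma W B Z Z'.
Proof.
move=> B0 h; split.
- by move=> t t0 t1; apply: mxnorm_le => // i j; exact: (ctrl_sup (h i j)).
- move=> t v t0 t1; apply: mxnorm_le => [|i j]; first by rewrite mulr_ge0.
  exact: (ctrl_sup' (h i j)).
- move=> s t v s0 st t1; apply: mxnorm_le => [|i j].
    by rewrite mulr_ge0// mulr_ge0// powR_ge0.
  by rewrite !mxE; exact: (ctrl_holder' (h i j)).
- move=> s t s0 st t1; apply: mxnorm_le => [|i j].
    by rewrite mulr_ge0// powR_ge0.
  by rewrite !mxE; exact: (ctrl_rem (h i j)).
Qed.

Lemma ctrl_coord p q gamma W B (Z : R -> 'M[R]_(p, q)) (Z' : R -> 'cV[R]_d -> 'M[R]_(p, q)) i j :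
  ctrl gamma W B Z Z' -> ctrl gamma W B (fun t => Z t i j : R) (fun t v => Z' t v i j).
Proof.
move=> h; split.
- by move=> t t0 t1; rewrite (le_trans (mxnorm_coord _ _ _))// (ctrl_sup h).
- by move=> t v t0 t1; rewrite (le_trans (mxnorm_coord _ _ _))// (ctrl_sup' h).
- move=> s t v s0 st t1; apply: le_trans (ctrl_holder' h v s0 st t1).
  by have := mxnorm_coord (Z' t v - Z' s v) i j; rewrite !mxE.
- move=> s t s0 st t1; apply: le_trans (ctrl_rem h s0 st t1).
  by have := mxnorm_coord (Z t - Z s - Z' s (W t - W s)) i j; rewrite !mxE.
Qed.

(** In the remainder of a product the new term is the product of the two increments, at most 4 w^2
    B1 B2 times a power 2 gamma. The largest factor that arises is 2 + 4 w^2 <= 6 w^2. *)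
Lemma ctrlM gamma w (W : rpath R d) B1 B2 (a b : R -> R) a' b' :
  0 < gamma -> rough_on gamma w W ->
  ctrl gamma W.1 B1 a a' -> ctrl gamma W.1 B2 b b' ->
  ctrl gamma W.1 (6 * w ^+ 2 * (B1 * B2)) (fun t => a t * b t)
    (fun t v => a' t v * b t + a t * b' t v).
Proof.
move=> g0 rW ca cb; have B10 := ctrl_ge0 ca; have B20 := ctrl_ge0 cb.
have w1 := rough_on_ge1 rW; have w0 : 0 <= w by exact: le_trans w1.
have B120 : 0 <= B1 * B2 by rewrite mulr_ge0.
have ww : w <= w ^+ 2 by rewrite expr2 ler_peMl.
have w21 : 1 <= w ^+ 2 by exact: le_trans ww.
split.
- move=> t t0 t1; rewrite normrM (le_trans (ler_pM _ _ (ctrl_sup ca t0 t1) (ctrl_sup cb t0 t1)))//.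
  by rewrite ler_peMl//; lra.
- move=> t v t0 t1; rewrite (le_trans (ler_normD _ _))// !normrM.
  have e1 := ler_pM (normr_ge0 _) (normr_ge0 _) (ctrl_sup' ca v t0 t1) (ctrl_sup cb t0 t1).
  have e2 := ler_pM (normr_ge0 _) (normr_ge0 _) (ctrl_sup ca t0 t1) (ctrl_sup' cb v t0 t1).
  rewrite (le_trans (lerD e1 e2))//.
  have -> : B1 * `|v| * B2 + B1 * (B2 * `|v|) = 2 * (B1 * B2) * `|v| by ring.
  by rewrite ler_wpM2r// ler_wpM2r//; lra.
- move=> s t v s0 st t1.
  have t0 := le_trans s0 st; have s1 := le_trans st t1.
  have ia := ctrl_incr g0 rW ca s0 st t1; have ib := ctrl_incr g0 rW cb s0 st t1.
  have -> : a' t v * b t + a t * b' t v - (a' s v * b s + a s * b' s v) =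
    (a' t v - a' s v) * b t + a' s v * (b t - b s) + (a t - a s) * b' t v + a s * (b' t v - b' s v).
    by ring.
  rewrite (le_trans (ler_normD _ _))// (le_trans (lerD (ler_normD _ _) (lexx _)))//.
  rewrite (le_trans (lerD (lerD (ler_normD _ _) (lexx _)) (lexx _)))// !normrM.
  have e1 := ler_pM (normr_ge0 _) (normr_ge0 _) (ctrl_holder' ca v s0 st t1) (ctrl_sup cb t0 t1).
  have e2 := ler_pM (normr_ge0 _) (normr_ge0 _) (ctrl_sup' ca v s0 s1) ib.
  have e3 := ler_pM (normr_ge0 _) (normr_ge0 _) ia (ctrl_sup' cb v t0 t1).
  have e4 := ler_pM (normr_ge0 _) (normr_ge0 _) (ctrl_sup ca s0 s1) (ctrl_holder' cb v s0 st t1).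
  rewrite (le_trans (lerD (lerD (lerD e1 e2) e3) e4))//.
  set T := (t - s) `^ gamma.
  have -> : B1 * T * `|v| * B2 + B1 * `|v| * (2 * (w * B2) * T) + 2 * (w * B1) * T * (B2 * `|v|) +
    B1 * (B2 * T * `|v|) = (2 + 4 * w) * (B1 * B2) * T * `|v| by ring.
  by rewrite ler_wpM2r// ler_wpM2r ?powR_ge0// ler_wpM2r//; lra.
- move=> s t s0 st t1.
  have t0 := le_trans s0 st; have s1 := le_trans st t1.
  have ia := ctrl_incr g0 rW ca s0 st t1; have ib := ctrl_incr g0 rW cb s0 st t1.
  set x := W.1 t - W.1 s.
  have -> : a t * b t - a s * b s - (a' s x * b s + a s * b' s x) =
    (a t - a s - a' s x) * b s + a s * (b t - b s - b' s x) + (a t - a s) * (b t - b s) by ring.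
  rewrite (le_trans (ler_normD _ _))// (le_trans (lerD (ler_normD _ _) (lexx _)))// !normrM.
  have e1 := ler_pM (normr_ge0 _) (normr_ge0 _) (ctrl_rem ca s0 st t1) (ctrl_sup cb s0 s1).
  have e2 := ler_pM (normr_ge0 _) (normr_ge0 _) (ctrl_sup ca s0 s1) (ctrl_rem cb s0 st t1).
  have e3 := ler_pM (normr_ge0 _) (normr_ge0 _) ia ib.
  rewrite (le_trans (lerD (lerD e1 e2) e3))//.
  have -> : (t - s) `^ (2 * gamma) = (t - s) `^ gamma * (t - s) `^ gamma.
    by rewrite mulr2n mulrDl mul1r powRD// gt_eqF//; lra.
  set T := (t - s) `^ gamma.
  have -> : B1 * (T * T) * B2 + B1 * (B2 * (T * T)) + 2 * (w * B1) * T * (2 * (w * B2) * T) =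
    (2 + 4 * w ^+ 2) * (B1 * B2) * (T * T) by ring.
  by rewrite ler_wpM2r ?mulr_ge0 ?powR_ge0// ler_wpM2r//; lra.
Qed.

End ControlledAlgebra.

Section Composition.
Context {R : realType} {n d : nat}.
Local Notation V := 'cV[R]_n.

Lemma ddirB (f : V -> R) (u v x : V) : ddir (u - v) f x = ddir u f x - ddir v f x.
Proof. exact: (linearB ('d f x)). Qed.

(** The order of the second derivatives becomes, by the mean value theorem, a Lipschitz bound for
    the first ones; composition with a controlled path uses it in that form. *)
Lemma local_bounds (I : finType) (f : I -> V -> R) k : (forall i, Ck 2 (f i)) ->
  (forall i, bigO0 (f i) k.+1) ->
  (forall i a, bigO0 (ddir (delta_mx a 0) (f i)) k) ->
  (forall i a b, bigO0 (ddir (delta_mx b 0) (ddir (delta_mx a 0) (f i))) k.-1) ->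
  exists K rho : R, [/\ 0 <= K, 0 < rho,
    forall i x, `|x| <= rho -> `|f i x| <= K * `|x| ^+ k.+1,
    forall i x v, `|x| <= rho -> `|ddir v (f i) x| <= K * `|x| ^+ k * `|v| &
    forall i x y v s, `|x| <= s -> `|y| <= s -> s <= rho ->
      `|ddir v (f i) x - ddir v (f i) y| <= K * s ^+ k.-1 * `|x - y| * `|v| ].
Proof.
move=> Cf O0 O1 O2.
have [K0 [r0 [K00 r00 h0]]] := bigO0_fin O0.
have [K1 [r1 [K10 r10 h1]]] := bigO0_fin (fun ia : I * 'I_n => O1 ia.1 ia.2).
have [K2 [r2 [K20 r20 h2]]] := bigO0_fin
  (fun iab : I * 'I_n * 'I_n => O2 iab.1.1 iab.1.2 iab.2).
exists (K0 + n%:R * K1 + n%:R * (n%:R * K2)), (Num.min r0 (Num.min r1 r2)).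
have nK1 : 0 <= n%:R * K1 by rewrite mulr_ge0.
have nK2 : 0 <= n%:R * (n%:R * K2) by rewrite !mulr_ge0.
split; [by rewrite !addr_ge0|by rewrite !lt_min r00 r10| | |].
- move=> i x; rewrite !le_min => /andP[xr0 _]; rewrite (le_trans (h0 i x xr0))//.
  by rewrite ler_wpM2r ?exprn_ge0//; lra.
- move=> i x v; rewrite !le_min => /andP[_ /andP[xr1 _]].
  have h a : `|ddir (delta_mx a 0) (f i) x| <= K1 * `|x| ^+ k by exact: (h1 (i, a)).
  rewrite (le_trans (ddir_bound _ h))// ler_wpM2r// mulrA.
  by rewrite ler_wpM2r ?exprn_ge0//; lra.
- move=> i x y v s xs ys; rewrite !le_min => /andP[_ /andP[_ sr2]].
  have s0 : 0 <= s by exact: le_trans xs.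
  have h a : `|ddir (delta_mx a 0) (f i) x - ddir (delta_mx a 0) (f i) y| <=
      n%:R * (K2 * s ^+ k.-1) * `|x - y|.
    have Ca : Ck 1 (ddir (delta_mx a 0) (f i)) by exact: Ck_ddir.
    have [c /andP[c0 c1]] := mvt_line y (x - y) (fun z => Ck_diff z Ca) ler01.
    rewrite scale1r [y + (x - y)]addrC subrK mulr1 => ->.
    apply: ddir_bound => b.
    have ns : `|y + c *: (x - y)| <= s.
      have -> : y + c *: (x - y) = (1 - c) *: y + c *: x.
        by rewrite scalerBr scalerBl scale1r addrCA addrC.
      rewrite (le_trans (ler_normD _ _))// !normrZ (ger0_norm c0) ger0_norm ?subr_ge0//.
      have : (1 - c) * `|y| <= (1 - c) * s by rewrite ler_wpM2l// subr_ge0.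
      have : c * `|x| <= c * s by rewrite ler_wpM2l.
      by rewrite mulrBl mul1r; lra.
    rewrite (le_trans (h2 (i, a, b) _ (le_trans ns sr2)))// ler_wpM2l//.
    by rewrite lerXn2r// nnegrE.
  rewrite (ddir_basis (f i) x) (ddir_basis (f i) y) -sumrB.
  rewrite (le_trans (ler_norm_sum _ _ _))//.
  rewrite (@le_trans _ _ (\sum_(a < n) `|v| * (n%:R * (K2 * s ^+ k.-1) * `|x - y|)))//.
    by apply: ler_sum => a _; rewrite -mulrBr normrM ler_pM// mxnorm_coord.
  rewrite sumr_const card_ord -[leLHS]mulr_natl.
  have -> : n%:R * (`|v| * (n%:R * (K2 * s ^+ k.-1) * `|x - y|)) =
    n%:R * (n%:R * K2) * s ^+ k.-1 * `|x - y| * `|v| by ring.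
  by rewrite ler_wpM2r// ler_wpM2r// ler_wpM2r ?exprn_ge0//; lra.
Qed.

(** The remainder of f(Y) is (Df(z) - Df(Y_s)) (Y_t - Y_s) + Df(Y_s) R_{s,t} with z on the segment
    from Y_s to Y_t. Two increments of size 2 w r give 4 w^2 and the second term adds 1: hence the
    factor 5 w^2. *)
Lemma ctrl_comp (f : V -> R) k (K rho : R) : 0 <= K ->
  (forall x, differentiable f x) ->
  (forall x, `|x| <= rho -> `|f x| <= K * `|x| ^+ k.+1) ->
  (forall x v, `|x| <= rho -> `|ddir v f x| <= K * `|x| ^+ k * `|v|) ->
  (forall x y v s, `|x| <= s -> `|y| <= s -> s <= rho ->
      `|ddir v f x - ddir v f y| <= K * s ^+ k.-1 * `|x - y| * `|v|) ->
  forall gamma w (W : rpath R d) r (Y : R -> V) Y',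
  0 < gamma -> rough_on gamma w W -> r <= rho -> r <= 1 -> ctrl gamma W.1 r Y Y' ->
  ctrl gamma W.1 (5 * K * w ^+ 2 * r ^+ k.+1) (fun t => f (Y t)) (fun t v => ddir (Y' t v) f (Y t)).
Proof.
move=> K0 df h0 h1 h2 gamma w W r Y Y' g0 rW rrho r1 cY.
have rp : 0 <= r := ctrl_ge0 cY.
have w1 := rough_on_ge1 rW; have w0 : 0 <= w by exact: le_trans w1.
have ww : w <= w ^+ 2 by rewrite expr2 ler_peMl.
have w21 : 1 <= w ^+ 2 by exact: le_trans ww.
have Yr t : 0 <= t -> t <= 1 -> `|Y t| <= r by exact: ctrl_sup cY t.
have Yrho t : 0 <= t -> t <= 1 -> `|Y t| <= rho.
  by move=> t0 t1; rewrite (le_trans _ rrho)// Yr.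
have rk0 j : 0 <= r ^+ j by rewrite exprn_ge0.
have P0 : 0 <= K * r ^+ k.+1 by rewrite mulr_ge0.
(* An equality for k > 0. For k = 0 the truncated predecessor leaves r^2 <= r, which uses r <= 1. *)
have rr : r ^+ k.-1 * (r * r) <= r ^+ k.+1.
  by case: (k) => [|j] /=; rewrite ?expr0 ?mul1r ?expr1 ?ler_piMr// !exprSr mulrA.
have Bd t v : 0 <= t -> t <= 1 -> `|ddir v f (Y t)| <= K * r ^+ k * `|v|.
  move=> t0 t1; rewrite (le_trans (h1 _ _ (Yrho t t0 t1)))// ler_wpM2r// ler_wpM2l//.
  by rewrite lerXn2r ?nnegrE// Yr.
have KE : 5 * K * w ^+ 2 * r ^+ k.+1 = 5 * w ^+ 2 * (K * r ^+ k.+1) by ring.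
rewrite KE.
split.
- move=> t t0 t1; rewrite (le_trans (h0 _ (Yrho t t0 t1)))//.
  rewrite (@le_trans _ _ (K * r ^+ k.+1))//.
    by rewrite ler_wpM2l// lerXn2r ?nnegrE// Yr.
  by rewrite ler_peMl//; lra.
- move=> t v t0 t1; rewrite (le_trans (Bd t _ t0 t1))//.
  rewrite (@le_trans _ _ (K * r ^+ k * (r * `|v|)))//.
    by rewrite ler_wpM2l ?mulr_ge0// (ctrl_sup' cY).
  have -> : K * r ^+ k * (r * `|v|) = K * r ^+ k.+1 * `|v| by rewrite exprSr; ring.
  rewrite ler_wpM2r//.
  by rewrite ler_peMl//; lra.
- move=> s t v s0 st t1.
  have t0 := le_trans s0 st; have s1 := le_trans st t1.
  have iY := ctrl_incr g0 rW cY s0 st t1.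
  have -> : ddir (Y' t v) f (Y t) - ddir (Y' s v) f (Y s) =
      (ddir (Y' t v) f (Y t) - ddir (Y' t v) f (Y s)) + ddir (Y' t v - Y' s v) f (Y s).
    by rewrite ddirB addrA subrK.
  rewrite (le_trans (ler_normD _ _))//.
  have e1 := h2 (Y t) (Y s) (Y' t v) r (Yr t t0 t1) (Yr s s0 s1) rrho.
  have e2 := Bd s (Y' t v - Y' s v) s0 s1.
  set T := (t - s) `^ gamma in iY *.
  have T0 : 0 <= T by exact: powR_ge0.
  have e1' : K * r ^+ k.-1 * `|Y t - Y s| * `|Y' t v| <=
     2 * w * (K * r ^+ k.+1) * T * `|v|.
    rewrite (@le_trans _ _ (K * r ^+ k.-1 * (2 * (w * r) * T) * (r * `|v|)))//.
      apply: ler_pM => //; last exact: (ctrl_sup' cY).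
        by rewrite mulr_ge0// mulr_ge0.
      by rewrite ler_wpM2l// mulr_ge0.
    have -> : K * r ^+ k.-1 * (2 * (w * r) * T) * (r * `|v|) =
      2 * w * (K * (r ^+ k.-1 * (r * r))) * T * `|v| by ring.
    by rewrite ler_wpM2r// ler_wpM2r// ler_wpM2l ?mulr_ge0// ler_wpM2l.
  have e2' : K * r ^+ k * `|Y' t v - Y' s v| <= (K * r ^+ k.+1) * T * `|v|.
    rewrite (@le_trans _ _ (K * r ^+ k * (r * T * `|v|)))//.
      by rewrite ler_wpM2l ?mulr_ge0// (ctrl_holder' cY).
    by rewrite le_eqVlt exprSr; apply/orP; left; apply/eqP; ring.
  rewrite (le_trans (lerD (le_trans e1 e1') (le_trans e2 e2')))//.
  rewrite -!mulrDl ler_wpM2r// ler_wpM2r//.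
  rewrite -{2}(mul1r (K * _)) -mulrDl ler_wpM2r//; lra.
- move=> s t s0 st t1.
  have t0 := le_trans s0 st; have s1 := le_trans st t1.
  have iY := ctrl_incr g0 rW cY s0 st t1.
  set x := W.1 t - W.1 s.
  have [c /andP[c0 c1]] := mvt_line (Y s) (Y t - Y s) df ler01.
  rewrite scale1r [Y s + (_ - _)]addrC subrK mulr1 => E.
  rewrite E.
  set z := Y s + _.
  have -> : ddir (Y t - Y s) f z - ddir (Y' s x) f (Y s) =
     (ddir (Y t - Y s) f z - ddir (Y t - Y s) f (Y s)) + ddir (Y t - Y s - Y' s x) f (Y s).
    by rewrite (ddirB f (Y t - Y s) (Y' s x)) addrA subrK.
  have zr : `|z| <= r.
    have -> : z = (1 - c) *: Y s + c *: Y t.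
      by rewrite /z scalerBr scalerBl scale1r addrCA addrC.
    rewrite (le_trans (ler_normD _ _))// !normrZ (ger0_norm c0) ger0_norm ?subr_ge0//.
    have : (1 - c) * `|Y s| <= (1 - c) * r by rewrite ler_wpM2l ?subr_ge0// Yr.
    have : c * `|Y t| <= c * r by rewrite ler_wpM2l// Yr.
    by rewrite mulrBl mul1r; lra.
  rewrite (le_trans (ler_normD _ _))//.
  have e1 := h2 z (Y s) (Y t - Y s) r zr (Yr s s0 s1) rrho.
  have e2 := Bd s (Y t - Y s - Y' s x) s0 s1.
  have TE : (t - s) `^ (2 * gamma) = (t - s) `^ gamma * (t - s) `^ gamma.
    by rewrite mulr2n mulrDl mul1r powRD// gt_eqF//; lra.
  have e3 := ctrl_rem cY s0 st t1; rewrite -/x TE in e3; rewrite TE.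
  set T := (t - s) `^ gamma in iY e3 *.
  have T0 : 0 <= T by exact: powR_ge0.
  have zs : `|z - Y s| <= 2 * (w * r) * T.
    by rewrite /z addrC addKr normrZ ger0_norm// (le_trans _ iY)// ler_piMl.
  have e1' : K * r ^+ k.-1 * `|z - Y s| * `|Y t - Y s| <= 4 * w ^+ 2 * (K * r ^+ k.+1) * (T * T).
    rewrite (@le_trans _ _ (K * r ^+ k.-1 * (2 * (w * r) * T) * (2 * (w * r) * T)))//.
      apply: ler_pM => //; first by rewrite mulr_ge0// mulr_ge0.
      by rewrite ler_wpM2l// mulr_ge0.
    have -> : K * r ^+ k.-1 * (2 * (w * r) * T) * (2 * (w * r) * T) =
      4 * w ^+ 2 * (K * (r ^+ k.-1 * (r * r))) * (T * T) by ring.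
    by rewrite ler_wpM2r ?mulr_ge0// ler_wpM2l ?mulr_ge0 ?exprn_ge0// ler_wpM2l.
  have e2' : K * r ^+ k * `|Y t - Y s - Y' s x| <= (K * r ^+ k.+1) * (T * T).
    rewrite (@le_trans _ _ (K * r ^+ k * (r * (T * T))))//.
      by rewrite ler_wpM2l ?mulr_ge0.
    by rewrite le_eqVlt exprSr; apply/orP; left; apply/eqP; ring.
  rewrite (le_trans (lerD (le_trans e1 e1') (le_trans e2 e2')))//.
  rewrite -!mulrDl ler_wpM2r ?mulr_ge0//.
  rewrite -{2}(mul1r (K * _)) -mulrDl ler_wpM2r//; lra.
Qed.

End Composition.

(** * Entrywise calculus and homogeneous polynomials *)

Section MatrixCalculus.
Context {R : realType} {n : nat}.
Local Notation V := 'cV[R]_n.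

Lemma diff_coord p q (g : V -> 'M[R]_(p, q)) x i j : differentiable g x ->
  differentiable (fun x => g x i j : R) x /\
  forall v, ddir v (fun x => g x i j) x = ('d g x v) i j.
Proof.
move=> dg.
have dc : differentiable (fun x => g x i j : R) x.
  apply: (@differentiable_comp _ _ _ _ g (fun N : 'M[R]_(p, q) => N i j : R)) => //.
  exact: differentiable_coord.
split=> // v; rewrite /ddir -!deriveE// derive_mx; last exact: diff_derivable.
by rewrite mxE.
Qed.

Lemma coord_diff p q (g : V -> 'M[R]_(p, q)) x :
  (forall i j, differentiable (fun x => g x i j : R) x) -> differentiable g x.
Proof.
move=> h.
rewrite (_ : g = \sum_(i < p) \sum_(j < q) (fun x => (g x i j : R) *: (delta_mx i j : 'M[R]_(p, q)))).
  do 2 (apply: differentiable_sum => ?); exact: differentiableZl.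
apply/funext => y; rewrite fct_sumE {1}[g y]matrix_sum_delta; apply: eq_bigr => i _.
by rewrite fct_sumE.
Qed.

Lemma Ck_coord p q k (g : V -> 'M[R]_(p, q)) i j : Ck k g -> Ck k (fun x => g x i j : R).
Proof.
elim: k g => [|k ih] g.
  move=> cg x; apply: (@continuous_comp _ _ _ g (fun N : 'M[R]_(p, q) => N i j : R)).
    exact: cg.
  exact: coord_continuous.
move=> [dg hg]; split; first by move=> x; have [] := diff_coord i j (dg x).
move=> v; have := ih _ (hg v).
rewrite (_ : (fun x => 'd g x v i j) = (fun x => 'd (fun y => g y i j : R) x v))//.
by apply/funext => x; have [_ h] := diff_coord i j (dg x); rewrite -h.
Qed.

Lemma ddir_sub (f g : V -> R) v x : differentiable f x -> differentiable g x ->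
  ddir v (f - g) x = ddir v f x - ddir v g x.
Proof. by move=> df dg; rewrite /ddir (diffB df dg). Qed.

Lemma CkB k (f g : V -> R) : Ck k f -> Ck k g -> Ck k (f - g).
Proof.
elim: k f g => [|k ih] f g.
  by move=> cf cg x; exact: (@continuousB _ _ _ f g x (cf x) (cg x)).
move=> [df hf] [dg hg]; split; first by move=> x; exact: differentiableB.
move=> v; have := ih _ _ (hf v) (hg v).
rewrite (_ : _ - _ = (fun x => 'd (f - g) x v))//.
by apply/funext => x; rewrite -[RHS]/(ddir v (f - g) x) ddir_sub.
Qed.

(** Homogeneous polynomials of degree [l], in a form that splits off one coordinate at a time and
    thus reduces estimates to the product rule. *)
Fixpoint rpoly (l : nat) (p : V -> R) : Prop :=
  if l is l'.+1 then exists2 g : 'I_n -> V -> R, (forall a, rpoly l' (g a)) &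
    forall x, p x = \sum_(a < n) x a 0 * g a x
  else exists c, forall x, p x = c.

Lemma rpoly0 l : rpoly l (fun=> 0).
Proof.
elim: l => [|l ih]; first by exists 0.
by exists (fun=> fun=> 0) => // x; rewrite big1// => a _; rewrite mulr0.
Qed.

Lemma rpolyD l p q : rpoly l p -> rpoly l q -> rpoly l (fun x => p x + q x).
Proof.
elim: l p q => [|l ih] p q; first by move=> [c hc] [e he]; exists (c + e) => x; rewrite hc he.
move=> [g hg pg] [k hk qk]; exists (fun a x => g a x + k a x); first by move=> a; exact: (ih _ _ (hg a) (hk a)).
move=> x; rewrite pg qk -big_split; apply: eq_bigr => a _; by rewrite mulrDr.
Qed.

Lemma rpolyZ l c p : rpoly l p -> rpoly l (fun x => c * p x).
Proof.
elim: l p => [|l ih] p; first by move=> [e he]; exists (c * e) => x; rewrite he.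
move=> [g hg pg]; exists (fun a x => c * g a x); first by move=> a; exact: (ih _ (hg a)).
by move=> x; rewrite pg mulr_sumr; apply: eq_bigr => a _; rewrite mulrCA.
Qed.

Lemma rpoly_sum l m (g : 'I_m -> V -> R) : (forall a, rpoly l (g a)) ->
  rpoly l (fun x => \sum_(a < m) g a x).
Proof.
elim: m g => [|m ih] g h.
  rewrite (_ : (fun=> _) = fun=> 0); first exact: rpoly0.
  by apply/funext => x; rewrite big_ord0.
rewrite (_ : (fun=> _) = fun x => g ord0 x + \sum_(a < m) g (lift ord0 a) x).
  by apply: rpolyD => //; apply: ih.
by apply/funext => x; rewrite big_ord_recl.
Qed.

Lemma diff_coord_id (a : 'I_n) (x v : V) : differentiable (fun x : V => x a 0 : R) x /\
  ddir v (fun x : V => x a 0) x = v a 0.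
Proof.
have did : differentiable (id : V -> V) x by [].
have [h1 h2] := @diff_coord n 1 id x a 0 did.
split=> //; rewrite h2.
by rewrite diff_val.
Qed.

Lemma rpoly_diff l p : rpoly l p -> forall x, differentiable p x.
Proof.
elim: l p => [|l ih] p.
  by move=> [c /funext ->] x; exact: differentiable_cst.
move=> [g hg /funext ->] x.
rewrite (_ : (fun=> _) = \sum_(a < n) ((fun x : V => x a 0 : R) * g a)).
  apply: differentiable_sum => a; apply: differentiableM; last exact: (ih _ (hg a) x).
  by have [] := diff_coord_id a x 0.
by apply/funext => y; rewrite fct_sumE.
Qed.

Lemma ddir_sum m (f : 'I_m -> V -> R) v x : (forall a, differentiable (f a) x) ->
  ddir v (fun x => \sum_(a < m) f a x) x = \sum_(a < m) ddir v (f a) x.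
Proof.
move=> df; rewrite (_ : (fun=> _) = \sum_(a < m) f a); last first.
  by apply/funext => y; rewrite fct_sumE.
rewrite /ddir -deriveE; last exact: differentiable_sum.
rewrite derive_sum; first by apply: eq_bigr => a _; rewrite deriveE.
by move=> a; exact: diff_derivable.
Qed.

Lemma ddir_mul (f g : V -> R) v x : differentiable f x -> differentiable g x ->
  ddir v (fun x => f x * g x) x = ddir v f x * g x + f x * ddir v g x.
Proof.
move=> df dg; rewrite (_ : (fun=> _) = f * g)// /ddir -!deriveE//; last exact: differentiableM.
rewrite deriveM; [|exact: diff_derivable|exact: diff_derivable].
by rewrite /GRing.scale/= addrC; congr (_ + _); rewrite mulrC.
Qed.

Lemma rpoly_ddirE (g : 'I_n -> V -> R) v x : (forall a, differentiable (g a) x) ->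
  ddir v (fun x => \sum_(a < n) x a 0 * g a x) x =
  \sum_(a < n) (v a 0 * g a x + x a 0 * ddir v (g a) x).
Proof.
move=> dg; rewrite ddir_sum => [|a]; last first.
  by apply: differentiableM => //; have [] := diff_coord_id a x 0.
apply: eq_bigr => a _; have [h1 h2] := diff_coord_id a x v.
by rewrite ddir_mul// h2.
Qed.

Lemma ddir_cst (c : R) (v x : V) : ddir v (fun=> c) x = 0.
Proof. by rewrite /ddir (_ : (fun=> c) = cst c :> (V -> R))// diff_cst. Qed.

Lemma rpoly_ddir l p v : rpoly l p -> rpoly l.-1 (ddir v p).
Proof.
elim: l p => [|l ih] p.
  by move=> [c /funext ->]; exists 0 => x; rewrite ddir_cst.
move=> [g hg /funext ->] /=.
rewrite (_ : ddir _ _ = fun x => \sum_(a < n) v a 0 * g a x + \sum_(a < n) x a 0 * ddir v (g a) x).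
  apply: rpolyD; first by apply: (@rpoly_sum l n (fun a x => v a 0 * g a x)) => a; exact: (rpolyZ (v a 0) (hg a)).
  case: l ih hg => [|l] ih hg; last by exists (fun a => ddir v (g a)) => // a; exact: (ih _ (hg a)).
  exists 0 => x; rewrite big1// => a _; have [c /funext ->] := hg a.
  by rewrite ddir_cst mulr0.
apply/funext => x; rewrite rpoly_ddirE ?big_split// => a.
exact: rpoly_diff (hg a) x.
Qed.

Lemma rpoly_Ck k l p : rpoly l p -> Ck k p.
Proof.
elim: k l p => [|k ih] l p h.
  by move=> x; apply: differentiable_continuous; exact: rpoly_diff h x.
split; first exact: rpoly_diff h.
by move=> v; exact: (ih _ _ (rpoly_ddir v h)).
Qed.

(** Expanding the first argument in the standard basis produces the coordinate factors. With that
    argument frozen at a basis vector, a multilinear map in one argument less remains. *)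
Lemma multilinear_rpoly p q l (f : ('I_l -> V) -> 'M[R]_(p, q)) i j :
  multilinear f -> rpoly l (fun x => on_diag f x i j : R).
Proof.
elim: l f => [|l ih] f mf.
  exists (f (fun=> 0) i j) => x; rewrite /on_diag; congr (f _ i j).
  by apply/funext => -[].
pose cons (e : V) (u : 'I_l -> V) : 'I_l.+1 -> V :=
  fun k => if unlift ord0 k is Some k' then u k' else e.
have cons_upd e u : cons e u = [eta cons 0 u with ord0 |-> e].
  apply/funext => k /=; rewrite /cons; case: unliftP => [k' ->|->]; last by rewrite eqxx.
  by rewrite eq_sym (negbTE (neq_lift _ _)).
have cons_lift e u k y : cons e [eta u with k |-> y] =
    [eta cons e u with lift ord0 k |-> y].
  apply/funext => z /=; rewrite /cons; case: unliftP => [k' ->|->] /=.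
    by rewrite (inj_eq lift_inj).
  by [].
exists (fun a x => on_diag (fun u => f (cons (delta_mx a 0) u)) x i j).
  by move=> a; apply: ih => k u c x y; rewrite !cons_lift; exact: mf.
move=> x.
have fadd (y z : V) c u : f (cons (c *: y + z) u) = c *: f (cons y u) + f (cons z u).
  by rewrite cons_upd mf -!cons_upd.
have f0 u : f (cons 0 u) = 0.
  have := fadd 0 0 1 u; rewrite scaler0 addr0 scale1r => /eqP.
  by rewrite addrC -subr_eq subrr eq_sym => /eqP.
have fsum (r : seq 'I_n) u : f (cons (\sum_(a <- r) x a 0 *: delta_mx a 0) u) =
    \sum_(a <- r) x a 0 *: f (cons (delta_mx a 0) u).
  elim: r => [|a r ihr]; first by rewrite !big_nil f0.
  by rewrite !big_cons fadd ihr.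
have -> : on_diag f x = f (cons x (fun=> x)).
  by rewrite /on_diag; congr (f _); apply/funext => k; rewrite /cons; case: unlift.
have -> : f (cons x (fun=> x)) =
    f (cons (\sum_(a <- index_enum 'I_n) x a 0 *: delta_mx a 0) (fun=> x)).
  congr (f (cons _ _)); rewrite {1}[x]matrix_sum_delta; apply: eq_bigr => a _.
  by rewrite big_ord1.
rewrite fsum summxE; apply: eq_bigr => a _; by rewrite mxE.
Qed.

End MatrixCalculus.

Section PolynomialPaths.
Context {R : realType} {n d : nat}.
Local Notation V := 'cV[R]_n.

(** Each coordinate factor costs [6 * w ^+ 2] by [ctrlM]. For differences, y_a g(y) - u_a g(u) = (y
    - u)_a g(y) + u_a (g(y) - g(u)) replaces one factor [r] by [D], in [l] ways altogether. *)
Lemma rpoly_ctrl l (p : V -> R) : rpoly l p -> exists2 K : R, 0 <= K &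
  forall gamma w (W : rpath R d), 0 < gamma -> rough_on gamma w W ->
  (forall r (Y : R -> V) Y', ctrl gamma W.1 r Y Y' ->
     ctrl gamma W.1 (K * ((6 * w ^+ 2) ^+ l * r ^+ l))
       (fun t => p (Y t)) (fun t v => ddir (Y' t v) p (Y t))) /\
  (forall r D (Y U : R -> V) Y' U', ctrl gamma W.1 r Y Y' -> ctrl gamma W.1 r U U' ->
     ctrl gamma W.1 D (fun t => Y t - U t) (fun t v => Y' t v - U' t v) ->
     ctrl gamma W.1 (K * (l%:R * ((6 * w ^+ 2) ^+ l * (D * r ^+ l.-1))))
       (fun t => p (Y t) - p (U t))
       (fun t v => ddir (Y' t v) p (Y t) - ddir (U' t v) p (U t))).
Proof.
elim: l p => [|l ih] p.
  move=> [c /funext ->]; exists `|c| => // gamma w W g0 rW; split.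
    move=> r Y Y' cY; rewrite !expr0 !mulr1.
    by apply: ctrl_ext (ctrl_cst gamma W.1 c) => // t v; rewrite ddir_cst.
  move=> r D Y U Y' U' cY cU cD; rewrite mul0r mulr0.
  apply: ctrl_ext (ctrl0 _ gamma W.1) => [t|t v]; first by rewrite subrr.
  by rewrite !ddir_cst subrr.
move=> [g hg pg].
have dg a x : differentiable (g a) x by exact: (rpoly_diff (hg a) x).
have /choice[Kf hK] : forall a, exists K : R, 0 <= K /\
  forall gamma w (W : rpath R d), 0 < gamma -> rough_on gamma w W ->
  (forall r (Y : R -> V) Y', ctrl gamma W.1 r Y Y' ->
     ctrl gamma W.1 (K * ((6 * w ^+ 2) ^+ l * r ^+ l))
       (fun t => g a (Y t)) (fun t v => ddir (Y' t v) (g a) (Y t))) /\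
  (forall r D (Y U : R -> V) Y' U', ctrl gamma W.1 r Y Y' -> ctrl gamma W.1 r U U' ->
     ctrl gamma W.1 D (fun t => Y t - U t) (fun t v => Y' t v - U' t v) ->
     ctrl gamma W.1 (K * (l%:R * ((6 * w ^+ 2) ^+ l * (D * r ^+ l.-1))))
       (fun t => g a (Y t) - g a (U t))
       (fun t v => ddir (Y' t v) (g a) (Y t) - ddir (U' t v) (g a) (U t))).
  by move=> a; have [K K0 h] := ih _ (hg a); exists K.
move/funext: pg => ->.
exists (\sum_a Kf a); first by apply: sumr_ge0 => a _; case: (hK a).
move=> gamma w W g0 rW; split.
- move=> r Y Y' cY.
  have h a : ctrl gamma W.1 (Kf a * ((6 * w ^+ 2) ^+ l.+1 * r ^+ l.+1))
      (fun t => Y t a 0 * g a (Y t) : R)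
      (fun t v => Y' t v a 0 * g a (Y t) + Y t a 0 * ddir (Y' t v) (g a) (Y t)).
    have [_ /(_ gamma w W g0 rW)[h1 _]] := hK a.
    have := ctrlM g0 rW (ctrl_coord a 0 cY) (h1 r Y Y' cY).
    by apply: ctrl_le; rewrite !exprS le_eqVlt; apply/orP; left; apply/eqP; ring.
  have := ctrl_sum h; rewrite -mulr_suml.
  by apply: ctrl_ext => // t v; rewrite rpoly_ddirE.
- move=> r D Y U Y' U' cY cU cD.
  have D0 := ctrl_ge0 cD; have r0 := ctrl_ge0 cY.
  have h a : ctrl gamma W.1 (Kf a * (l.+1%:R * ((6 * w ^+ 2) ^+ l.+1 * (D * r ^+ l))))
      (fun t => Y t a 0 * g a (Y t) - U t a 0 * g a (U t) : R)
      (fun t v => (Y' t v a 0 * g a (Y t) + Y t a 0 * ddir (Y' t v) (g a) (Y t)) -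
        (U' t v a 0 * g a (U t) + U t a 0 * ddir (U' t v) (g a) (U t))).
    have [Ka0 /(_ gamma w W g0 rW)[h1 h2]] := hK a.
    have c1 := ctrlM g0 rW (ctrl_coord a 0 cD) (h1 r Y Y' cY).
    have c2 := ctrlM g0 rW (ctrl_coord a 0 cU) (h2 r D Y U Y' U' cY cU cD).
    have := ctrlD c1 c2; set B := (X in ctrl _ _ X) => h.
    apply: (@ctrl_le _ _ _ _ _ B).
      rewrite /B; move: (6 * w ^+ 2) (Kf a) => X Ka; rewrite -(@natr1 _ l) (exprS X).
      (* At l = 0 the factor [l%:R] hides the truncated predecessor. *)
      have lr : l%:R * (r * r ^+ l.-1) = l%:R * r ^+ l.
        by case: (l) => [|j]; rewrite ?mul0r//= -exprS.
      rewrite le_eqVlt; apply/orP; left; apply/eqP.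
      transitivity (X * (Ka * X ^+ l * D) * (r ^+ l + l%:R * (r * r ^+ l.-1))).
        by ring.
      by rewrite lr; ring.
    apply: ctrl_ext h => [t|t v]; rewrite ?mxE; ring.
  have := ctrl_sum h; rewrite -mulr_suml.
  apply: ctrl_ext => [t|t v]; rewrite sumrB//.
  by rewrite !rpoly_ddirE.
Qed.

Lemma mpoly_ctrl p q l (f : V -> 'M[R]_(p, q)) :
  (forall i j, rpoly l (fun x => f x i j : R)) -> exists2 K : R, 0 <= K &
  forall gamma w (W : rpath R d), 0 < gamma -> rough_on gamma w W ->
  (forall r (Y : R -> V) (Y' : R -> 'cV[R]_d -> V), ctrl gamma W.1 r Y Y' ->
     ctrl gamma W.1 (K * ((6 * w ^+ 2) ^+ l * r ^+ l))
       (fun t => f (Y t)) (fun t v => 'd f (Y t) (Y' t v))) /\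
  (forall r D (Y U : R -> V) (Y' U' : R -> 'cV[R]_d -> V), ctrl gamma W.1 r Y Y' -> ctrl gamma W.1 r U U' ->
     ctrl gamma W.1 D (fun t => Y t - U t) (fun t v => Y' t v - U' t v) ->
     ctrl gamma W.1 (K * (l%:R * ((6 * w ^+ 2) ^+ l * (D * r ^+ l.-1))))
       (fun t => f (Y t) - f (U t))
       (fun t v => 'd f (Y t) (Y' t v) - 'd f (U t) (U' t v))).
Proof.
move=> h; have df x : differentiable f x.
  by apply: coord_diff => i j; exact: (rpoly_diff (h i j) x).
have dE i j x v : ('d f x v) i j = ddir v (fun x => f x i j : R) x.
  by have [_ ->] := diff_coord i j (df x).
have /choice[Kf hK] : forall ij : 'I_p * 'I_q, exists K : R, 0 <= K /\
  forall gamma w (W : rpath R d), 0 < gamma -> rough_on gamma w W ->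
  (forall r (Y : R -> V) Y', ctrl gamma W.1 r Y Y' ->
     ctrl gamma W.1 (K * ((6 * w ^+ 2) ^+ l * r ^+ l))
       (fun t => f (Y t) ij.1 ij.2 : R) (fun t v => ddir (Y' t v) (fun x => f x ij.1 ij.2 : R) (Y t))) /\
  (forall r D (Y U : R -> V) Y' U', ctrl gamma W.1 r Y Y' -> ctrl gamma W.1 r U U' ->
     ctrl gamma W.1 D (fun t => Y t - U t) (fun t v => Y' t v - U' t v) ->
     ctrl gamma W.1 (K * (l%:R * ((6 * w ^+ 2) ^+ l * (D * r ^+ l.-1))))
       (fun t => f (Y t) ij.1 ij.2 - f (U t) ij.1 ij.2 : R)
       (fun t v => ddir (Y' t v) (fun x => f x ij.1 ij.2 : R) (Y t) -
          ddir (U' t v) (fun x => f x ij.1 ij.2 : R) (U t))).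
  by move=> ij; have [K K0 hh] := rpoly_ctrl (h ij.1 ij.2); exists K.
have KS ij : Kf ij <= \sum_i Kf i.
  rewrite (bigD1 ij)//= lerDl sumr_ge0// => i _; by case: (hK i).
have KS0 : 0 <= \sum_i Kf i by apply: sumr_ge0 => i _; case: (hK i).
exists (\sum_i Kf i) => // gamma w W g0 rW.
have w60 : 0 <= (6 * w ^+ 2) ^+ l.
  by rewrite exprn_ge0// mulr_ge0// exprn_ge0// (le_trans _ (rough_on_ge1 rW)).
split.
- move=> r Y Y' cY; have r0 := ctrl_ge0 cY.
  have P0 : 0 <= (6 * w ^+ 2) ^+ l * r ^+ l by rewrite mulr_ge0// exprn_ge0.
  apply: ctrl_entries => [|i j]; first by rewrite mulr_ge0.
  have [_ /(_ gamma w W g0 rW)[h1 _]] := hK (i, j).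
  apply: ctrl_le (ctrl_ext _ _ (h1 r Y Y' cY)) => [|//|t v]; first by rewrite ler_wpM2r.
  by rewrite dE.
- move=> r D Y U Y' U' cY cU cD; have r0 := ctrl_ge0 cY; have D0 := ctrl_ge0 cD.
  have P0 : 0 <= l%:R * ((6 * w ^+ 2) ^+ l * (D * r ^+ l.-1)).
    by rewrite !mulr_ge0// exprn_ge0.
  apply: ctrl_entries => [|i j]; first by rewrite mulr_ge0.
  have [_ /(_ gamma w W g0 rW)[_ h2]] := hK (i, j).
  apply: ctrl_le (ctrl_ext _ _ (h2 r D Y U Y' U' cY cU cD)) => [|t|t v]; first by rewrite ler_wpM2r.
    by rewrite !mxE.
  by rewrite !mxE !dE.
Qed.

Lemma matrix_ctrl_comp p q (f : V -> 'M[R]_(p, q)) k :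
  (forall i j, Ck 2 (fun x => f x i j : R)) ->
  (forall i j, bigO0 (fun x => f x i j : R) k.+1) ->
  (forall i j a, bigO0 (ddir (delta_mx a 0) (fun x => f x i j : R)) k) ->
  (forall i j a b, bigO0 (ddir (delta_mx b 0) (ddir (delta_mx a 0) (fun x => f x i j : R))) k.-1) ->
  exists K rho : R, [/\ 0 <= K, 0 < rho &
  forall gamma w (W : rpath R d) r (Y : R -> V) (Y' : R -> 'cV[R]_d -> V),
  0 < gamma -> rough_on gamma w W -> r <= rho -> r <= 1 -> ctrl gamma W.1 r Y Y' ->
  ctrl gamma W.1 (K * (w ^+ 2 * r ^+ k.+1)) (fun t => f (Y t)) (fun t v => 'd f (Y t) (Y' t v))].
Proof.
move=> C2 O0 O1 O2.
have [K [rho [K0 rho0 h0 h1 h2]]] := @local_bounds R n _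
  (fun (ij : 'I_p * 'I_q) x => f x ij.1 ij.2 : R) k (fun ij => C2 ij.1 ij.2)
  (fun ij => O0 ij.1 ij.2) (fun ij => O1 ij.1 ij.2) (fun ij => O2 ij.1 ij.2).
exists (5 * K), rho; split; rewrite ?mulr_ge0//.
move=> gamma w W r Y Y' g0 rW rrho r1 cY; have r0 := ctrl_ge0 cY.
have w0 : 0 <= w by rewrite (le_trans _ (rough_on_ge1 rW)).
have df x : differentiable f x.
  by apply: coord_diff => i j; exact: (Ck_diff x (C2 i j)).
apply: ctrl_entries => [|i j]; first by rewrite !mulr_ge0// exprn_ge0.
have := ctrl_comp K0 (fun x => Ck_diff x (C2 i j)) (h0 (i, j)) (h1 (i, j)) (h2 (i, j))
  g0 rW rrho r1 cY.
rewrite -!mulrA => h; apply: ctrl_ext h => // t v.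
by have [_ ->] := diff_coord i j (df (Y t)).
Qed.

End PolynomialPaths.

(** * Bounds on the coefficients and on their leading terms near 0 *)

Section LeadingOrder.
Context {R : realType} {n : nat}.
Local Notation V := 'cV[R]_n.

Lemma leading_bound p q l (f g : V -> 'M[R]_(p, q)) :
  f = g +O_ (0 : V) (fun u => `|u| ^+ l) ->
  exists K rho : R, [/\ 0 <= K, 0 < rho &
    forall x, `|x| <= rho -> `|f x - g x| <= K * `|x| ^+ l].
Proof.
move/eqaddOP => [K0 [_ hK]].
have : \forall x \near (0 : V), `|(f - g) x| <= (`|K0| + 1) * `| `|x| ^+ l |.
  by apply: hK; rewrite (le_lt_trans (ler_norm _))// ltrDl.
rewrite -nbhs_nearE => /nbhs_ballP[e /= e0 he].
exists (`|K0| + 1), (e / 2); split; rewrite ?divr_gt0 ?addr_ge0//.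
move=> x xe; have hx : `|f x - g x| <= (`|K0| + 1) * `| `|x| ^+ l |.
  apply: (he x); rewrite -ball_normE/= sub0r normrN (le_lt_trans xe)//.
  by rewrite ltr_pdivrMr// ltr_pMr// ltr1n.
by move: hx; rewrite [X in _ * X]ger0_norm ?exprn_ge0.
Qed.

(** Differentiability alone gives o(|x|). This is the smallness of [F] available when m = 1, where
    it is merely C^1. *)
Lemma small_at0 p q (f : V -> 'M[R]_(p, q)) (e : R) : differentiable f 0 ->
  f 0 = 0 -> (forall v, 'd f 0 v = 0) -> 0 < e ->
  exists2 rho : R, 0 < rho & forall x, `|x| <= rho -> `|f x| <= e * `|x|.
Proof.
move=> df f0 df0 e0.
have := diff_locallyx df; set k := 'o _ => hk.
have /(littleoP [littleo of k]) : 0 < e by [].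
rewrite -nbhs_nearE => /nbhs_ballP[r /= r0 hr].
exists (r / 2); first by rewrite divr_gt0.
move=> x xr; have := hk x; rewrite addr0 f0 df0 !add0r => ->.
apply: hr; rewrite -ball_normE/= sub0r normrN (le_lt_trans xr)//.
by rewrite ltr_pdivrMr// ltr_pMr// ltr1n.
Qed.

Lemma quadratic_at0 p q (f : V -> 'M[R]_(p, q)) : Ck 2 f -> f 0 = 0 ->
  (forall v, 'd f 0 v = 0) ->
  exists K rho : R, [/\ 0 <= K, 0 < rho & forall x, `|x| <= rho -> `|f x| <= K * `|x| ^+ 2].
Proof.
move=> Cf f0 df0.
have O2 (ij : 'I_p * 'I_q) : bigO0 (fun x => f x ij.1 ij.2 : R) 2.
  have Cij := Ck_coord ij.1 ij.2 Cf.
  apply: bigO0_integrate => [|x|a]; [by rewrite f0 mxE|exact: Ck_diff Cij|].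
  have Ca := Ck_ddir (delta_mx a 0) Cij.
  apply: bigO0_integrate => [|x|b]; [|exact: Ck_diff Ca|].
    have [_ ->] := diff_coord ij.1 ij.2 (Cf.1 0).
    by rewrite df0 mxE.
  by apply: bigO0_cont; exact: (Ck_ddir (delta_mx b 0) Ca).
have [K [rho [K0 r0 h]]] := bigO0_fin O2; exists K, rho; split=> // x xr.
by apply: mxnorm_le => [|i j]; [rewrite mulr_ge0|exact: (h (i, j))].
Qed.

End LeadingOrder.

Section Coefficients.
Context {R : realType} {n d : nat}.
Local Notation V := 'cV[R]_n.

(** The interface between the coefficients and the dynamics. The quadratic bound on the drift is
    restricted to l > 0, where m >= 2 makes [F] of class C^2; the linear bound [cb_F], with a ball
    depending on [e], serves the Gronwall argument for every l. *)
Record coeff_bounds (l : nat) (K rho : R) (F Fl : V -> V) (G Gl : V -> 'M[R]_(n, d)) : Prop := {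
  cb_K : 1 <= K;
  cb_rho : 0 < rho;
  cb_Fcont : continuous F;
  cb_Flcont : continuous Fl;
  cb_F : forall e : R, 0 < e -> exists2 rh : R, 0 < rh & forall x, `|x| <= rh -> `|F x| <= e * `|x|;
  cb_F2 : (0 < l)%N -> forall x, `|x| <= rho -> `|F x| <= K * `|x| ^+ 2;
  cb_G : forall gamma w (W : rpath R d) r (Y : R -> V) (Y' : R -> 'cV[R]_d -> V),
    0 < gamma -> rough_on gamma w W -> r <= rho -> ctrl gamma W.1 r Y Y' ->
    ctrl gamma W.1 (K * (w ^+ 2 * r ^+ 3)) (fun t => G (Y t)) (fun t v => 'd G (Y t) (Y' t v));
  cb_FFl : forall x, `|x| <= rho -> `|F x - Fl x| <= K * `|x| ^+ l.+1;
  cb_GGl : forall gamma w (W : rpath R d) r (Y : R -> V) (Y' : R -> 'cV[R]_d -> V),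
    0 < gamma -> rough_on gamma w W -> r <= rho -> ctrl gamma W.1 r Y Y' ->
    ctrl gamma W.1 (K * (w ^+ 2 * r ^+ l.+1)) (fun t => G (Y t) - Gl (Y t))
      (fun t v => 'd G (Y t) (Y' t v) - 'd Gl (Y t) (Y' t v));
  cb_Fl : forall gamma w (W : rpath R d) r D (Y U : R -> V) (Y' U' : R -> 'cV[R]_d -> V),
    0 < gamma -> rough_on gamma w W ->
    ctrl gamma W.1 r Y Y' -> ctrl gamma W.1 r U U' ->
    ctrl gamma W.1 D (fun t => Y t - U t) (fun t v => Y' t v - U' t v) ->
    forall t, 0 <= t -> t <= 1 ->
    `|Fl (Y t) - Fl (U t)| <= K * (l%:R * (w ^+ (2 * l) * (D * r ^+ l.-1)));
  cb_Gl : forall gamma w (W : rpath R d) r D (Y U : R -> V) (Y' U' : R -> 'cV[R]_d -> V),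
    0 < gamma -> rough_on gamma w W ->
    ctrl gamma W.1 r Y Y' -> ctrl gamma W.1 r U U' ->
    ctrl gamma W.1 D (fun t => Y t - U t) (fun t v => Y' t v - U' t v) ->
    ctrl gamma W.1 (K * (l%:R * (w ^+ (2 * l) * (D * r ^+ l.-1))))
       (fun t => Gl (Y t) - Gl (U t))
       (fun t v => 'd Gl (Y t) (Y' t v) - 'd Gl (U t) (U' t v)) }.

Lemma diff_sub_mx p q (f g : V -> 'M[R]_(p, q)) x v :
  differentiable f x -> differentiable g x ->
  'd (f - g) x v = 'd f x v - 'd g x v.
Proof.
move=> df dg; apply/matrixP => i j.
have [dfi hf] := diff_coord i j df; have [dgi hg] := diff_coord i j dg.
have [_ <-] := diff_coord i j (differentiableB df dg).
have -> : (fun x => (f - g) x i j) = (fun x => f x i j : R) - (fun x => g x i j).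
  by apply/funext => y; rewrite !mxE.
by rewrite ddir_sub// hf hg !mxE.
Qed.

(** [bigO0_ddir] differentiates the pointwise bound on G - Gl twice, losing one order each time. The
    regularity it consumes is covered by l < m and G of class C^(m+3), as the polynomial [Gl] is
    smooth. *)
Lemma leading_remainder_ctrl m l (G : V -> 'M[R]_(n, d)) (Gl : ('I_l -> V) -> 'M[R]_(n, d)) :
  (l < m)%N -> Ck (m + 3) G -> multilinear Gl ->
  G = on_diag Gl +O_ (0 : V) (fun u => `|u| ^+ l.+1) ->
  exists K rho : R, [/\ 0 <= K, 0 < rho &
  forall gamma w (W : rpath R d) r (Y : R -> V) (Y' : R -> 'cV[R]_d -> V),
  0 < gamma -> rough_on gamma w W -> r <= rho -> r <= 1 -> ctrl gamma W.1 r Y Y' ->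
  ctrl gamma W.1 (K * (w ^+ 2 * r ^+ l.+1)) (fun t => G (Y t) - on_diag Gl (Y t))
    (fun t v => 'd G (Y t) (Y' t v) - 'd (on_diag Gl) (Y t) (Y' t v))].
Proof.
move=> lm CG mGl /leading_bound [K0 [rho0 [K00 r00 h0]]].
pose H : V -> 'M[R]_(n, d) := G - on_diag Gl.
have pij i j : rpoly l (fun x => on_diag Gl x i j : R) by exact: multilinear_rpoly.
have CH i j : Ck (m + 3) (fun x => H x i j : R).
  have -> : (fun x => H x i j) = (fun x => G x i j) - (fun x => on_diag Gl x i j) :> (V -> R).
    by apply/funext => x; rewrite /H !mxE.
  by apply: CkB; [exact: Ck_coord CG|exact: rpoly_Ck (pij i j)].
have O0 i j : bigO0 (fun x => H x i j : R) l.+1.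
  apply: (bigO0_intro r00 (K := K0)) => x /h0.
  by apply: le_trans; exact: (mxnorm_coord (H x)).
have O1 i j a : bigO0 (ddir (delta_mx a 0) (fun x => H x i j : R)) l.
  by apply: bigO0_ddir (O0 i j); apply: Ck_le (CH i j); lia.
(* At k = 0 the order cannot drop further, and continuity of the derivative provides the bound of
   order 0. *)
have aux (f : V -> R) v k : (k < m)%N -> Ck (m + 2) f -> bigO0 f k -> bigO0 (ddir v f) k.-1.
  case: k => [|k] km Cf h; last by apply: bigO0_ddir h; apply: Ck_le Cf; lia.
  by apply: bigO0_cont; apply: (Ck_continuous (k := m.+1)); apply: Ck_ddir; rewrite -addn2.
have O2 i j a b : bigO0 (ddir (delta_mx b 0) (ddir (delta_mx a 0) (fun x => H x i j : R))) l.-1.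
  have Ca : Ck (m + 2) (ddir (delta_mx a 0) (fun x => H x i j : R)).
    by apply: Ck_ddir; rewrite -addnS; exact: CH.
  exact: aux lm Ca (O1 i j a).
have C2 i j : Ck 2 (fun x => H x i j : R) by apply: Ck_le (CH i j); lia.
have [K [rho [? ? h]]] := @matrix_ctrl_comp R n d n d H l C2 O0 O1 O2.
exists K, rho; split => // gamma w W r Y Y' g0 rW rrho r1 cY.
apply: ctrl_ext (h gamma w W r Y Y' g0 rW rrho r1 cY) => // t v.
have dG x : differentiable G x by move: CG; rewrite addnS => CG; exact: Ck_diff CG.
have dGl x : differentiable (on_diag Gl) x.
  by apply: coord_diff => i j; exact: (rpoly_diff (pij i j) x).
exact: (diff_sub_mx (Y' t v) (dG (Y t)) (dGl (Y t))).
Qed.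

(** Here the orders go upwards: starting from locally bounded third derivatives, each vanishing
    value at 0 permits one more integration. *)
Lemma cubic_ctrl m (G : V -> 'M[R]_(n, d)) :
  Ck (m + 3) G -> G 0 = 0 -> (forall v, 'd G 0 v = 0) ->
  (forall v w, 'd (fun x => 'd G x v) 0 w = 0) ->
  exists K rho : R, [/\ 0 <= K, 0 < rho &
  forall gamma w (W : rpath R d) r (Y : R -> V) (Y' : R -> 'cV[R]_d -> V),
  0 < gamma -> rough_on gamma w W -> r <= rho -> r <= 1 -> ctrl gamma W.1 r Y Y' ->
  ctrl gamma W.1 (K * (w ^+ 2 * r ^+ 3)) (fun t => G (Y t)) (fun t v => 'd G (Y t) (Y' t v))].
Proof.
move=> CG G0 DG0 D2G0.
have C3 : Ck 3 G by apply: Ck_le CG; lia.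
have Cij i j : Ck 3 (fun x => G x i j : R) by exact: Ck_coord C3.
have Ca a i j := Ck_ddir (delta_mx a 0) (Cij i j).
have Cab a b i j := Ck_ddir (delta_mx b 0) (Ca a i j).
have dE i j v x : ddir v (fun x => G x i j : R) x = ('d G x v) i j.
  by have [_ ->] := diff_coord i j (C3.1 x).
have O2 i j a b : bigO0 (ddir (delta_mx b 0) (ddir (delta_mx a 0) (fun x => G x i j : R))) 1.
  apply: bigO0_integrate => [|x|c]; [|exact: Ck_diff (Cab a b i j)|].
    have -> : ddir (delta_mx a 0) (fun x => G x i j : R) = fun x => ('d G x (delta_mx a 0)) i j.
      by apply/funext => x; rewrite dE.
    have d2 : differentiable (fun x => 'd G x (delta_mx a 0)) 0 by case: C3 => _ /(_ (delta_mx a 0))[].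
    by have [_ ->] := diff_coord i j d2; rewrite D2G0 mxE.
  by apply: bigO0_cont; exact: (Ck_ddir (delta_mx c 0) (Cab a b i j)).
have O1 i j a : bigO0 (ddir (delta_mx a 0) (fun x => G x i j : R)) 2.
  apply: bigO0_integrate => [|x|b //]; last exact: Ck_diff (Ca a i j).
  by rewrite dE DG0 mxE.
have O0 i j : bigO0 (fun x => G x i j : R) 3.
  apply: bigO0_integrate => [|x|a //]; last exact: Ck_diff (Cij i j).
  by rewrite G0 mxE.
exact: (@matrix_ctrl_comp R n d n d G 2 (fun i j => Ck_pred (Cij i j)) O0 O1 O2).
Qed.

Lemma coeff_boundsP m l (F : V -> V) (G : V -> 'M[R]_(n, d))
  (Fl : ('I_l -> V) -> V) (Gl : ('I_l -> V) -> 'M[R]_(n, d)) :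
  (l < m)%N -> Ck m F -> F 0 = 0 -> (forall v, 'd F 0 v = 0) ->
  Ck (m + 3) G -> G 0 = 0 -> (forall v, 'd G 0 v = 0) ->
  (forall v w, 'd (fun x => 'd G x v) 0 w = 0) ->
  multilinear Fl -> multilinear Gl ->
  F = on_diag Fl +O_ (0 : V) (fun u => `|u| ^+ l.+1) ->
  G = on_diag Gl +O_ (0 : V) (fun u => `|u| ^+ l.+1) ->
  exists K rho : R, coeff_bounds l K rho F (on_diag Fl) G (on_diag Gl).
Proof.
move=> lm CF F0 DF0 CG G0 DG0 D2G0 mFl mGl OF OG.
have dF x : differentiable F x.
  by case: (m) lm CF => [//|k] _ CF; exact: CF.1.
have pF i j : rpoly l (fun x => on_diag Fl x i j : R) by exact: multilinear_rpoly.
have pG i j : rpoly l (fun x => on_diag Gl x i j : R) by exact: multilinear_rpoly.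
have [K1 [r1 [K10 r10 h1]]] := cubic_ctrl CG G0 DG0 D2G0.
have [K2 [r2 [K20 r20 h2]]] := leading_remainder_ctrl lm CG mGl OG.
have [K3 [r3 [K30 r30 h3]]] := leading_bound OF.
have [K4 [r4 [K40 r40 h4]]] : exists K rho : R, [/\ 0 <= K, 0 < rho &
    (0 < l)%N -> forall x, `|x| <= rho -> `|F x| <= K * `|x| ^+ 2].
  case: (posnP l) => [l0|l0]; first by exists 0, 1; split=> // h; exfalso; lia.
  have C2 : Ck 2 F by apply: Ck_le CF; lia.
  by have [K [r [? ? h]]] := quadratic_at0 C2 F0 DF0; exists K, r.
have [K5 K50 h5] := @mpoly_ctrl R n d _ _ _ _ pF.
have [K6 K60 h6] := @mpoly_ctrl R n d _ _ _ _ pG.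
have s60 : 1 <= (6 : R) ^+ l by rewrite exprn_ege1// ler1n.
(* The factors 6^l reduce the (6 w^2)^l of the polynomial estimates to w^(2 l). *)
pose K := 1 + (K1 + K2 + K3 + K4) + (K5 * 6 ^+ l + K6 * 6 ^+ l).
have K56 : 0 <= K5 * 6 ^+ l /\ 0 <= K6 * 6 ^+ l by rewrite !mulr_ge0// (le_trans _ s60).
have KK : [/\ 1 <= K, K1 <= K, K2 <= K, K3 <= K & K4 <= K] /\ (K5 * 6 ^+ l <= K /\ K6 * 6 ^+ l <= K).
  rewrite /K; case: K56; move: (K5 * _) (K6 * _) => X Y X0 Y0.
  by clear -K10 K20 K30 K40 X0 Y0; do 2?split; lra.
case: KK => -[Kge1 KK1 KK2 KK3 KK4] [KK5 KK6].
(* The cap 1 discharges the side condition [r <= 1] of the composition bounds. *)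
pose r := Num.min (Num.min (Num.min r1 r2) (Num.min r3 r4)) 1.
exists K, r; split => //.
- by rewrite /r !lt_min r10 r20 r30 r40 ltr01.
- by move=> x; exact: differentiable_continuous.
- move=> x; apply: differentiable_continuous; apply: coord_diff => i j.
  exact: (rpoly_diff (pF i j)).
- by move=> e e0; exact: small_at0.
- move=> l0 x; rewrite !le_min -!andbA => /and5P[_ _ _ x4 _].
  by apply: le_trans (h4 l0 x x4) _; rewrite ler_wpM2r.
- move=> gamma w W s Y Y' g0 rW; rewrite !le_min -!andbA => /and5P[s1 _ _ _ s5] cY.
  apply: ctrl_le (h1 _ _ _ _ _ _ g0 rW s1 s5 cY).
  by rewrite ler_wpM2r// mulr_ge0 ?sqr_ge0 ?exprn_ge0// (ctrl_ge0 cY).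
- move=> x; rewrite !le_min -!andbA => /and5P[_ _ x3 _ _].
  by apply: le_trans (h3 x x3) _; rewrite ler_wpM2r// exprn_ge0.
- move=> gamma w W s Y Y' g0 rW; rewrite !le_min -!andbA => /and5P[_ s2 _ _ s5] cY.
  apply: ctrl_le (h2 _ _ _ _ _ _ g0 rW s2 s5 cY).
  by rewrite ler_wpM2r// mulr_ge0 ?sqr_ge0 ?exprn_ge0// (ctrl_ge0 cY).
- move=> gamma w W s D Y U Y' U' g0 rW cY cU cD t t0 t1.
  have h := (h5 gamma w W g0 rW).2 _ _ _ _ _ _ cY cU cD.
  apply: le_trans (ctrl_sup h t0 t1) _.
  have -> : K5 * (l%:R * ((6 * w ^+ 2) ^+ l * (D * s ^+ l.-1))) =
      (K5 * 6 ^+ l) * (l%:R * (w ^+ (2 * l) * (D * s ^+ l.-1))).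
    by rewrite exprMn -exprM -!mulrA; congr (_ * _); rewrite mulrCA.
  rewrite ler_wpM2r//.
  by rewrite !mulr_ge0 ?exprn_ge0 ?(ctrl_ge0 cD) ?(ctrl_ge0 cY) ?(le_trans _ (rough_on_ge1 rW)).
- move=> gamma w W s D Y U Y' U' g0 rW cY cU cD.
  have h := (h6 gamma w W g0 rW).2 _ _ _ _ _ _ cY cU cD.
  apply: ctrl_le h.
  have -> : K6 * (l%:R * ((6 * w ^+ 2) ^+ l * (D * s ^+ l.-1))) =
      (K6 * 6 ^+ l) * (l%:R * (w ^+ (2 * l) * (D * s ^+ l.-1))).
    by rewrite exprMn -exprM -!mulrA; congr (_ * _); rewrite mulrCA.
  rewrite ler_wpM2r//.
  by rewrite !mulr_ge0 ?exprn_ge0 ?(ctrl_ge0 cD) ?(ctrl_ge0 cY) ?(le_trans _ (rough_on_ge1 rW)).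
Qed.

End Coefficients.

(** * From extended norms to [ctrl]; the cut-off, the center orbit and the blocks *)

Section NormConversion.
Context {R : realType}.

Lemma holder_norm_le (V : normedModType R) (a b al B : R) (f : R -> R -> V) :
  (forall s t, a <= s -> s < t -> t <= b -> `|f s t| <= B * (t - s) `^ al) ->
  (holder_norm a b al f <= B%:E)%E.
Proof.
move=> h; apply: ge_ereal_sup => _ [[s t] /= [as_ st tb] <-].
by rewrite lee_fin ler_pdivrMr ?powR_gt0 ?subr_gt0//; exact: h.
Qed.

Lemma holder_norm_bound (V : normedModType R) (a b al B : R) (f : R -> R -> V) :
  (holder_norm a b al f <= B%:E)%E ->
  forall s t, a <= s -> s < t -> t <= b -> `|f s t| <= B * (t - s) `^ al.
Proof.
move=> h s t as_ st tb.
have : ((`|f s t| / (t - s) `^ al)%:E <= B%:E)%E.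
  by apply: le_trans h; apply: ereal_sup_ubound; exists (s, t).
by rewrite lee_fin ler_pdivrMr ?powR_gt0 ?subr_gt0.
Qed.

Lemma holder_norm_ge0 (V : normedModType R) (a b al : R) (f : R -> R -> V) :
  a < b -> (0 <= holder_norm a b al f)%E.
Proof.
move=> ab; apply: (@le_trans _ _ (`|f a b| / (b - a) `^ al)%:E).
  by rewrite lee_fin divr_ge0// powR_ge0.
by apply: ereal_sup_ubound; exists (a, b).
Qed.

Lemma sup_norm_le (V : normedModType R) (B : R) (Y : R -> V) :
  (forall t, 0 <= t -> t <= 1 -> `|Y t| <= B) -> (sup_norm Y <= B%:E)%E.
Proof.
move=> h; apply: ge_ereal_sup => _ [t /=] + <-.
by rewrite in_itv/= lee_fin => /andP[]; exact: h.
Qed.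

Lemma sup_norm_bound (V : normedModType R) (B : R) (Y : R -> V) :
  (sup_norm Y <= B%:E)%E -> forall t, 0 <= t -> t <= 1 -> `|Y t| <= B.
Proof.
move=> h t t0 t1; rewrite -lee_fin; apply: le_trans h.
by apply: ereal_sup_ubound; exists t => //=; rewrite in_itv/= t0 t1.
Qed.

Lemma sup_norm_ge0 (V : normedModType R) (Y : R -> V) : (0 <= sup_norm Y)%E.
Proof.
apply: (@le_trans _ _ `|Y 0|%:E); first by rewrite lee_fin.
by apply: ereal_sup_ubound; exists 0 => //=; rewrite in_itv/= lexx ler01.
Qed.

Lemma cpath0E n d (t : R) :
  ((0 : cpath R n d).1 t = 0) * ((0 : cpath R n d).2 t = 0).
Proof. by []. Qed.

Lemma cpathBE n d (U V : cpath R n d) t :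
  ((U - V).1 t = U.1 t - V.1 t) * ((U - V).2 t = U.2 t - V.2 t).
Proof. by []. Qed.

Lemma cpathZE n d (c : R) (U : cpath R n d) t :
  ((c *: U).1 t = c *: U.1 t) * ((c *: U).2 t = c *: U.2 t).
Proof. by []. Qed.

Definition pctrl n d (gamma : R) (W : R -> 'cV[R]_d) (B : R) (U : cpath R n d) :=
  ctrl gamma W B U.1 (fun s v => U.2 s *m v).

Lemma Dnorm_ge0 n d gamma (W : R -> 'cV[R]_d) (U : cpath R n d) :
  (0 <= Dnorm gamma W U)%E.
Proof. by rewrite !adde_ge0 ?sup_norm_ge0 ?holder_norm_ge0. Qed.

(** The factor [d] is lost between the sup norm of the matrix [U.2] and its action on vectors. *)
Lemma Dnorm_pctrl n d gamma (W : R -> 'cV[R]_d) (U : cpath R n d) (B : R) :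
  (Dnorm gamma W U <= B%:E)%E -> pctrl gamma W ((1 + d%:R) * B) U.
Proof.
move=> h.
have s1 := sup_norm_ge0 U.1; have s2 := sup_norm_ge0 U.2.
have s3 := holder_norm_ge0 gamma (incr U.2) (@ltr01 R).
have s4 := holder_norm_ge0 (2 * gamma) (remainder W U) (@ltr01 R).
have h4 : (holder_norm 0 1 (2 * gamma) (remainder W U) <= B%:E)%E.
  by apply: le_trans h; rewrite leeDr// !adde_ge0.
have h3 : (holder_norm 0 1 gamma (incr U.2) <= B%:E)%E.
  by apply: le_trans h; rewrite (le_trans _ (leeDl _ s4))// leeDr// adde_ge0.
have h12 : (sup_norm U.1 + sup_norm U.2 <= B%:E)%E.
  by apply: le_trans h; rewrite /Dnorm -(addeA (_ + _)%E) leeDl// adde_ge0.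
have h1 := sup_norm_bound (le_trans (leeDl _ s2) h12).
have h2 := sup_norm_bound (le_trans (leeDr _ s1) h12).
have B0 : 0 <= B by rewrite -lee_fin (le_trans _ h4).
have d0 : 0 <= d%:R :> R by [].
have lB (x : R) : 0 <= x -> B * x <= (1 + d%:R) * B * x.
  by move=> x0; rewrite ler_wpM2r// mulrDl mul1r lerDl mulr_ge0.
have ldB (x : R) : 0 <= x -> d%:R * B * x <= (1 + d%:R) * B * x.
  by move=> x0; rewrite ler_wpM2r// ler_wpM2r// lerDr.
split=> [t t0 t1|t v t0 t1|s t v s0 st t1|s t s0 st t1].
- by have := lB 1 ler01; rewrite !mulr1; apply: le_trans; exact: h1.
- apply: le_trans (mulmx_norm _ _) _; apply: le_trans (ldB _ _) => //.
  by rewrite ler_wpM2r// ler_wpM2l// h2.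
- rewrite -mulmxBl; apply: le_trans (mulmx_norm _ _) _.
  rewrite ler_wpM2r//; apply: le_trans (ldB _ (powR_ge0 _ _)).
  rewrite -mulrA ler_wpM2l//.
  move: st; rewrite le_eqVlt => /predU1P[->|st].
    by rewrite subrr normr0 mulr_ge0// powR_ge0.
  exact: (holder_norm_bound h3).
- apply: le_trans (lB _ (powR_ge0 _ _)).
  move: st; rewrite le_eqVlt => /predU1P[->|st].
    by rewrite !subrr mulmx0 subr0 normr0 mulr_ge0// powR_ge0.
  exact: (holder_norm_bound h4).
Qed.

Lemma pctrl_Dnorm n d gamma (W : R -> 'cV[R]_d) (U : cpath R n d) (B : R) :
  pctrl gamma W B U -> (Dnorm gamma W U <= (4 * B)%:E)%E.
Proof.
move=> c; have B0 := ctrl_ge0 c.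
have -> : 4 * B = B + B + B + B by ring.
rewrite !EFinD; apply: leeD; [apply: leeD; [apply: leeD|]|].
- by apply: sup_norm_le => t t0 t1; exact: (ctrl_sup c).
- apply: sup_norm_le => t t0 t1; apply: norm_mulmx_coord => // v.
  exact: (ctrl_sup' c).
- apply: holder_norm_le => s t s0 st t1.
  apply: norm_mulmx_coord => [|v]; first by rewrite mulr_ge0// powR_ge0.
  by rewrite /incr mulmxBl (ctrl_holder' c)// ltW.
- by apply: holder_norm_le => s t s0 st t1; rewrite (ctrl_rem c)// ltW.
Qed.

Lemma pctrl_controlled n d gamma w (W : rpath R d) (U : cpath R n d) (B : R) :
  0 < gamma -> rough_on gamma w W -> pctrl gamma W.1 B U -> controlled gamma W.1 U.
Proof.
move=> g0 rW c; split; last by rewrite (le_lt_trans (pctrl_Dnorm c))// ltry.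
apply: (@le_lt_trans _ _ (2 * (w * B))%:E); last exact: ltry.
by apply: holder_norm_le => s t s0 st t1; rewrite (ctrl_incr g0 rW c)// ltW.
Qed.

Lemma controlled_pctrl n d gamma (W : R -> 'cV[R]_d) (U : cpath R n d) :
  controlled gamma W U -> pctrl gamma W ((1 + d%:R) * fine (Dnorm gamma W U)) U.
Proof.
move=> [_ h]; apply: Dnorm_pctrl; rewrite fineK//.
by rewrite ge0_fin_numE// Dnorm_ge0.
Qed.

Lemma ctrl_ext01 d (E : normedModType R) gamma (W : R -> 'cV[R]_d) B
    (Z1 Z2 : R -> E) Z1' Z2' :
  (forall t, 0 <= t <= 1 -> Z1 t = Z2 t) ->
  (forall t v, 0 <= t <= 1 -> Z1' t v = Z2' t v) ->
  ctrl gamma W B Z1 Z1' -> ctrl gamma W B Z2 Z2'.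
Proof.
move=> e1 e2 [h1 h2 h3 h4]; split.
- by move=> t t0 t1; rewrite -e1 ?t0//; exact: h1.
- by move=> t v t0 t1; rewrite -e2 ?t0//; exact: h2.
- move=> s t v s0 st t1; have t0 := le_trans s0 st; have s1 := le_trans st t1.
  by rewrite -!e2 ?s0 ?t0//; exact: h3.
- move=> s t s0 st t1; have t0 := le_trans s0 st; have s1 := le_trans st t1.
  by rewrite -!e1 -?e2 ?s0 ?t0//; exact: h4.
Qed.

Lemma pctrl_eq n d gamma (W : R -> 'cV[R]_d) B (U V : cpath R n d) :
  eq_cpath U V -> pctrl gamma W B U -> pctrl gamma W B V.
Proof. by move=> e; apply: ctrl_ext01 => t => [/e[]//|v /e[_ ->]]. Qed.

Lemma pctrlZ n d gamma (W : R -> 'cV[R]_d) B (c : R) (U : cpath R n d) :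
  0 <= c -> pctrl gamma W B U -> pctrl gamma W (c * B) (c *: U).
Proof.
move=> c0 /(ctrlZ c); rewrite ger0_norm//; apply: ctrl_ext => // t v.
by rewrite scalemxAl.
Qed.

Lemma pctrl0 n d gamma (W : R -> 'cV[R]_d) : pctrl gamma W 0 (0 : cpath R n d).
Proof. by apply: ctrl_ext (ctrl0 _ gamma W) => // t v; rewrite mul0mx. Qed.

End NormConversion.

Section CutOffBounds.
Context {R : realType} {n d : nat}.

(** First bound: either the rescaled path has norm at least 1 and is cut to 0, or its norm is below
    1 and the Lipschitz property against chi(0) = 0 applies. The other two are the Lipschitz
    property, in which the rescaling by the radius cancels. [L] is uniform in the radius and in the
    rough path. *)
Lemma truncate_bounds (gamma : R) (chi : (R -> 'cV[R]_d) -> cpath R n d -> cpath R n d) :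
  0 < gamma -> cut_off gamma chi -> exists2 L : R, 1 <= L &
  forall (rad : R -> R -> R) w (W : rpath R d), rough_on gamma w W ->
  0 < Defs.radius gamma rad W -> forall U, controlled gamma W.1 U ->
  [/\ pctrl gamma W.1 (L * Defs.radius gamma rad W) (truncate gamma chi rad W U),
      forall B, pctrl gamma W.1 B U -> pctrl gamma W.1 (L * B) (truncate gamma chi rad W U) &
      forall V B, controlled gamma W.1 V -> pctrl gamma W.1 B (U - V) ->
        pctrl gamma W.1 (L * B) (truncate gamma chi rad W U - truncate gamma chi rad W V)].
Proof.
move=> g0 [L0 L00 hchi]; pose c : R := 1 + d%:R; pose L1 := c * (L0 * 4).
have c1 : 1 <= c by rewrite /c lerDl.
have L10 : 0 <= L1 by rewrite !mulr_ge0// (le_trans ler01).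
exists (1 + L1 * c); first by rewrite lerDl mulr_ge0// (le_trans ler01).
have LL : L1 <= 1 + L1 * c.
  by apply: (@le_trans _ _ (L1 * c)); rewrite ?lerDr// ler_peMr.
move=> rad w W rW; set rho := Defs.radius _ _ _ => rho0 U cU.
have [] := hchi W.1.
  apply: (@le_lt_trans _ _ w%:E); last exact: ltry.
  by apply: holder_norm_le => s t s0 st t1; rewrite (rough_on1 rW)// ltW.
move=> chi_c chi_lip chi_id chi_0.
have ri0 : 0 <= rho^-1 by rewrite invr_ge0 ltW.
have scale_c (V : cpath R n d) : controlled gamma W.1 V -> controlled gamma W.1 (rho^-1 *: V).
  move=> /controlled_pctrl/(pctrlZ ri0); exact: (pctrl_controlled g0 rW).
have c0 : controlled gamma W.1 (0 : cpath R n d) by exact: (pctrl_controlled g0 rW (pctrl0 _ _ _)).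
have chi00 : eq_cpath (chi W.1 0) 0.
  apply: chi_id => //; apply: le_trans (pctrl_Dnorm (pctrl0 _ _ _)) _.
  by rewrite mulr0 lee_fin.
have chi_B V V' B : controlled gamma W.1 V -> controlled gamma W.1 V' ->
    pctrl gamma W.1 B (V - V') -> pctrl gamma W.1 (L1 * B) (chi W.1 V - chi W.1 V').
  move=> cV cV' cB; rewrite /L1 -mulrA; apply: Dnorm_pctrl.
  apply: le_trans (chi_lip _ _ cV cV') _; rewrite -mulrA EFinM.
  by apply: lee_wpmul2l; rewrite ?lee_fin//; exact: pctrl_Dnorm.
have eq_sub0 (V : cpath R n d) : eq_cpath (chi W.1 V - chi W.1 0) (chi W.1 V).
  by move=> t /chi00[e1 e2]; split; rewrite cpathBE ?e1 ?e2 cpath0E subr0.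
have tr_lip V B : controlled gamma W.1 V -> pctrl gamma W.1 B (U - V) ->
    pctrl gamma W.1 ((1 + L1 * c) * B) (truncate gamma chi rad W U - truncate gamma chi rad W V).
  move=> cV cB; have B0 := ctrl_ge0 cB.
  have /(chi_B _ _ _ (scale_c U cU) (scale_c V cV)) :
      pctrl gamma W.1 (rho^-1 * B) (rho^-1 *: U - rho^-1 *: V).
    by rewrite -scalerBr; exact: pctrlZ.
  move=> /(pctrlZ (ltW rho0)); rewrite scalerBr.
  apply: ctrl_le; rewrite mulrCA (mulrA rho) divff ?gt_eqF// mul1r ler_wpM2r//.
split => //.
- have [h|h] := leP 1%:E (Dnorm gamma W.1 (rho^-1 *: U)).
    have e := chi_0 _ (scale_c U cU) h.
    apply: ctrl_le (pctrl_eq _ (pctrl0 n gamma W.1)).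
      by rewrite mulr_ge0 ?(ltW rho0)// addr_ge0// mulr_ge0// (le_trans ler01).
    by move=> t /e[e1 e2]; split; rewrite /truncate cpathZE ?e1 ?e2 cpath0E scaler0.
  have := Dnorm_pctrl (ltW h); rewrite mulr1 -[rho^-1 *: U]subr0 => cB.
  have := pctrl_eq (eq_sub0 _) (chi_B _ _ _ (scale_c U cU) c0 cB).
  move=> /(pctrlZ (ltW rho0)); apply: ctrl_le.
  by rewrite mulrC ler_wpM2r ?(ltW rho0)// lerDr.
- move=> B cB; have cB' : pctrl gamma W.1 B (U - 0) by rewrite subr0.
  have := tr_lip 0 B c0 cB'; apply: pctrl_eq => t t01.
  have [e1 e2] := chi00 _ t01.
  by split; rewrite cpathBE /truncate scaler0 !cpathZE ?e1 ?e2 cpath0E scaler0 subr0.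
Qed.

Lemma center_orbit_pctrl (A : 'M[R]_n) : exists2 K : R, 0 <= K &
  forall gamma (W : R -> 'cV[R]_d) (xi : 'cV[R]_n) q, 0 < gamma -> 2 * gamma <= 1 ->
  pctrl gamma W (K * `|expmx (- q.+1%:R *: A) *m xi|) (center_orbit d A xi q).
Proof.
have [C hC _] := expmx_lip01 A; have C0 := lip01_ge0 hC.
exists (n%:R * C); first by rewrite mulr_ge0.
move=> gamma W xi q g0 g1; set x := expmx _ *m xi.
have E t : (center_orbit d A xi q).1 t = expmx (t *: A) *m x.
  by rewrite /center_orbit/= expmxD -mulmxA.
have K0 : 0 <= n%:R * C * `|x| by rewrite !mulr_ge0.
split=> [t t0 t1|t v t0 t1|s t v s0 st t1|s t s0 st t1].
- rewrite E; apply: le_trans (mulmx_norm _ _) _.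
  by rewrite ler_wpM2r// ler_wpM2l//; have [] := hC t t t0 (lexx t) t1.
- by rewrite mul0mx normr0 mulr_ge0.
- by rewrite !mul0mx subr0 normr0 !mulr_ge0// powR_ge0.
- rewrite mul0mx subr0 !E -mulmxBl; apply: le_trans (mulmx_norm _ _) _.
  have [_ h] := hC s t s0 st t1.
  have st0 : 0 <= t - s by rewrite subr_ge0.
  have st1 : t - s <= 1 by lra.
  have h2 : t - s <= (t - s) `^ (2 * gamma) by apply: le_powR_exp => //; rewrite mulr_gt0.
  have h3 : `|expmx (t *: A) - expmx (s *: A)| <= C * (t - s) `^ (2 * gamma).
    by apply: le_trans h _; rewrite ler_wpM2l.
  have -> : n%:R * C * `|x| * (t - s) `^ (2 * gamma) =
    n%:R * (C * (t - s) `^ (2 * gamma)) * `|x| by ring.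
  by rewrite ler_wpM2r// ler_wpM2l.
Qed.

(** The block lies in [-T, T] with T = p + 1, where the Hoelder norms are finite by assumption; so
    [fine] loses nothing. *)
Lemma block_rough (gamma : R) (W : rpath R d) (p : nat) : geometric_rough_path gamma W ->
  let a := fine (holder_norm 0 1 gamma (incr (block W p).1)) in
  let b := fine (holder_norm 0 1 (2 * gamma) (block W p).2) in
  [/\ 0 <= a, 0 <= b & rough_on gamma (1 + a + b) (block W p)].
Proof.
move=> [h1 h2 chen _] a b; set al2 := 2 * gamma.
have T0 : 0 < p.+1%:R :> R by [].
have bd s t : 0 <= s -> s < t -> t <= 1 ->
  [/\ - p.+1%:R <= s - p.+1%:R, s - p.+1%:R < t - p.+1%:R & t - p.+1%:R <= p.+1%:R :> R].
  move=> s0 st t1; have p1 : 1 <= p.+1%:R :> R by rewrite ler1n.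
  by split; lra.
have f1 : holder_norm 0 1 gamma (incr (block W p).1) \is a fin_num.
  rewrite ge0_fin_numE ?holder_norm_ge0//; apply: le_lt_trans (h1 _ T0).
  have fin := h1 _ T0; have ge := holder_norm_ge0 gamma (incr W.1) (ltrN10 R).
  apply: ge_ereal_sup => _ [[s t] /= [s0 st t1] <-].
  apply: ereal_sup_ubound; have [b1 b2 b3] := bd _ _ s0 st t1.
  exists (s - p.+1%:R, t - p.+1%:R) => //=; congr (`|_| / _ `^ _)%:E; last by ring.
  by rewrite /incr/= opprD opprK addrACA [- _ + _]addrC subrr addr0.
have f2 : holder_norm 0 1 al2 (block W p).2 \is a fin_num.
  rewrite ge0_fin_numE ?holder_norm_ge0//; apply: le_lt_trans (h2 _ T0).
  apply: ge_ereal_sup => _ [[s t] /= [s0 st t1] <-].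
  apply: ereal_sup_ubound; have [b1 b2 b3] := bd _ _ s0 st t1.
  by exists (s - p.+1%:R, t - p.+1%:R) => //=; congr (`|_| / _ `^ _)%:E; ring.
have a0 : 0 <= a by rewrite fine_ge0// holder_norm_ge0.
have b0 : 0 <= b by rewrite fine_ge0// holder_norm_ge0.
have l1 : (holder_norm 0 1 gamma (incr (block W p).1) <= a%:E)%E by rewrite fineK.
have l2 : (holder_norm 0 1 al2 (block W p).2 <= b%:E)%E by rewrite fineK.
split => //; split; first by rewrite -addrA lerDl addr_ge0.
- move=> s t s0; rewrite le_eqVlt => /predU1P[->|st] t1.
    by rewrite subrr normr0 mulr_ge0 ?powR_ge0// !addr_ge0.
  apply: le_trans (holder_norm_bound l1 s0 st t1) _.
  by rewrite ler_wpM2r ?powR_ge0//; lra.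
- move=> s t s0; rewrite le_eqVlt => /predU1P[<-|st] t1.
    (* The Hoelder norm only sees s < t. On the diagonal the second level vanishes by Chen's
       relation. *)
    have -> : (block W p).2 s s = 0.
      have := chen (s - p.+1%:R) (s - p.+1%:R) (s - p.+1%:R) (lexx _) (lexx _).
      by rewrite /incr !subrr mul0mx sub0r => /eqP; rewrite oppr_eq0 => /eqP.
    by rewrite normr0 mulr_ge0 ?powR_ge0// !addr_ge0.
  apply: le_trans (holder_norm_bound l2 s0 st t1) _.
  by rewrite ler_wpM2r ?powR_ge0//; lra.
- move=> s u t s0 su ut t1; rewrite /block/= chen ?lerD2r//.
  have subK (x y z : 'cV[R]_d) : (x - z) - (y - z) = x - y by rewrite opprB addrA subrK.
  by rewrite /incr/= !subK.
Qed.

End CutOffBounds.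

(** * The spectral projections commute with the flow *)

Section Splitting.
Context {R : realType} {n : nat}.
Implicit Types (A Pc Ps : 'M[R]_n).

Lemma spectral_subspace_stable A S (x : 'cV[R]_n) :
  spectral_subspace A S x -> spectral_subspace A S (A *m x).
Proof.
move=> [s hs sub]; exists s => //; rewrite map_mxM trmx_mul.
apply: submx_trans (submxMr _ sub) _; elim/big_ind: _ => [|V U hV hU|lam _].
- by rewrite stable0mx.
- exact: stableDmx.
- exact: comm_mx_stable_geigenspace.
Qed.

(** The columns of [P] lie in the invariant subspace, so [P] fixes their images under [A]. *)
Lemma proj_comm A (P Q : 'M[R]_n) (E : 'cV[R]_n -> Prop) :
  (forall x, E x <-> P *m x = x) -> (forall x, E x -> E (A *m x)) ->
  P *m P = P -> P *m (A *m P) = A *m P.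
Proof.
move=> hE st PP; apply/matrixP => i j.
have /hE/st/hE h : P *m (P *m delta_mx j 0) = P *m (delta_mx j 0 : 'cV[R]_n) by rewrite mulmxA PP.
have e (M : 'M[R]_n) : M i j = (M *m (delta_mx j 0 : 'cV[R]_n)) i 0.
  by rewrite -colE mxE.
by rewrite e [RHS]e -!mulmxA h.
Qed.

(** Both subspaces are invariant, whence Pc A Ps = Pc Ps A Ps = 0 and Pc A = Pc A Pc = A Pc. *)
Lemma splitting_comm A Pc Ps : center_stable_splitting A Pc Ps ->
  [/\ A *m Pc = Pc *m A, A *m Ps = Ps *m A, Ps *m Ps = Ps & Ps *m Pc = 0].
Proof.
move=> [_ PcPs PcPc hc hs].
have Pse : Ps = 1%:M - Pc by rewrite -PcPs addrAC subrr add0r.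
have PsPc : Ps *m Pc = 0 by rewrite Pse mulmxBl mul1mx PcPc subrr.
have PcPs0 : Pc *m Ps = 0 by rewrite Pse mulmxBr mulmx1 PcPc subrr.
have PsPs : Ps *m Ps = Ps by rewrite {2}Pse mulmxBr mulmx1 PsPc subr0.
have c1 := proj_comm Pc hc (fun x => @spectral_subspace_stable A _ x) PcPc.
have c2 := proj_comm Ps hs (fun x => @spectral_subspace_stable A _ x) PsPs.
have cc : A *m Pc = Pc *m A.
  rewrite -[RHS]mulmx1 -PcPs mulmxDr -!mulmxA c1 -c2 [Pc *m _]mulmxA PcPs0 mul0mx addr0//.
split => //; by rewrite Pse mulmxBr mulmxBl mulmx1 mul1mx cc.
Qed.

Lemma expmx_proj A (P : 'M[R]_n) (t : R) : A *m P = P *m A ->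
  expmx (t *: A) *m P = P *m expmx (t *: A).
Proof. by move=> c; apply: expmx_comm; rewrite -scalemxAl c scalemxAr. Qed.

End Splitting.

(** * Weights on the blocks that are stable under the two sums *)

Section TameSequences.
Context {R : realType}.

(* [E q] bounds the coefficients on the block [q] steps in the past; the two sums
   are those of the center and of the stable part of the Lyapunov-Perron map. *)
Record tame (rho s : R) (E : nat -> R) : Prop := {
  tame_ge0 : forall q, 0 <= E q;
  tame_past : forall p, \sum_(0 <= q < p.+1) E q <= s * E p;
  tame_future : forall p N, \sum_(p.+1 <= q < N) rho ^+ (q - p.+1) * E q <= s * E p }.

Lemma geometric_sum_le (z : R) N : 0 <= z -> z < 1 -> \sum_(0 <= i < N) z ^+ i <= (1 - z)^-1.
Proof.
move=> z0 z1; have d : 0 < 1 - z by lra.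
rewrite -[leRHS]mul1r ler_pdivlMr// mulrC big_mkord -opprB mulNr -subrX1 opprB.
by rewrite gerBl exprn_ge0.
Qed.

(** A geometric sum is comparable to its largest term: the last one in the increasing sum, as z > 1,
    and the first one in the discounted sum, as rho z < 1. *)
Lemma tame_geometric (rho z c : R) : 0 < rho -> 1 < z -> rho * z < 1 -> 0 <= c ->
  tame rho (z / (z - 1) + z / (1 - rho * z)) (fun q => c * z ^+ q).
Proof.
move=> r0 z1 rz c0.
have z0 : 0 < z by lra.
have zn0 q : 0 <= z ^+ q by rewrite exprn_ge0// ltW.
have d1 : 0 < z - 1 by lra.
have d2 : 0 < 1 - rho * z by lra.
have q1 : 0 <= z / (z - 1) by rewrite divr_ge0// ltW.
have q2 : 0 <= z / (1 - rho * z) by rewrite divr_ge0// ltW.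
split=> [q|p|p N].
- by rewrite mulr_ge0.
- apply: (@le_trans _ _ (z / (z - 1) * (c * z ^+ p))); last first.
    by rewrite ler_wpM2r ?lerDl// mulr_ge0.
  rewrite -mulr_sumr mulrCA ler_wpM2l// mulrAC ler_pdivlMr// big_mkord.
  by rewrite mulrC -subrX1 -exprS gerBl.
- apply: (@le_trans _ _ (z / (1 - rho * z) * (c * z ^+ p))); last first.
    by rewrite ler_wpM2r ?lerDr// mulr_ge0.
  have [pN|pN] := leqP p.+1 N; last first.
    by rewrite big_geq ?(ltnW pN)//; apply: mulr_ge0 => //; exact: mulr_ge0.
  rewrite -{1}[p.+1]add0n big_addn.
  have -> : \sum_(0 <= i < N - p.+1) rho ^+ (i + p.+1 - p.+1) * (c * z ^+ (i + p.+1)) =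
      c * z ^+ p.+1 * \sum_(i < N - p.+1) (rho * z) ^+ i.
    rewrite mulr_sumr big_mkord; apply: eq_bigr => i _.
    by rewrite addnK exprD exprMn; ring.
  have -> : z / (1 - rho * z) * (c * z ^+ p) = c * z ^+ p.+1 / (1 - rho * z).
    by rewrite exprS; field; lra.
  rewrite ler_wpM2l ?mulr_ge0// -(big_mkord xpredT).
  by apply: geometric_sum_le => //; rewrite mulr_ge0// ltW.
Qed.

Lemma tame_add (rho s : R) (E E' : nat -> R) :
  tame rho s E -> tame rho s E' -> tame rho s (fun q => E q + E' q).
Proof.
move=> [h1 h2 h3] [k1 k2 k3]; split=> [q|p|p N].
- by rewrite addr_ge0.
- by rewrite big_split/= mulrDr lerD.
- under eq_bigr do rewrite mulrDr.
  by rewrite big_split/= mulrDr lerD.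
Qed.

Lemma tame_le (rho s s' : R) (E : nat -> R) : s <= s' -> tame rho s E -> tame rho s' E.
Proof.
move=> ss [h1 h2 h3]; split=> // [p|p N].
- by apply: le_trans (h2 p) _; rewrite ler_wpM2r.
- by apply: le_trans (h3 p N) _; rewrite ler_wpM2r.
Qed.

End TameSequences.

(** The algebra of [lp_path_split], kept apart from its sums and limits. *)
Lemma regroup {R : realType} {n : nat} (e : 'M[R]_n) (z S a L b x y : 'cV[R]_n) :
  - a + b = e *m (x - y) ->
  z - e *m S - a + e *m L + b = z + e *m (L - (S + y) + x).
Proof.
move=> h; have -> : b = e *m (x - y) + a by rewrite -h addrC addrA subrr add0r.
by rewrite !mulmxBr !mulmxDr !mulmxN mulmxDr; apply/matrixP => i j; rewrite !mxE; ring.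
Qed.

(** * The Lyapunov-Perron map for an arbitrary family of integrands *)

Section LyapunovPerronBounds.
Context {R : realType} {n d : nat}.
Variables (gamma nu beta Mc Ms : R) (A Pc Ps : 'M[R]_n).
Hypothesis nu_ge0 : 0 <= nu.
Hypothesis spl : center_stable_splitting A Pc Ps.
Hypothesis dich : dichotomy A nu beta Mc Ms.
Hypotheses (Mc1 : 1 <= Mc) (Ms1 : 1 <= Ms).
Let rho := expR (- beta).

Section Family.
Variables (Wq : nat -> rpath R d) (phi : nat -> R -> 'cV[R]_n) (Z : nat -> R -> 'M[R]_(n, d)).
Variable (dZ : nat -> R -> 'cV[R]_d -> 'M[R]_(n, d)).
Variables (w b1 b2 : nat -> R).
Hypothesis ig : forall q, integrand gamma (w q) (Wq q) (b1 q) (b2 q) (phi q) (Z q) (dZ q).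

Definition btot (q : nat) : R := b1 q + w q * b2 q.

Definition block_int (P : 'M[R]_n) (q : nat) (a b t : R) : 'cV[R]_n :=
  bint (Wq q) (flow A P t) (phi q) (Z q) (dZ q) a b.

Definition lp_path (xi : 'cV[R]_n) (p : nat) (t : R) : 'cV[R]_n :=
  expmx ((t - p.+1%:R) *: A) *m xi
  - \sum_(0 <= q < p) expmx ((t - p.+1%:R + q%:R) *: A) *m block_int Pc q 0 1 1
  - block_int Pc p t 1 t
  + limn (fun N => \sum_(p.+1 <= q < N)
      expmx ((t - p.+1%:R + q%:R) *: A) *m block_int Ps q 0 1 1)
  + block_int Ps p 0 t t.

(** A projection that commutes with [A] can be absorbed in the kernel. This places block integrals
    in the subspaces on which the dichotomy gives bounds. *)
Lemma block_int_proj (P : 'M[R]_n) q a b t : A *m P = P *m A -> P *m P = P ->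
  0 <= a -> a <= b -> b <= 1 -> P *m block_int P q a b t = block_int P q a b t.
Proof.
move=> cP PP a0 ab b1'.
have [C hC] := flow_lip01 A P.
rewrite /block_int (bint_flow _ _ _ (ig q))//.
rewrite mulmxA -expmx_proj// -mulmxA; congr (_ *m _).
have <- := bint_mulmx hC (ig q) P a0 ab b1'.
have -> // : (fun r => P *m flow A P 0 r) = flow A P 0.
by apply/funext => r; rewrite /flow mulmxA -expmx_proj// -mulmxA PP.
Qed.

Definition future (p N : nat) : 'cV[R]_n :=
  \sum_(p.+1 <= q < N) expmx ((q%:R - p.+1%:R) *: A) *m block_int Ps q 0 1 1.

(* On block [p], [lp_path] is the center orbit plus [e^{tA}] applied to the sum of
   [pivot p] and the convolution from [0] to [t]. *)
Definition pivot (p : nat) : 'cV[R]_n :=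
  limn (future p) -
  \sum_(0 <= q < p.+1) expmx ((q%:R - p.+1%:R) *: A) *m block_int Pc q 0 1 1.

Variables (K s : R) (E : nat -> R).
Hypothesis K0 : 0 <= K.
Hypothesis Kc : forall q, `|block_int Pc q 0 1 1| <= K * btot q.
Hypothesis Ks : forall q, `|block_int Ps q 0 1 1| <= K * btot q.
Hypothesis tE : tame rho s E.
Hypothesis bE : forall q, btot q <= E q.

Lemma future_term p q : (p < q)%N ->
  `|expmx ((q%:R - p.+1%:R) *: A) *m block_int Ps q 0 1 1| <=
  Ms * K * (rho ^+ (q - p.+1) * E q).
Proof.
move=> pq; have [_ c2 PsPs _] := splitting_comm spl.
have hs : stable_space A (block_int Ps q 0 1 1).
  by apply/(proj_stable spl); rewrite block_int_proj.
rewrite -natrB//; apply: le_trans (stable_bound dich (ler0n _ _) hs) _.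
rewrite expRM_natr -/rho mulrAC -!mulrA ler_wpM2l ?(le_trans ler01)//.
rewrite mulrC [leRHS]mulrCA ler_wpM2l ?exprn_ge0 ?expR_ge0//.
by apply: le_trans (Ks q) _; rewrite ler_wpM2l.
Qed.

(** The time q - p - 1 is negative, so the exponential of the center bound is at most 1 because nu
    >= 0. *)
Lemma past_term p q : (q <= p)%N ->
  `|expmx ((q%:R - p.+1%:R) *: A) *m block_int Pc q 0 1 1| <= Mc * K * E q.
Proof.
move=> qp; have [c1 _ _ _] := splitting_comm spl.
have hs : center_space A (block_int Pc q 0 1 1).
  by apply/(proj_center spl); rewrite block_int_proj ?(proj_idem spl).
have qp0 : q%:R - p.+1%:R <= 0 :> R by rewrite subr_le0 ler_nat ltnW.
apply: le_trans (center_bound dich qp0 hs) _.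
rewrite -!mulrA ler_wpM2l ?(le_trans ler01)//.
apply: le_trans (ler_wpM2l K0 (bE q)); apply: le_trans (Kc q).
rewrite -[leRHS]mul1r ler_wpM2r//.
have : expR (nu * (q%:R - p.+1%:R)) <= expR 0 by rewrite ler_expR; exact: mulr_ge0_le0.
by rewrite expR0.
Qed.

Lemma future_cvg p : cvgn (future p) /\ `|limn (future p)| <= Ms * K * (s * E p).
Proof.
have MK : 0 <= Ms * K by rewrite mulr_ge0// (le_trans ler01).
(* Extending the terms by 0 below p + 1 turns [future p] into a [series], dominated by the series of
   [v]. *)
pose u q := if (p < q)%N then expmx ((q%:R - p.+1%:R) *: A) *m block_int Ps q 0 1 1 else 0.
pose v q := if (p < q)%N then Ms * K * (rho ^+ (q - p.+1) * E q) else 0.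
have E0 := tame_ge0 tE.
have v0 q : 0 <= v q.
  by rewrite /v; case: ifP => // _; apply: mulr_ge0 => //; apply: mulr_ge0 => //; rewrite exprn_ge0// expR_ge0.
have fu : future p = series u.
  apply/funext => N; by rewrite /future /series/= (big_nat_widenl _ 0)// big_mkcond.
have sv N : series v N <= Ms * K * (s * E p).
  apply: le_trans (ler_wpM2l MK (tame_future tE p N)).
  by rewrite mulr_sumr (big_nat_widenl _ 0)// big_mkcond.
have cv : cvgn (series v).
  apply: nondecreasing_is_cvgn; first by apply/nondecreasing_seqP => k; rewrite /series/= big_nat_recr//= lerDl.
  by exists (Ms * K * (s * E p)) => _ [k _ <-].
have uv q : `|u q| <= v q.
  by rewrite /u /v; case: ifP => [/future_term//|_]; rewrite normr0.
have cu : cvgn (series u) by exact: series_mx_cvg uv cv.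
rewrite fu; split => //; apply: (cvgn_norm_le cu) => k.
apply: le_trans (sv k); rewrite /series/=.
by apply: le_trans (ler_norm_sum _ _ _) _; apply: ler_sum.
Qed.

Lemma pivot_bound p : `|pivot p| <= (Ms + Mc) * K * (s * E p).
Proof.
have MK : 0 <= Mc * K by rewrite mulr_ge0// (le_trans ler01).
apply: le_trans (ler_normB _ _) _; rewrite mulrDl mulrDl; apply: lerD.
  by case: (future_cvg p).
apply: le_trans (ler_wpM2l MK (tame_past tE p)).
rewrite mulr_sumr; apply: le_trans (ler_norm_sum _ _ _) _.
by apply: ler_sum_nat => q /andP[_ qp]; exact: past_term.
Qed.

Lemma lp_path_split xi p t : 0 <= t -> t <= 1 ->
  lp_path xi p t = expmx ((t - p.+1%:R) *: A) *m xi +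
    expmx (t *: A) *m (pivot p + bint (Wq p) (flow A 1%:M 0) (phi p) (Z p) (dZ p) 0 t).
Proof.
move=> t0 t1; rewrite /lp_path.
have shift q : t - p.+1%:R + q%:R = t + (q%:R - p.+1%:R) by ring.
have -> : (fun N => \sum_(p.+1 <= q < N)
      expmx ((t - p.+1%:R + q%:R) *: A) *m block_int Ps q 0 1 1) =
    (fun N => expmx (t *: A) *m future p N).
  apply/funext => N; rewrite /future mulmx_sumr; apply: eq_bigr => q _.
  by rewrite shift expmxD mulmxA.
have fl : (fun N => expmx (t *: A) *m future p N) @ \oo --> expmx (t *: A) *m limn (future p).
  by apply: cvg_mulmx; exact: (future_cvg p).1.
rewrite (mx_cvgn_lim fl).
have -> : \sum_(0 <= q < p) expmx ((t - p.+1%:R + q%:R) *: A) *m block_int Pc q 0 1 1 =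
    expmx (t *: A) *m (\sum_(0 <= q < p) expmx ((q%:R - p.+1%:R) *: A) *m block_int Pc q 0 1 1).
  rewrite mulmx_sumr; apply: eq_bigr => q _.
  by rewrite shift expmxD mulmxA.
(* The correction over all of [0, 1] left by [bint_flow_split] has the form of the term q = p of the
   past sum. This is why [pivot] sums up to and including p. *)
have last_term : expmx ((p%:R - p.+1%:R) *: A) *m block_int Pc p 0 1 1 =
    bint (Wq p) (flow A Pc 0) (phi p) (Z p) (dZ p) 0 1.
  rewrite /block_int (bint_flow _ _ _ (ig p))// mulmxA -expmxD.
  by rewrite -natr1 opprD addrA subrr add0r addNr expmx0 mul1mx.
rewrite /pivot big_nat_recr//= last_term; apply: regroup.
exact: (bint_flow_split A (ig p) (proj_sum spl) t0 t1).
Qed.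

Variable K2 : R.
Hypothesis K20 : 0 <= K2.
Hypothesis hK2 : forall w (W : rpath R d) b1 b2 (phi : R -> 'cV[R]_n)
    (Z : R -> 'M[R]_(n, d)) dZ (v : 'cV[R]_n), integrand gamma w W b1 b2 phi Z dZ ->
  ctrl gamma W.1 (K2 * (`|v| + (b1 + w * b2)))
    (fun t => expmx (t *: A) *m (v + bint W (flow A 1%:M 0) phi Z dZ 0 t))
    (fun t x => Z t *m x).

Lemma lp_path_deviation xi p :
  ctrl gamma (Wq p).1 (K2 * ((Ms + Mc) * K * s + 1) * E p)
    (fun t => lp_path xi p t - expmx ((t - p.+1%:R) *: A) *m xi)
    (fun t x => Z p t *m x).
Proof.
apply: ctrl_ext01 (ctrl_le _ (hK2 (pivot p) (ig p))) => [t /andP[t0 t1]|//|].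
  by rewrite lp_path_split// [in RHS]addrC addKr.
rewrite -mulrA ler_wpM2l// mulrDl mul1r -[_ * s * _]mulrA lerD//.
  exact: pivot_bound.
exact: bE.
Qed.

(** At time 1 of block 0 the past sum is empty and the center integral is over [1, 1]. The
    projection kills the orbit and fixes the stable terms. *)
Lemma stable_projection xi : center_space A xi ->
  (\sum_(0 <= q < N) expmx (q%:R *: A) *m block_int Ps q 0 1 1) @[N --> \oo] -->
  Ps *m lp_path xi 0 1.
Proof.
move=> cxi; have [c1 c2 PsPs PsPc] := splitting_comm spl.
have PT q : Ps *m block_int Ps q 0 1 1 = block_int Ps q 0 1 1 by exact: block_int_proj.
have fc (M : 'M[R]_n) : (fun N => M *m future 0 N) @ \oo --> M *m limn (future 0).
  by apply: cvg_mulmx; exact: (future_cvg 0).1.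
have Pf N : Ps *m future 0 N = future 0 N.
  rewrite /future mulmx_sumr; apply: eq_bigr => q _.
  by rewrite mulmxA -expmx_proj// -mulmxA PT.
have Pl : Ps *m limn (future 0) = limn (future 0).
  rewrite -[LHS](mx_cvgn_lim (fc Ps)).
  by have -> : (fun N => Ps *m future 0 N) = future 0 by exact/funext.
have shift q : 1 - 1%:R + q%:R = 1 + (q%:R - 1%:R) :> R by ring.
have e1 : (fun N => \sum_(1 <= q < N) expmx ((1 - 1%:R + q%:R) *: A) *m block_int Ps q 0 1 1) =
    (fun N => expmx (1 *: A) *m future 0 N).
  apply/funext => N; rewrite /future mulmx_sumr; apply: eq_bigr => q _.
  by rewrite shift expmxD mulmxA.
(* An additive function of intervals vanishes on a degenerate interval. *)
have z0 : block_int Pc 0 1 1 1 = 0.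
  have [C hC] := flow_lip01 A Pc.
  rewrite /block_int (bint_flow _ _ _ (ig 0))//.
  have := bint_additive hC (ig 0) ler01 (lexx 1) (lexx 1) (lexx 1).
  by move/eqP; rewrite -subr_eq subrr eq_sym => /eqP ->; rewrite mulmx0.
have -> : Ps *m lp_path xi 0 1 = expmx (1 *: A) *m limn (future 0) + block_int Ps 0 0 1 1.
  rewrite /lp_path e1 (mx_cvgn_lim (fc (expmx (1 *: A)))).
  rewrite z0 (big_geq (leqnn 0)) subrr expmx0 mul1mx.
  move: (block_int Ps 0 0 1 1) (PT 0) (limn _) Pl => T hT L hL.
  rewrite !subr0 !mulmxDr hT; congr (_ + _).
  by rewrite -[xi](proj_center spl xi).1// mulmxA PsPc mul0mx add0r mulmxA -expmx_proj// -mulmxA hL.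
set f := (fun N => \sum_(0 <= q < N) _).
(* The term q = 0 is the current block. In the other terms one factor e^A is taken out, which leaves
   the exponents q - 1 of [future 0]. *)
have fS : (fun N => f N.+1) = (fun N => expmx (1 *: A) *m future 0 N.+1 + block_int Ps 0 0 1 1).
  apply/funext => N; rewrite /f big_ltn// expmx0 mul1mx addrC; congr (_ + _).
  rewrite /future mulmx_sumr; apply: eq_bigr => q _.
  by rewrite mulmxA -expmxD addrC subrK.
rewrite -cvg_shiftS fS; apply: cvgD; last exact: cvg_cst.
by have := fc (expmx (1 *: A)); rewrite -cvg_shiftS.
Qed.

End Family.
End LyapunovPerronBounds.

(** * The Gronwall argument and the two-scale estimate *)

Section RealEstimates.
Context {R : realType}.

Lemma le_geometric_limit (a b M : R) : (forall k, a <= b + M * 2^-1 ^+ k) -> a <= b.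
Proof.
move=> h; have h2 : (fun k => b + M * 2^-1 ^+ k) @ \oo --> b + M * 0.
  apply: cvgD; first exact: cvg_cst.
  by apply: cvgMr; apply: cvg_expr; rewrite ger0_norm// invf_lt1// ltr1n.
move: h2; rewrite mulr0 addr0 => h2; rewrite -(cvg_lim _ h2)//.
by apply: limr_ge; [apply/cvg_ex; exists b|exact: nearW].
Qed.

Lemma tame_scale (rho s k : R) E : 0 <= k -> tame rho s E -> tame rho s (fun q => k * E q).
Proof.
move=> k0 [h1 h2 h3]; split=> [q|p|p N]; first by rewrite mulr_ge0.
  by rewrite -mulr_sumr mulrCA ler_wpM2l.
under eq_bigr do rewrite mulrCA.
by rewrite -mulr_sumr mulrCA ler_wpM2l.
Qed.

(* Each use of the hypothesis halves the component of weight [y^q] and keeps the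
   component of weight [x^q]. *)
Lemma gronwall_tame (rho s S eps c B x y : R) (a : nat -> R) :
  0 < eps -> 0 <= S -> eps * S <= 2^-1 -> 0 <= c -> 0 <= B ->
  tame rho s (fun q => x ^+ q) -> tame rho s (fun q => y ^+ q) -> 1 <= x ->
  (forall E, tame rho s E -> (forall q, eps * a q <= E q) -> forall p, a p <= c + S * E p) ->
  (forall q, a q <= B * y ^+ q) -> forall q, a q <= 2 * c * x ^+ q.
Proof.
move=> e0 S0 eS c0 B0 tx ty x1 hS aB.
suff h k : forall q, a q <= 2 * c * x ^+ q + B * 2^-1 ^+ k * y ^+ q.
  by move=> q; apply: (@le_geometric_limit _ _ (B * y ^+ q)) => k; rewrite (mulrAC B); exact: h.
elim: k => [|k ih] p.
  rewrite expr0 mulr1; apply: le_trans (aB p) _; rewrite lerDr.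
  by rewrite !mulr_ge0//; exact: (tame_ge0 tx p).
have M0 : 0 <= B * 2^-1 ^+ k by rewrite mulr_ge0// exprn_ge0// invr_ge0.
have tE : tame rho s (fun q => eps * (2 * c) * x ^+ q + eps * (B * 2^-1 ^+ k) * y ^+ q).
  by apply: tame_add; apply: tame_scale => //; rewrite mulr_ge0// ?mulr_ge0// ltW.
have := hS _ tE _ p => /(_ _)/le_trans; apply.
  by move=> q; rewrite -2!(mulrA eps) -mulrDr; apply: ler_wpM2l (ih q); exact: ltW.
have xp1 : 1 <= x ^+ p by exact: exprn_ege1.
have yp0 : 0 <= y ^+ p := tame_ge0 ty p.
rewrite exprS; move: (2^-1 ^+ k) M0 => t M0.
have eS0 : 0 <= eps * S by rewrite mulr_ge0// ltW.
have h1 : eps * S * (2 * c * x ^+ p) <= 2^-1 * (2 * c * x ^+ p).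
  by rewrite ler_wpM2r// !mulr_ge0// (le_trans ler01).
have h2 : eps * S * (B * t * y ^+ p) <= 2^-1 * (B * t * y ^+ p).
  by rewrite ler_wpM2r// mulr_ge0.
have h3 : c <= c * x ^+ p by rewrite ler_peMr.
have -> : c + S * (eps * (2 * c) * x ^+ p + eps * (B * t) * y ^+ p) =
  c + eps * S * (2 * c * x ^+ p) + eps * S * (B * t * y ^+ p) by ring.
have -> : 2 * c * x ^+ p + B * (2^-1 * t) * y ^+ p =
  c * x ^+ p + 2^-1 * (2 * c * x ^+ p) + 2^-1 * (B * t * y ^+ p) by field.
by apply: lerD => //; apply: lerD.
Qed.

(* Below the scale [kap] the quadratic bound on [D] gains the factor [kap];
   above it the truncation does. *)
Lemma two_scale_bound (l : nat) (C kap z r D : R) : 1 <= C -> 0 < kap -> kap <= 1 -> 0 <= z ->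
  0 <= r -> r <= C * kap ^+ 2 -> r <= C * z -> 0 <= D -> D <= 2 * C * kap ^+ 2 ->
  ((0 < l)%N -> D <= C * z ^+ 2) ->
  r ^+ l.+1 + l%:R * (D * r ^+ l.-1) <= (1 + 2 * l%:R) * C ^+ l.+1 * kap * z ^+ l.
Proof.
move=> C1 k0 k1 z0 r0 rk rz D0 Dk Dz.
have C0 : 0 <= C := le_trans ler01 C1.
have Cz0 : 0 <= C * z by rewrite mulr_ge0.
have kk : kap ^+ 2 <= kap by rewrite expr2 ler_piMl// ltW.
have hr : r ^+ l.+1 <= C ^+ l.+1 * kap * z ^+ l.
  rewrite !exprS; have -> : C * C ^+ l * kap * z ^+ l = (C * kap) * (C * z) ^+ l.
    by rewrite exprMn; ring.
  apply: ler_pM; rewrite ?exprn_ge0//; last by apply: lerXn2r.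
  by apply: le_trans rk _; rewrite ler_wpM2l.
have -> : (1 + 2 * l%:R) * C ^+ l.+1 * kap * z ^+ l =
  C ^+ l.+1 * kap * z ^+ l + 2 * l%:R * C ^+ l.+1 * kap * z ^+ l by ring.
apply: lerD => //.
case: l Dz hr => [|l] Dz _; first by rewrite mulr0 !mul0r.
rewrite -pred_Sn.
have hD : D <= 2 * C * kap * z.
  have [zk|kz] := lerP z kap.
    apply: le_trans (Dz isT) _; rewrite expr2 !mulrA ler_wpM2r//.
    have : C * z <= C * kap by rewrite ler_wpM2l.
    have : 0 <= C * kap by rewrite mulr_ge0// ltW.
    by rewrite -(mulrA 2); lra.
  apply: le_trans Dk _; rewrite expr2 mulrA ler_wpM2l ?(ltW kz)//.
  by rewrite !mulr_ge0// ltW.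
have hrl : r ^+ l <= (C * z) ^+ l by apply: lerXn2r.
have hDr : D * r ^+ l <= (2 * C * kap * z) * (C * z) ^+ l by apply: ler_pM; rewrite ?exprn_ge0.
apply: (@le_trans _ _ (l.+1%:R * ((2 * C * kap * z) * (C * z) ^+ l))); first by rewrite ler_wpM2l.
have -> : l.+1%:R * (2 * C * kap * z * (C * z) ^+ l) =
   2 * l.+1%:R * (C * C ^+ l) * kap * (z * z ^+ l) by rewrite exprMn; ring.
rewrite -!exprS; move: (z ^+ l.+1) (exprn_ge0 l.+1 z0) => Z Z0.
rewrite ler_wpM2r// ler_wpM2r ?(ltW k0)// ler_wpM2l ?mulr_ge0//.
by rewrite ler_weXn2l.
Qed.

End RealEstimates.

(** * Replacing coefficients and path in the integral over one block *)

Section BlockDifference.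
Context {R : realType} {n d : nat}.
Local Notation V := 'cV[R]_n.
Variables (l : nat) (K rho : R) (F Fl : V -> V) (G Gl : V -> 'M[R]_(n, d)).
Hypothesis cb : coeff_bounds l K rho F Fl G Gl.
Variable gamma : R.
Hypothesis gamma3 : 1 < 3 * gamma.
Hypothesis gamma2 : 2 * gamma <= 1.

Lemma pctrl_min (W : R -> 'cV[R]_d) B1 B2 (U : cpath R n d) :
  pctrl gamma W B1 U -> pctrl gamma W B2 U -> pctrl gamma W (Num.min B1 B2) U.
Proof. by move=> c1 c2; rewrite /Num.min; case: ifP. Qed.

Lemma pctrl_cont01 w (W : rpath R d) r (Y : cpath R n d) : rough_on gamma w W ->
  pctrl gamma W.1 r Y -> cont01 Y.1.
Proof.
have g0 : 0 < gamma by have := gamma3; lra.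
move=> rW cY; apply: (@cont01_holder _ _ _ _ (2 * (w * r)) gamma g0) => s t s0 st t1.
exact: ctrl_incr g0 rW cY s0 st t1.
Qed.

Lemma basis_linear_diff (g : V -> 'M[R]_(n, d)) (x : V) (M : 'M[R]_(n, d)) :
  basis_linear (fun v => 'd g x (M *m v)).
Proof. exact: (linear_basis_linear ('d g x \o mulmx M)). Qed.

Lemma truncated_integrand w (W : rpath R d) r b1 (Y : cpath R n d) :
  rough_on gamma w W -> r <= rho -> pctrl gamma W.1 r Y ->
  (forall x, `|x| <= r -> `|F x| <= b1) ->
  integrand gamma w W b1 (K * (w ^+ 2 * r ^+ 3)) (F \o Y.1) (G \o Y.1)
    (fun t v => 'd G (Y.1 t) (Y.2 t *m v)).
Proof.
have g0 : 0 < gamma by have := gamma3; lra.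
move=> rW rrho cY hF; split => //.
- exact: cont01_comp (cb_Fcont cb) (pctrl_cont01 rW cY).
- by move=> t t0 t1; apply: hF; exact: (ctrl_sup cY).
- exact: (cb_G cb).
- by move=> s; exact: basis_linear_diff.
Qed.

(** Inserting the leading term at [Y] separates the two errors: the higher-order part of the
    coefficient at [Y], and the change of argument in a polynomial. *)
Lemma difference_integrand w (W : rpath R d) r D (Y U : cpath R n d) :
  rough_on gamma w W -> r <= rho -> pctrl gamma W.1 r Y -> pctrl gamma W.1 r U ->
  pctrl gamma W.1 D (Y - U) ->
  integrand gamma w W
    (K * r ^+ l.+1 + K * (l%:R * (w ^+ (2 * l) * (D * r ^+ l.-1))))
    (K * (w ^+ 2 * r ^+ l.+1) + K * (l%:R * (w ^+ (2 * l) * (D * r ^+ l.-1))))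
    (fun t => F (Y.1 t) - Fl (U.1 t)) (fun t => G (Y.1 t) - Gl (U.1 t))
    (fun t v => 'd G (Y.1 t) (Y.2 t *m v) - 'd Gl (U.1 t) (U.2 t *m v)).
Proof.
have g0 : 0 < gamma by have := gamma3; lra.
have tele (p q : nat) (a b c : 'M[R]_(p, q)) : (a - b) + (b - c) = a - c by rewrite addrA subrK.
move=> rW rrho cY cU cD.
have cD' : ctrl gamma W.1 D (fun t => Y.1 t - U.1 t) (fun t v => Y.2 t *m v - U.2 t *m v).
  by apply: ctrl_ext cD => // t v; rewrite cpathBE mulmxBl.
split => //.
- apply: cont01B; first exact: (cont01_comp (cb_Fcont cb) (pctrl_cont01 rW cY)).
  exact: (cont01_comp (cb_Flcont cb) (pctrl_cont01 rW cU)).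
- move=> t t0 t1; rewrite -(tele _ _ _ (Fl (Y.1 t))); apply: le_trans (ler_normD _ _) _.
  have Yr := ctrl_sup cY t0 t1; have r0 := ctrl_ge0 cY.
  apply: lerD; last exact: (cb_Fl cb g0 rW cY cU cD').
  apply: le_trans (cb_FFl cb (le_trans Yr rrho)) _.
  have K0 : 0 <= K := le_trans ler01 (cb_K cb).
  by rewrite ler_wpM2l// lerXn2r// nnegrE.
- have := ctrlD (cb_GGl cb g0 rW rrho cY) (cb_Gl cb g0 rW cY cU cD').
  by apply: ctrl_ext => [t|t v]; rewrite tele.
- move=> s v; under eq_bigr do rewrite scalerBr.
  by rewrite sumrB -!basis_linear_diff.
Qed.

(** The leading term at [U] is the full coefficient at [Y] minus the difference already treated.
    Only the existence of bounds matters here, since it makes the integral well defined and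
    linear. *)
Lemma leading_integrand w (W : rpath R d) r D b1 (Y U : cpath R n d) :
  rough_on gamma w W -> r <= rho -> pctrl gamma W.1 r Y -> pctrl gamma W.1 r U ->
  pctrl gamma W.1 D (Y - U) -> (forall x, `|x| <= r -> `|F x| <= b1) ->
  exists b1' b2', integrand gamma w W b1' b2' (Fl \o U.1) (Gl \o U.1)
    (fun t v => 'd Gl (U.1 t) (U.2 t *m v)).
Proof.
move=> rW rrho cY cU cD hF.
have [_ _ _ a1 a2 a3 a4] := truncated_integrand rW rrho cY hF.
have [_ _ _ b1' b2 b3 b4] := difference_integrand rW rrho cY cU cD.
have subK (p q : nat) (a b : 'M[R]_(p, q)) : a - (a - b) = b by rewrite opprB addrC subrK.
do 2 eexists; split => //.
- exact: cont01_comp (cb_Flcont cb) (pctrl_cont01 rW cU).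
- move=> t t0 t1; rewrite /= -(subK _ _ (F (Y.1 t)) (Fl (U.1 t))).
  by apply: le_trans (ler_normB _ _) _; apply: lerD; [exact: a2|exact: b2].
- by apply: ctrl_ext (ctrlB a3 b3) => [t|t v]; exact: subK.
- by move=> s; exact: basis_linear_diff.
Qed.

Variable A : 'M[R]_n.

(** The powers of [w] that occur are w^3 from the remainder, and w^(2 l) and w^(2 l + 1) from the
    polynomials. The exponent 2 l + 3 dominates them all and is the one built into the radius. *)
Lemma block_difference (P : 'M[R]_n) : exists2 K4 : R, 0 <= K4 &
  forall w (W : rpath R d) r D b1 (Y U : cpath R n d),
  rough_on gamma w W -> r <= rho -> pctrl gamma W.1 r Y -> pctrl gamma W.1 r U ->
  pctrl gamma W.1 D (Y - U) -> (forall x, `|x| <= r -> `|F x| <= b1) ->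
  `|bint W (flow A P 1) (F \o Y.1) (G \o Y.1) (fun t v => 'd G (Y.1 t) (Y.2 t *m v)) 0 1 -
    bint W (flow A P 1) (Fl \o U.1) (Gl \o U.1) (fun t v => 'd Gl (U.1 t) (U.2 t *m v)) 0 1|
  <= K4 * (w ^+ (2 * l + 3) * (r ^+ l.+1 + l%:R * (D * r ^+ l.-1))).
Proof.
have [K3 K30 h3] := @bint_flow_bound R n d A gamma P gamma3.
have K0 : 0 <= K := le_trans ler01 (cb_K cb).
exists (K3 * (2 * K)); first by rewrite !mulr_ge0.
move=> w W r D b1 Y U rW rrho cY cU cD hF.
have w1 := rough_on_ge1 rW; have r0 := ctrl_ge0 cY; have D0 := ctrl_ge0 cD.
have w0 : 0 <= w := le_trans ler01 w1.
have igF := truncated_integrand rW rrho cY hF.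
have igD := difference_integrand rW rrho cY cU cD.
have [C hC] := flow_lip01 A P.
have lf : lip01 (n%:R * `|expmx (1 *: A)| * C) (flow A P 1).
  rewrite flow_factor => s t s0 st t1; have [h1 h2] := hC s t s0 st t1.
  split; first by apply: le_trans (mulmx_norm _ _) _; rewrite ler_wpM2l// mulr_ge0.
  rewrite -mulmxBr; apply: le_trans (mulmx_norm _ _) _.
  by rewrite -[leRHS]mulrA ler_wpM2l// mulr_ge0.
have subK (p q : nat) (a b : 'M[R]_(p, q)) : a - (a - b) = b by rewrite opprB addrC subrK.
have -> : bint W (flow A P 1) (Fl \o U.1) (Gl \o U.1) (fun t v => 'd Gl (U.1 t) (U.2 t *m v)) 0 1 =
  bint W (flow A P 1) (F \o Y.1) (G \o Y.1) (fun t v => 'd G (Y.1 t) (Y.2 t *m v)) 0 1 -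
  bint W (flow A P 1) (fun t => F (Y.1 t) - Fl (U.1 t)) (fun t => G (Y.1 t) - Gl (U.1 t))
    (fun t v => 'd G (Y.1 t) (Y.2 t *m v) - 'd Gl (U.1 t) (U.2 t *m v)) 0 1.
  rewrite -(bint_sub_integrand igF igD lf (lexx 0) ler01 (lexx 1)).
  have E1 : (fun r => (F \o Y.1) r - (F (Y.1 r) - Fl (U.1 r))) = Fl \o U.1.
    by apply/funext => t; exact: subK.
  have E2 : (fun r => (G \o Y.1) r - (G (Y.1 r) - Gl (U.1 r))) = Gl \o U.1.
    by apply/funext => t; exact: subK.
  have E3 : (fun r v => 'd G (Y.1 r) (Y.2 r *m v) -
      ('d G (Y.1 r) (Y.2 r *m v) - 'd Gl (U.1 r) (U.2 r *m v))) =
      (fun t v => 'd Gl (U.1 t) (U.2 t *m v)).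
    by apply/funext => t; apply/funext => v; exact: subK.
  by rewrite E1 E2 E3.
rewrite subK; apply: le_trans (h3 _ _ _ _ _ _ _ igD) _.
rewrite -[leRHS]mulrA ler_wpM2l//.
set T := l%:R * (D * r ^+ l.-1); set X := r ^+ l.+1.
have X0 : 0 <= X by rewrite exprn_ge0.
have T0 : 0 <= T by rewrite !mulr_ge0// exprn_ge0.
have -> : l%:R * (w ^+ (2 * l) * (D * r ^+ l.-1)) = w ^+ (2 * l) * T by rewrite /T mulrCA.
have e1 : 1 <= w ^+ (2 * l + 3) by exact: exprn_ege1.
have e2 : w ^+ 3 <= w ^+ (2 * l + 3) by rewrite ler_weXn2l// leq_addl.
have e3 : w ^+ (2 * l) <= w ^+ (2 * l + 3) by rewrite ler_weXn2l// leq_addr.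
have e4 : w * w ^+ (2 * l) <= w ^+ (2 * l + 3) by rewrite -exprS ler_weXn2l// -addn1 leq_add2l.
have -> : K * X + K * (w ^+ (2 * l) * T) + w * (K * (w ^+ 2 * X) + K * (w ^+ (2 * l) * T)) =
  K * ((1 + w ^+ 3) * X + (w ^+ (2 * l) + w * w ^+ (2 * l)) * T) by ring.
rewrite (mulrC 2 K) -[leRHS]mulrA ler_wpM2l//.
move: (w ^+ (2 * l + 3)) (w ^+ 3) (w ^+ (2 * l)) (w * _) e1 e2 e3 e4 => N w3 wl ww e1 e2 e3 e4.
clearbody T X; have -> : 2 * (N * (X + T)) = 2 * N * X + 2 * N * T by ring.
by apply: lerD; apply: ler_wpM2r => //; lra.
Qed.

End BlockDifference.

(** * Growth of the fixed point and comparison with the center orbit *)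

Section MainEstimates.
Context {R : realType} {n d : nat}.
Local Notation V := 'cV[R]_n.
Variables (l : nat) (K rho : R) (F Fl : V -> V) (G Gl : V -> 'M[R]_(n, d)).
Hypothesis cb : coeff_bounds l K rho F Fl G Gl.
Variables (gamma nu beta eta Mc Ms : R) (A Pc Ps : 'M[R]_n).
Hypotheses (gamma3 : 1 < 3 * gamma) (gamma2 : 2 * gamma <= 1) (nu_ge0 : 0 <= nu).
Hypotheses (Mc1 : 1 <= Mc) (Ms1 : 1 <= Ms).
Hypothesis spl : center_stable_splitting A Pc Ps.
Hypothesis dich : dichotomy A nu beta Mc Ms.
Variables (chi : (R -> 'cV[R]_d) -> cpath R n d -> cpath R n d) (rad : R -> R -> R).

Variables (L Kb K2 c1 : R).
Hypothesis L1 : 1 <= L.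
Hypothesis truncL : forall (rad : R -> R -> R) w (W : rpath R d), rough_on gamma w W ->
  0 < Defs.radius gamma rad W -> forall U, controlled gamma W.1 U ->
  [/\ pctrl gamma W.1 (L * Defs.radius gamma rad W) (truncate gamma chi rad W U),
      forall B, pctrl gamma W.1 B U -> pctrl gamma W.1 (L * B) (truncate gamma chi rad W U) &
      forall V B, controlled gamma W.1 V -> pctrl gamma W.1 B (U - V) ->
        pctrl gamma W.1 (L * B) (truncate gamma chi rad W U - truncate gamma chi rad W V)].
Hypothesis Kb0 : 0 <= Kb.
Hypothesis flow_bound : forall w (W : rpath R d) b1 b2 (phi : R -> V) (Z : R -> 'M[R]_(n, d)) dZ,
  integrand gamma w W b1 b2 phi Z dZ ->
  `|bint W (flow A Pc 1) phi Z dZ 0 1| <= Kb * (b1 + w * b2) /\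
  `|bint W (flow A Ps 1) phi Z dZ 0 1| <= Kb * (b1 + w * b2).
Hypothesis K20 : 0 <= K2.
Hypothesis flow_ctrl : forall w (W : rpath R d) b1 b2 (phi : R -> V) (Z : R -> 'M[R]_(n, d)) dZ (v : V),
  integrand gamma w W b1 b2 phi Z dZ ->
  ctrl gamma W.1 (K2 * (`|v| + (b1 + w * b2)))
    (fun t => expmx (t *: A) *m (v + bint W (flow A 1%:M 0) phi Z dZ 0 t))
    (fun t x => Z t *m x).
Hypothesis c10 : 0 <= c1.
Hypothesis orbit_bound : forall gamma (W : R -> 'cV[R]_d) (xi : V) q, 0 < gamma -> 2 * gamma <= 1 ->
  pctrl gamma W (c1 * `|expmx (- q.+1%:R *: A) *m xi|) (center_orbit d A xi q).

Variables (Wp : rpath R d) (w kap : nat -> R) (kap0 : R).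
Hypothesis rW : forall q, rough_on gamma (w q) (block Wp q).
Let Rq q := Defs.radius gamma rad (block Wp q).
Hypothesis Rq_gt0 : forall q, 0 < Rq q.
Hypothesis kap_gt0 : forall q, 0 < kap q.
Hypothesis Rq_kap : forall q, Rq q <= kap q ^+ 2.
Hypothesis w_kap : forall q, w q ^+ (2 * l + 3) * kap q <= kap0.
Hypothesis kap0_le1 : kap0 <= 1.
Hypothesis kap0_rho : L * kap0 <= rho.

Variables (xi : V) (U : nat -> cpath R n d).
Hypothesis cxi : center_space A xi.
Hypothesis fpU : LP_fixed_point gamma A Pc Ps chi rad F G eta Wp xi U.

Let g0 : 0 < gamma. Proof. by have := gamma3; lra. Qed.
Let L0 : 0 <= L := le_trans ler01 L1.
Let K0 : 0 <= K := le_trans ler01 (cb_K cb).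
Let w0 q : 0 <= w q := le_trans ler01 (rough_on_ge1 (rW q)).
Let cU q : controlled gamma (block Wp q).1 (U q).
Proof. by case: fpU => -[]. Qed.

Definition Dn (q : nat) : R := fine (Dnorm gamma (block Wp q).1 (U q)).
Local Notation a := Dn.
Definition trunc_path (q : nat) : cpath R n d := truncate gamma chi rad (block Wp q) (U q).
Local Notation Y := trunc_path.
(** The minimum keeps both effects of the cut-off: the radius makes the coefficients small, and the
    norm of the path keeps the estimates linear in it. *)
Definition trunc_size (q : nat) : R := Num.min (L * Rq q) (L * ((1 + d%:R) * a q)).
Local Notation r := trunc_size.

Lemma Dn_ge0 q : 0 <= a q.
Proof. by rewrite fine_ge0// Dnorm_ge0. Qed.

Lemma Dn_fin q : Dnorm gamma (block Wp q).1 (U q) = (a q)%:E.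
Proof.
have [_ h] := cU q; rewrite fineK// ge0_fin_numE// Dnorm_ge0//.
Qed.

Lemma trunc_path_ctrl q : pctrl gamma (block Wp q).1 (r q) (Y q).
Proof.
have [h1 h2 _] := truncL (rW q) (Rq_gt0 q) (cU q).
by apply: pctrl_min => //; apply: h2; exact: controlled_pctrl.
Qed.

Lemma kap_le q : kap q <= kap0 /\ w q ^+ 3 * kap q <= kap0.
Proof.
have w1 := rough_on_ge1 (rW q).
split; apply: le_trans (w_kap q).
  by rewrite ler_peMl ?(ltW (kap_gt0 q))// exprn_ege1.
by rewrite ler_wpM2r ?(ltW (kap_gt0 q))// ler_weXn2l// leq_addl.
Qed.

Lemma kap_le1 q : kap q <= 1.
Proof. exact: le_trans (kap_le q).1 kap0_le1. Qed.

Lemma kap_sqr q : kap q ^+ 2 <= kap q.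
Proof. by rewrite expr2 ler_piMl ?(ltW (kap_gt0 q))// kap_le1. Qed.

Lemma trunc_size_ge0 q : 0 <= r q.
Proof. exact: ctrl_ge0 (trunc_path_ctrl q). Qed.

Lemma trunc_size_kap q : r q <= L * kap q ^+ 2.
Proof. by rewrite /r ge_min ler_wpM2l. Qed.

Lemma trunc_size_le q : r q <= L * kap0.
Proof.
apply: le_trans (trunc_size_kap q) _; rewrite ler_wpM2l//.
exact: le_trans (kap_sqr q) (kap_le q).1.
Qed.

Lemma trunc_size_rho q : r q <= rho.
Proof. exact: le_trans (trunc_size_le q) kap0_rho. Qed.

Lemma trunc_size_Dn q : r q <= L * ((1 + d%:R) * a q).
Proof. by rewrite /r ge_min lexx orbT. Qed.

(** Two of the three factors r are bounded through the radius, by L^2 kap^4. One kap absorbs w^3,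
    and the noise term becomes linear in r with a small coefficient. *)
Lemma cubic_small q : w q * (K * (w q ^+ 2 * r q ^+ 3)) <= K * L ^+ 2 * kap0 * r q.
Proof.
have -> : w q * (K * (w q ^+ 2 * r q ^+ 3)) = K * (w q ^+ 3 * r q ^+ 2) * r q by ring.
rewrite ler_wpM2r ?trunc_size_ge0// -(mulrA K (L ^+ 2)) ler_wpM2l//.
apply: (@le_trans _ _ (w q ^+ 3 * (L * kap q ^+ 2) ^+ 2)).
  by rewrite ler_wpM2l ?exprn_ge0// lerXn2r ?nnegrE ?trunc_size_ge0 ?trunc_size_kap// mulr_ge0// sqr_ge0.
have -> : w q ^+ 3 * (L * kap q ^+ 2) ^+ 2 = L ^+ 2 * (w q ^+ 3 * kap q * kap q ^+ 3) by ring.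
rewrite ler_wpM2l ?sqr_ge0//; apply: le_trans (kap_le q).2.
by rewrite ler_piMr ?mulr_ge0 ?exprn_ge0 ?(ltW (kap_gt0 q))// exprn_ile1 ?kap_le1// ltW.
Qed.

Let dec := expR (- beta).

Lemma block_family b1 : (forall q x, `|x| <= r q -> `|F x| <= b1 q) -> forall q,
  integrand gamma (w q) (block Wp q) (b1 q) (K * (w q ^+ 2 * r q ^+ 3))
    (F \o (Y q).1) (G \o (Y q).1) (fun t v => 'd G ((Y q).1 t) ((Y q).2 t *m v)).
Proof.
move=> hF q; apply: (truncated_integrand cb gamma3 gamma2 (rW q)) (hF q).
  exact: trunc_size_rho.
exact: trunc_path_ctrl.
Qed.

(** The integrals in [LP_path] are instances of [bint] by conversion. *)
Lemma fixed_point_path p t : 0 <= t <= 1 ->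
  (U p).1 t = lp_path A Pc Ps (block Wp) (fun q => F \o (Y q).1) (fun q => G \o (Y q).1)
    (fun q t v => 'd G ((Y q).1 t) ((Y q).2 t *m v)) xi p t /\
  (U p).2 t = G ((Y p).1 t).
Proof. by move=> t01; have [_ /(_ p t t01)[-> ->]] := fpU. Qed.

Lemma deviation b1 s E : (forall q x, `|x| <= r q -> `|F x| <= b1 q) ->
  tame dec s E -> (forall q, b1 q + w q * (K * (w q ^+ 2 * r q ^+ 3)) <= E q) ->
  forall p, pctrl gamma (block Wp p).1 (K2 * ((Ms + Mc) * Kb * s + 1) * E p)
    (U p - center_orbit d A xi p).
Proof.
move=> hF tE bE p; have ig := block_family hF.
have h := lp_path_deviation nu_ge0 spl dich Mc1 Ms1 ig Kb0
  (fun q => (flow_bound (ig q)).1) (fun q => (flow_bound (ig q)).2) tE bE K20 flow_ctrl xi p.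
apply: ctrl_ext01 h => [t t01|t v t01]; rewrite cpathBE.
  by rewrite (fixed_point_path p t01).1.
by rewrite (fixed_point_path p t01).2 subr0.
Qed.

Lemma center_orbit_ctrl p : pctrl gamma (block Wp p).1 (c1 * (Mc * `|xi|)) (center_orbit d A xi p).
Proof.
apply: ctrl_le (orbit_bound _ _ _ g0 gamma2); rewrite ler_wpM2l//.
have p0 : - p.+1%:R <= 0 :> R by rewrite oppr_le0.
apply: le_trans (center_bound dich p0 cxi) _.
rewrite -mulrA ler_wpM2l ?(le_trans ler01)// ler_piMl//.
have : expR (nu * - p.+1%:R) <= expR 0 by rewrite ler_expR; exact: mulr_ge0_le0.
by rewrite expR0.
Qed.

Lemma Dn_deviation B p : pctrl gamma (block Wp p).1 B (U p - center_orbit d A xi p) ->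
  a p <= 4 * (c1 * (Mc * `|xi|)) + 4 * B.
Proof.
move=> h; have := ctrlD (center_orbit_ctrl p) h => h2.
have h3 : pctrl gamma (block Wp p).1 (c1 * (Mc * `|xi|) + B) (U p).
  apply: ctrl_ext h2 => [t|t v]; rewrite cpathBE; first by rewrite addrC subrK.
  by rewrite mulmxBl addrC subrK.
by have := pctrl_Dnorm h3; rewrite Dn_fin lee_fin mulrDr.
Qed.

Variables (x s eps eps1 rho1 : R).
Hypothesis x1 : 1 < x.
Hypothesis tx : tame dec s (fun q => x ^+ q).
Hypothesis tx2 : tame dec s (fun q => (x ^+ 2) ^+ q).
Hypothesis ty : tame dec s (fun q => expR (- eta) ^+ q).
Hypothesis s0 : 0 <= s.
Local Notation S := (K2 * ((Ms + Mc) * Kb * s + 1)).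
Hypothesis eps_gt0 : 0 < eps.
Hypothesis epsS : eps * (4 * S) <= 2^-1.
Hypothesis eps1_ge0 : 0 <= eps1.
Hypothesis F_eps1 : forall x, `|x| <= rho1 -> `|F x| <= eps1 * `|x|.
Hypothesis kap0_rho1 : L * kap0 <= rho1.
Hypothesis eps_small : (eps1 + K * L ^+ 2 * kap0) * (L * (1 + d%:R)) <= eps.

Let S0 : 0 <= S.
Proof.
by rewrite mulr_ge0// addr_ge0// !mulr_ge0// addr_ge0// (le_trans ler01).
Qed.

(** Block q has index - (q + 1), so membership in [BC] allows growth e^{- eta (q + 1)}; the extra
    factor e^{- eta} goes into [B]. *)
Lemma weight_BC : exists2 B : R, 0 <= B & forall q, a q <= B * expR (- eta) ^+ q.
Proof.
have [[_ _ hsup] _] := fpU.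
set T := ereal_sup _ in hsup.
have hq q : ((expR (- eta * - q.+1%:R))%:E * (a q)%:E <= T)%E.
  by apply: ereal_sup_ubound; exists q => //; rewrite Dn_fin.
have T0 : (0 <= T)%E.
  by apply: le_trans (hq 0); rewrite lee_fin mulr_ge0 ?expR_ge0 ?Dn_ge0.
have fT : T \is a fin_num by rewrite ge0_fin_numE.
exists (fine T * expR (- eta)); first by rewrite mulr_ge0 ?fine_ge0 ?expR_ge0.
move=> q; have h : expR (- eta * - q.+1%:R) * a q <= fine T.
  by rewrite -lee_fin fineK// EFinM; exact: hq.
rewrite -mulrA -exprS -expRM_natr.
have -> : expR (- eta * q.+1%:R) = (expR (- eta * - q.+1%:R))^-1 by rewrite -expRN mulrN opprK.
by rewrite ler_pdivlMr ?expR_gt0// mulrC.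
Qed.

Lemma total_small k :
  eps1 * r k + w k * (K * (w k ^+ 2 * r k ^+ 3)) <= eps * a k.
Proof.
have h1 := cubic_small k; have h2 := trunc_size_Dn k.
have h3 : (eps1 + K * L ^+ 2 * kap0) * r k <= (eps1 + K * L ^+ 2 * kap0) * (L * ((1 + d%:R) * a k)).
  have kp : 0 <= kap0 := le_trans (ltW (kap_gt0 0)) (kap_le 0).1.
  by rewrite ler_wpM2l// addr_ge0// !mulr_ge0// exprn_ge0.
have h4 : (eps1 + K * L ^+ 2 * kap0) * (L * ((1 + d%:R) * a k)) <= eps * a k.
  by rewrite !(mulrA _ _ (a k)) ler_wpM2r// Dn_ge0.
apply: le_trans (le_trans _ h3) h4; rewrite mulrDl lerD2l//.
Qed.

Lemma F_small q (y : V) : `|y| <= r q -> `|F y| <= eps1 * r q.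
Proof.
move=> yr; apply: le_trans (F_eps1 _) _; last by rewrite ler_wpM2l.
exact: le_trans yr (le_trans (trunc_size_le q) kap0_rho1).
Qed.

(** The prefactor from [weight_BC] depends on the fixed point in an unknown way; [gronwall_tame]
    uses its mere existence and returns a bound linear in |xi|. The factors 4 come from the four
    summands of [Dnorm]. *)
Lemma linear_growth q : a q <= 2 * (4 * (c1 * (Mc * `|xi|))) * x ^+ q.
Proof.
have [B B0 hB] := weight_BC.
apply: (@gronwall_tame _ dec s (4 * S) eps _ B x (expR (- eta))) => //.
- by rewrite mulr_ge0.
- by rewrite !mulr_ge0// (le_trans ler01).
- exact: ltW.
move=> E tE aE p; rewrite -[4 * _ * E p]mulrA; apply: Dn_deviation.
apply: (@deviation (fun q => eps1 * r q)) => [k y|//|k]; first exact: F_small.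
exact: le_trans (total_small k) (aE k).
Qed.

Local Notation z q := (x ^+ q * `|xi|).
Local Notation Cg := (8 * (c1 * Mc)).
Local Notation C1 := (L * ((1 + d%:R) * Cg)).
Local Notation Kq := (K * (1 + L)).

Lemma Dn_le q : a q <= Cg * z q.
Proof.
apply: le_trans (linear_growth q) _; rewrite le_eqVlt; apply/orP; left; apply/eqP.
by move: (x ^+ q) `|xi| => X Y; ring.
Qed.

Let z_ge0 q : 0 <= z q.
Proof. by rewrite mulr_ge0// exprn_ge0// ltW// (lt_trans ltr01). Qed.

Let c1Mc : 0 <= c1 * Mc.
Proof. by rewrite mulr_ge0// (le_trans ler01). Qed.

Lemma trunc_size_growth q : r q <= C1 * z q.
Proof.
apply: le_trans (trunc_size_Dn q) _; rewrite -!mulrA ler_wpM2l// ler_wpM2l//.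
by have := Dn_le q; rewrite -!mulrA.
Qed.

(** The drift is at most K r^2, and w^3 r <= L brings the cubic noise term down to K L r^2. Since r
    is linear in z by the growth bound, the weight is z^2; its growth (x^2)^q is tame by [tx2]. *)
Lemma quadratic_deviation p : (0 < l)%N ->
  pctrl gamma (block Wp p).1 (S * (Kq * C1 ^+ 2) * z p ^+ 2) (U p - center_orbit d A xi p).
Proof.
move=> l0; have Kq0 : 0 <= Kq by rewrite mulr_ge0// addr_ge0.
pose E q := Kq * C1 ^+ 2 * `|xi| ^+ 2 * (x ^+ 2) ^+ q.
have EE q : E q = Kq * (C1 * z q) ^+ 2.
  by rewrite /E -exprM mulnC exprM; move: (x ^+ q) C1 Kq `|xi| => X C Q Y; ring.
have tE : tame dec s E.
  apply: tame_scale tx2.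
  by apply: mulr_ge0; [apply: mulr_ge0|]; rewrite ?sqr_ge0.
have := @deviation (fun q => K * r q ^+ 2) s E _ tE _ p.
have -> : S * E p = S * (Kq * C1 ^+ 2) * z p ^+ 2.
  by rewrite EE; move: C1 Kq (z p) S => C Q Y T; ring.
apply=> [q y yr|q].
  apply: le_trans (cb_F2 cb l0 (le_trans yr (trunc_size_rho q))) _.
  by rewrite ler_wpM2l// lerXn2r// nnegrE// trunc_size_ge0.
rewrite EE; apply: (@le_trans _ _ (Kq * r q ^+ 2)); last first.
  by rewrite ler_wpM2l// lerXn2r// ?nnegrE ?trunc_size_ge0 ?trunc_size_growth// (le_trans (trunc_size_ge0 q))// trunc_size_growth.
have -> : K * r q ^+ 2 + w q * (K * (w q ^+ 2 * r q ^+ 3)) =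
  K * (1 + w q ^+ 3 * r q) * r q ^+ 2 by ring.
rewrite ler_wpM2r ?sqr_ge0// ler_wpM2l// lerD2l.
apply: (@le_trans _ _ (w q ^+ 3 * (L * kap q))).
  rewrite ler_wpM2l ?exprn_ge0//; apply: le_trans (trunc_size_kap q) _.
  by rewrite ler_wpM2l// kap_sqr.
rewrite mulrCA -[leRHS]mulr1 ler_wpM2l//.
exact: le_trans (kap_le q).2 kap0_le1.
Qed.

Definition orbit_trunc (q : nat) : cpath R n d :=
  truncate gamma chi rad (block Wp q) (center_orbit d A xi q).
Local Notation Y0 := orbit_trunc.
Local Notation C := (L + C1 + L * (c1 * Mc) + L * (S * (Kq * C1 ^+ 2))).

Lemma C_ge : [/\ 1 <= C, L <= C, C1 <= C, L * (c1 * Mc) <= C & L * (S * (Kq * C1 ^+ 2)) <= C].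
Proof.
have h1 : 0 <= C1.
  by apply: mulr_ge0 => //; apply: mulr_ge0; [rewrite addr_ge0|apply: mulr_ge0].
have h2 : 0 <= L * (c1 * Mc) by rewrite mulr_ge0.
have h3 : 0 <= L * (S * (Kq * C1 ^+ 2)).
  by apply: mulr_ge0 => //; apply: mulr_ge0 => //; rewrite mulr_ge0 ?sqr_ge0// mulr_ge0// addr_ge0.
move: h1 h2 h3; move: C1 (L * (c1 * Mc)) (L * (S * (Kq * C1 ^+ 2))) => X1 X2 X3 h1 h2 h3.
by have := L1; have := L0; split; lra.
Qed.

(** A size valid at once for the truncated fixed point and for the truncated orbit. *)
Definition diff_size (q : nat) : R := Num.min (L * Rq q) (C * z q).
Local Notation rr := diff_size.

(** The bound by the radius is the triangle inequality. The bound by z^2 is the Lipschitz property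
    of the cut-off applied to [quadratic_deviation]; for l = 0 it is not claimed. *)
Lemma diff_paths q : exists D,
  [/\ [/\ pctrl gamma (block Wp q).1 (rr q) (Y q), pctrl gamma (block Wp q).1 (rr q) (Y0 q) &
      pctrl gamma (block Wp q).1 D (Y q - Y0 q)],
      D <= 2 * C * kap q ^+ 2 & ((0 < l)%N -> D <= C * z q ^+ 2)].
Proof.
have [hC1 hC2 hC3 hC4 hC5] := C_ge.
have cO : controlled gamma (block Wp q).1 (center_orbit d A xi q).
  exact: (pctrl_controlled g0 (rW q) (center_orbit_ctrl q)).
have [h1 h2 h3] := truncL (rW q) (Rq_gt0 q) (cU q).
have [k1 k2 _] := truncL (rW q) (Rq_gt0 q) cO.
have zq := z_ge0 q.
have cY : pctrl gamma (block Wp q).1 (rr q) (Y q).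
  apply: pctrl_min h1 (ctrl_le _ (trunc_path_ctrl q)).
  by apply: le_trans (trunc_size_growth q) _; rewrite ler_wpM2r.
have cY0 : pctrl gamma (block Wp q).1 (rr q) (Y0 q).
  apply: pctrl_min k1 (ctrl_le _ (k2 _ (center_orbit_ctrl q))).
  apply: (@le_trans _ _ (L * (c1 * Mc) * z q)); last by rewrite ler_wpM2r.
  rewrite -!mulrA ler_wpM2l// ler_wpM2l// ler_wpM2l ?(le_trans ler01)//.
  by rewrite ler_peMl// exprn_ege1// ltW.
have cD1 : pctrl gamma (block Wp q).1 (2 * (L * Rq q)) (Y q - Y0 q).
  apply: ctrl_ext (ctrl_le _ (ctrlB h1 k1)) => [t|t v|]; rewrite ?cpathBE ?mulmxBl//.
  by rewrite mulr_natl mulr2n.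
have Dk : 2 * (L * Rq q) <= 2 * C * kap q ^+ 2.
  rewrite -mulrA ler_wpM2l//; apply: ler_pM => //; exact: ltW.
case: (posnP l) => [l0|l0].
  exists (2 * (L * Rq q)); split; [by split|exact: Dk|by []].
have cD2 := h3 _ _ cO (quadratic_deviation q l0).
exists (Num.min (2 * (L * Rq q)) (C * z q ^+ 2)); split.
- split=> //; apply: pctrl_min cD1 (ctrl_le _ cD2).
  by rewrite mulrA; apply: ler_wpM2r; rewrite ?sqr_ge0.
- by rewrite ge_min Dk.
- by move=> _; rewrite ge_min lexx orbT.
Qed.

Variable K4 : R.
Hypothesis K40 : 0 <= K4.
Hypothesis diffK4 : forall w (W : rpath R d) r D b1 (Y U : cpath R n d),
  rough_on gamma w W -> r <= rho -> pctrl gamma W.1 r Y -> pctrl gamma W.1 r U ->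
  pctrl gamma W.1 D (Y - U) -> (forall x, `|x| <= r -> `|F x| <= b1) ->
  `|bint W (flow A Ps 1) (F \o Y.1) (G \o Y.1) (fun t v => 'd G (Y.1 t) (Y.2 t *m v)) 0 1 -
    bint W (flow A Ps 1) (Fl \o U.1) (Gl \o U.1) (fun t v => 'd Gl (U.1 t) (U.2 t *m v)) 0 1|
  <= K4 * (w ^+ (2 * l + 3) * (r ^+ l.+1 + l%:R * (D * r ^+ l.-1))).
Local Notation Kd := (K4 * ((1 + 2 * l%:R) * C ^+ l.+1)).
Hypothesis xl : dec * x ^+ l < 1.
Hypothesis kap0_small : Ms * (Kd * kap0) <= 1 - dec * x ^+ l.

Local Notation T q := (trunc_int gamma A chi rad Ps F G (block Wp q) (U q) 0 1 1).
Local Notation T0 q := (trunc_int gamma A chi rad Ps Fl Gl (block Wp q) (center_orbit d A xi q) 0 1 1).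

Lemma diff_size_rho q : rr q <= rho.
Proof.
rewrite /diff_size ge_min; apply/orP; left; apply: le_trans kap0_rho.
rewrite ler_wpM2l//; apply: le_trans (Rq_kap q) _.
exact: le_trans (kap_sqr q) (kap_le q).1.
Qed.

Lemma diff_size_ge0 q : 0 <= rr q.
Proof. by have [D [[h _ _] _ _]] := diff_paths q; exact: ctrl_ge0 h. Qed.

Lemma diff_F q (y : V) : `|y| <= rr q -> `|F y| <= eps1 * rr q.
Proof.
move=> yr; apply: le_trans (F_eps1 _) _; last by rewrite ler_wpM2l.
apply: le_trans yr _; rewrite /diff_size ge_min; apply/orP; left.
apply: le_trans kap0_rho1; rewrite ler_wpM2l//; apply: le_trans (Rq_kap q) _.
exact: le_trans (kap_sqr q) (kap_le q).1.
Qed.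

(** The factor kap gained in [two_scale_bound] is spent on the power of [w] lost in
    [block_difference]. *)
Lemma stable_difference q : `|T q - T0 q| <= Kd * kap0 * z q ^+ l.
Proof.
have [D [[cY cY0 cD] Dk Dz]] := diff_paths q.
have [hC1 hC2 _ _ _] := C_ge.
apply: le_trans (diffK4 (rW q) (diff_size_rho q) cY cY0 cD (@diff_F q)) _.
have h : rr q ^+ l.+1 + l%:R * (D * rr q ^+ l.-1) <=
    (1 + 2 * l%:R) * C ^+ l.+1 * kap q * z q ^+ l.
  apply: two_scale_bound Dk Dz => //.
  - exact: kap_le1.
  - exact: diff_size_ge0.
  - rewrite /diff_size ge_min; apply/orP; left; apply: ler_pM => //; exact: ltW.
  - by rewrite /diff_size ge_min lexx orbT.
  - exact: ctrl_ge0 cD.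
have C0 : 0 <= C := le_trans ler01 hC1.
rewrite -!(mulrA K4) ler_wpM2l//.
apply: le_trans (ler_wpM2l (exprn_ge0 _ (w0 q)) h) _.
have -> : w q ^+ (2 * l + 3) * ((1 + 2 * l%:R) * C ^+ l.+1 * kap q * z q ^+ l) =
  (1 + 2 * l%:R) * C ^+ l.+1 * (w q ^+ (2 * l + 3) * kap q * z q ^+ l).
  by move: (w q ^+ _) (C ^+ l.+1) (z q ^+ l) => X1 X2 X3; ring.
rewrite -[leRHS]mulrA; apply: ler_wpM2l.
  by apply: mulr_ge0; [rewrite addr_ge0// mulr_ge0|exact: exprn_ge0].
by rewrite ler_wpM2r// exprn_ge0.
Qed.

Lemma stable_integral_proj q : Ps *m T q = T q /\ Ps *m T0 q = T0 q.
Proof.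
have [_ c2 PsPs _] := splitting_comm spl.
have [D [[cY cY0 cD] _ _]] := diff_paths q.
have ig := block_family (b1 := fun q => eps1 * r q) F_small q.
have [b1' [b2' ig0]] := leading_integrand cb gamma3 gamma2 (rW q) (diff_size_rho q) cY cY0 cD (@diff_F q).
by split; [exact: (block_int_proj (fun=> ig) 0 1 c2 PsPs)|
  exact: (block_int_proj (fun=> ig0) 0 1 c2 PsPs)].
Qed.

Lemma stable_term q : `|expmx (q%:R *: A) *m (T q - T0 q)| <=
  Ms * (Kd * kap0) * `|xi| ^+ l * (dec * x ^+ l) ^+ q.
Proof.
have [h1 h2] := stable_integral_proj q.
have hs : stable_space A (T q - T0 q).
  apply/(proj_stable spl); move: (T q) (T0 q) h1 h2 => a b ha hb.
  by rewrite mulmxBr ha hb.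
apply: le_trans (stable_bound dich (ler0n _ q) hs) _.
rewrite expRM_natr -/dec; apply: le_trans (ler_wpM2l _ (stable_difference q)) _.
  by rewrite mulr_ge0 ?exprn_ge0 ?expR_ge0// (le_trans ler01).
rewrite !exprMn -!exprM (mulnC l q); move: (Kd * kap0) => X.
by rewrite le_eqVlt; apply/orP; left; apply/eqP; ring.
Qed.

Lemma stable_series_Gam :
  stable_series gamma A Ps chi rad F G Wp U N @[N --> \oo] --> Ps *m (U 0).1 1.
Proof.
have ig := block_family (b1 := fun q => eps1 * r q) F_small.
have c0 : 0 <= 2 * (4 * (c1 * (Mc * `|xi|))) by rewrite !mulr_ge0// (le_trans ler01).
have tE : tame dec s (fun q => eps * (2 * (4 * (c1 * (Mc * `|xi|)))) * x ^+ q).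
  by apply: tame_scale tx; rewrite mulr_ge0// ltW.
have t01 : 0 <= (1 : R) <= 1 by rewrite ler01 lexx.
rewrite (fixed_point_path 0 t01).1.
apply: (stable_projection spl dich Ms1 ig Kb0 (fun q => (flow_bound (ig q)).2) tE _ cxi) => q.
apply: le_trans (total_small q) _; rewrite -mulrA ler_wpM2l ?(ltW eps_gt0)//.
exact: linear_growth.
Qed.

(** The approximate series converges as the series of the fixed point minus the absolutely
    convergent series of differences. The geometric sum of the latter is compensated by
    [kap0_small], which leaves the constant 1. *)
Lemma stable_series_diff :
  cvgn (stable_series gamma A Ps chi rad Fl Gl Wp (center_orbit d A xi)) /\
  `|Ps *m (U 0).1 1 - limn (stable_series gamma A Ps chi rad Fl Gl Wp (center_orbit d A xi))|
    <= `|xi| ^+ l.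
Proof.
pose u q := expmx (q%:R *: A) *m (T q - T0 q).
have d0 : 0 < 1 - dec * x ^+ l by have := xl; lra.
have dx0 : 0 <= dec * x ^+ l.
  by rewrite mulr_ge0 ?expR_ge0// exprn_ge0// ltW// (lt_trans ltr01).
have [hC1 _ _ _ _] := C_ge.
have kp : 0 <= kap0 := le_trans (ltW (kap_gt0 0)) (kap_le 0).1.
have Kd0 : 0 <= Kd.
  apply: mulr_ge0 => //; apply: mulr_ge0; first by rewrite addr_ge0// mulr_ge0.
  by apply: exprn_ge0; exact: le_trans hC1.
have B0 : 0 <= Ms * (Kd * kap0) * `|xi| ^+ l.
  by do 2?[apply: mulr_ge0]; [exact: le_trans Ms1|exact: mulr_ge0|exact: exprn_ge0].
have cu : cvgn (series u).
  apply: (series_mx_cvg stable_term); apply: is_cvg_geometric_series.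
  by rewrite ger0_norm.
have ub N : `|series u N| <= `|xi| ^+ l.
  apply: le_trans (ler_norm_sum _ _ _) _.
  apply: le_trans (ler_sum _ (fun q _ => stable_term q)) _.
  rewrite -mulr_sumr; apply: le_trans (ler_wpM2l B0 (geometric_sum_le N dx0 xl)) _.
  rewrite mulrAC ler_piMl ?exprn_ge0// ler_pdivrMr// mul1r.
  exact: kap0_small.
have e : stable_series gamma A Ps chi rad Fl Gl Wp (center_orbit d A xi) =
    (fun N => stable_series gamma A Ps chi rad F G Wp U N - series u N).
  have key (M : 'M[R]_n) (a b : V) : M *m b = M *m a - M *m (a - b).
    by rewrite mulmxBr opprB addrC subrK.
  apply/funext => N; rewrite /stable_series /series/= -sumrB.
  by apply: eq_bigr => q _; exact: key.
have cv : (stable_series gamma A Ps chi rad Fl Gl Wp (center_orbit d A xi)) @ \oo -->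
    Ps *m (U 0).1 1 - limn (series u).
  by rewrite e; apply: cvgB; [exact: stable_series_Gam|exact: cu].
split; first by apply/cvg_ex; exists (Ps *m (U 0).1 1 - limn (series u)).
rewrite (mx_cvgn_lim cv) opprB addrC subrK.
exact: cvgn_norm_le cu ub.
Qed.

End MainEstimates.

(** * Choice of the constants and of the radius *)

Section FinalConstants.
Context {R : realType}.

(** Satisfies finitely many smallness conditions m k <= b at once, whatever the sign of m. *)
Lemma small_constant (s : seq (R * R)) : {in s, forall mb, 0 < mb.2} ->
  exists k : R, [/\ 0 < k, k <= 1 & {in s, forall mb, mb.1 * k <= mb.2}].
Proof.
elim: s => [|[m b] s ih] h; first by exists 1; rewrite ltr01.
have [mb mbs|k [k0 k1 hk]] := ih; first by apply: h; rewrite inE mbs orbT.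
have b0 : 0 < b by apply: (h (m, b)); rewrite mem_head.
have m1 : 0 < `|m| + 1 by rewrite ltr_wpDl.
exists (Num.min k (b / (`|m| + 1))); split.
- by rewrite lt_min k0 divr_gt0.
- by rewrite ge_min k1.
- have min0 : 0 <= Num.min k (b / (`|m| + 1)) by rewrite le_min (ltW k0) divr_ge0// ltW.
  move=> mb; rewrite inE => /predU1P[->|mbs] /=.
    apply: (@le_trans _ _ (`|m| * (b / (`|m| + 1)))).
      apply: (@le_trans _ _ (`|m| * Num.min k (b / (`|m| + 1)))).
        by rewrite ler_wpM2r// ler_norm.
      by rewrite ler_wpM2l// ge_min lexx orbT.
    by rewrite mulrA ler_pdivrMr// mulrC ler_pM2l// lerDl.
  have [m0|m0] := lerP 0 mb.1.
    by apply: le_trans (hk _ mbs); rewrite ler_wpM2l// ge_min lexx.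
  apply: (@le_trans _ _ 0); first by rewrite mulr_le0_ge0// ltW.
  by apply: ltW; apply: h; rewrite inE mbs orbT.
Qed.

Lemma tame_pow (rho z : R) : 0 < rho -> 1 < z -> rho * z < 1 ->
  exists2 s : R, 0 <= s & tame rho s (fun q => z ^+ q).
Proof.
move=> r0 z1 rz; have [h1 h2 h3] := tame_geometric r0 z1 rz ler01.
exists (z / (z - 1) + z / (1 - rho * z)).
  by rewrite addr_ge0// divr_ge0//; lra.
split=> [q|p|p N].
- by have := h1 q; rewrite mul1r.
- by have := h2 p; rewrite mul1r; under eq_bigr do rewrite mul1r.
- by have := h3 p N; rewrite mul1r; under eq_bigr do rewrite mul1r.
Qed.

Lemma Dnorm_cst n d gamma (W : R -> 'cV[R]_d) (v : 'cV[R]_n) :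
  (Dnorm gamma W (cst_cpath d v) <= `|v|%:E)%E.
Proof.
have -> : `|v|%:E = (`|v|%:E + 0%:E + 0%:E + 0%:E)%E by rewrite !adde0.
rewrite /Dnorm; apply: leeD; [apply: leeD; [apply: leeD|]|].
- by apply: sup_norm_le => t t0 t1.
- by apply: sup_norm_le => t t0 t1; rewrite normr0.
- by apply: holder_norm_le => s t s0 st t1; rewrite mul0r /incr/= subrr normr0.
- by apply: holder_norm_le => s t s0 st t1; rewrite mul0r /remainder /incr/= subrr mul0mx subrr normr0.
Qed.

End FinalConstants.

Theorem theoremD2 (R : realType) (n d m l : nat)
  (gamma beta nu eta Mc Ms : R)
  (gamma_gt : 3^-1 < gamma) (gamma_le : gamma <= 2^-1)
  (beta_gt0 : - beta < 0) (nu_ge0 : 0 <= nu) (nu_lt : nu < beta)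
  (Mc_ge1 : 1 <= Mc) (Ms_ge1 : 1 <= Ms)
  (eta_gt : - beta < eta) (eta_lt0 : eta < 0)
  (F : 'cV[R]_n -> 'cV[R]_n) (G : 'cV[R]_n -> 'M[R]_(n, d))
  (F_Cm : Ck m F) (F0 : F 0 = 0) (DF0 : forall v, 'd F 0 v = 0)
  (G_Cm3 : Ck (m + 3) G) (G0 : G 0 = 0) (DG0 : forall v, 'd G 0 v = 0)
  (D2G0 : forall v w, 'd (fun x => 'd G x v) 0 w = 0)
  (l_lt_m : (l < m)%N)
  (Fl : ('I_l -> 'cV[R]_n) -> 'cV[R]_n)
  (Gl : ('I_l -> 'cV[R]_n) -> 'M[R]_(n, d))
  (Fl_lin : multilinear Fl) (Gl_lin : multilinear Gl)
  (F_lead : F = on_diag Fl +O_ (0 : 'cV[R]_n) (fun u => `|u| ^+ l.+1))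
  (G_lead : G = on_diag Gl +O_ (0 : 'cV[R]_n) (fun u => `|u| ^+ l.+1))
  (chi : (R -> 'cV[R]_d) -> cpath R n d -> cpath R n d)
  (chi_cut : cut_off gamma chi) :
  exists C : R -> R,
  forall A Pc Ps : 'M[R]_n,
    center_stable_splitting A Pc Ps -> dichotomy A nu beta Mc Ms ->
  exists2 rad0 : R -> R -> R,
    (forall a b, 0 <= a -> 0 <= b -> 0 < rad0 a b) &
  forall rad : R -> R -> R,
    (forall a b, 0 <= a -> 0 <= b -> 0 < rad a b <= rad0 a b) ->
  forall (dsp : measure_display) (Om : measurableType dsp)
    (P : probability Om R) (theta : R -> Om -> Om) (W : Om -> rpath R d),
    metric_dynamical_system P theta -> rough_cocycle gamma theta W ->
  forall (om : Om) (Gam : 'cV[R]_n -> nat -> cpath R n d),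
    (forall xi, center_space A xi ->
       LP_unique_fixed_point gamma A Pc Ps chi rad F G eta (W om) xi (Gam xi)) ->
  forall xi : 'cV[R]_n, center_space A xi ->
    let h := center_manifold Ps Gam xi in
    let happ := center_manifold_app gamma A Ps chi rad Fl Gl (W om) xi in
    [/\ stable_series gamma A Ps chi rad F G (W om) (Gam xi) N @[N --> \oo] --> h,
        cvgn (stable_series gamma A Ps chi rad (on_diag Fl) (on_diag Gl) (W om)
                (center_orbit d A xi))
      & (Dnorm gamma (W om).1 (cst_cpath d (h - happ)%R)
         <= (C (op_norm A) * `|xi| ^+ l)%:E)%E].
Proof.
have g3 : 1 < 3 * gamma by lra.
have g2 : 2 * gamma <= 1 by lra.
have g0 : 0 < gamma by lra.
have [K [rho cb]] := coeff_boundsP l_lt_m F_Cm F0 DF0 G_Cm3 G0 DG0 D2G0 Fl_lin Gl_lin F_lead G_lead.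
have [L L1 truncL] := truncate_bounds g0 chi_cut.
have L0 : 0 < L := lt_le_trans ltr01 L1.
have K0 : 0 < K := lt_le_trans ltr01 (cb_K cb).
exists (fun=> 1) => A Pc Ps spl dich.
have [Ka Ka0 hKa] := @bint_flow_bound R n d A gamma Pc g3.
have [Kb Kb0 hKb] := @bint_flow_bound R n d A gamma Ps g3.
have [K2 K20 hK2] := @bint_flow_ctrl R n d A gamma g3.
have [c1 c10 hc1] := @center_orbit_pctrl R n d A.
have [K4 K40 hK4] := block_difference cb g3 g2 A Ps.
have flow_bound w (W : rpath R d) b1 b2 (phi : R -> 'cV[R]_n) (Z : R -> 'M[R]_(n, d)) dZ :
    integrand gamma w W b1 b2 phi Z dZ ->
    `|bint W (flow A Pc 1) phi Z dZ 0 1| <= (Ka + Kb) * (b1 + w * b2) /\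
    `|bint W (flow A Ps 1) phi Z dZ 0 1| <= (Ka + Kb) * (b1 + w * b2).
  move=> ig; have e0 : 0 <= b1 + w * b2.
    apply: addr_ge0; first exact: le_trans (ig_sup ig (lexx 0) ler01).
    by rewrite mulr_ge0 ?(ctrl_ge0 (ig_ctrl ig))// (le_trans ler01)// (rough_on_ge1 (ig_rough ig)).
  split; [apply: le_trans (hKa _ _ _ _ _ _ _ ig) _|apply: le_trans (hKb _ _ _ _ _ _ _ ig) _];
    by rewrite ler_wpM2r// ?lerDl// lerDr.
have beta0 : 0 < beta by lra.
have l20 : 0 < (2 * (l + 2))%:R :> R by rewrite ltr0n muln_gt0 addn_gt0 orbT.
(* Half of the decay rate is shared among l + 2 factors, so that x = e^del satisfies e^{- beta} x^k
   < 1 for k = 1, 2 and l simultaneously. *)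
pose del : R := beta / (2 * (l + 2))%:R.
have del0 : 0 < del by rewrite divr_gt0.
have dec_pow k : (k <= l + 2)%N -> expR (- beta) * expR del ^+ k < 1.
  move=> kl; rewrite -expRM_natr -expRD expR_lt1.
  have : del * k%:R <= beta / 2.
    have j0 : 0 < (l + 2)%:R :> R by rewrite ltr0n addn2.
    have -> : beta / 2 = del * (l + 2)%:R.
      by rewrite /del natrM; move: ((l + 2)%:R : R) j0 => j j0; field; exact: lt0r_neq0.
    by rewrite ler_pM2l// ler_nat.
  lra.
have x1 : 1 < expR del by rewrite expR_gt1.
have dec0 : 0 < expR (- beta) by exact: expR_gt0.
have dx1 : expR (- beta) * expR del < 1 by apply: (dec_pow 1); rewrite addn2.
have dx2 : expR (- beta) * expR del ^+ 2 < 1 by apply: dec_pow; rewrite addn2.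
have dxl : expR (- beta) * expR del ^+ l < 1 by apply: dec_pow; rewrite leq_addr.
have dy : expR (- beta) * expR (- eta) < 1 by rewrite -expRD expR_lt1; lra.
have x21 : 1 < expR del ^+ 2 by rewrite exprn_egt1.
have y1 : 1 < expR (- eta) by rewrite expR_gt1; lra.
have [s1 s10 t1] := tame_pow dec0 x1 dx1.
have [s2 s20 t2] := tame_pow dec0 x21 dx2.
have [s3 s30 t3] := tame_pow dec0 y1 dy.
(* One tameness constant for the three weights x^q, x^(2 q) and e^{- eta q}. *)
pose s := s1 + s2 + s3.
have s0 : 0 <= s by rewrite !addr_ge0.
have [s1s s2s s3s] : [/\ s1 <= s, s2 <= s & s3 <= s].
  by rewrite /s; clear -s10 s20 s30; split; lra.
have tx := tame_le s1s t1; have tx2 := tame_le s2s t2.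
have ty := tame_le s3s t3.
pose S := K2 * ((Ms + Mc) * (Ka + Kb) * s + 1).
have S0 : 0 <= S.
  rewrite mulr_ge0// addr_ge0// mulr_ge0// mulr_ge0// addr_ge0//;
    exact: le_trans ler01 _.
pose eps := (8 * (S + 1))^-1.
have eps0 : 0 < eps by rewrite invr_gt0 mulr_gt0// ltr_wpDl.
have epsS : eps * (4 * S) <= 2^-1.
  by rewrite mulrC ler_pdivrMr; [clear -S0; clearbody S; lra|rewrite mulr_gt0// ltr_wpDl].
have Ld : 0 < L * (1 + d%:R) by rewrite mulr_gt0// ltr_wpDr.
(* The admissible total [eps] is shared equally between the drift, through [eps1], and the noise,
   through the third condition on [k] below. *)
pose eps1 := eps / (2 * (L * (1 + d%:R))).
have eps10 : 0 < eps1 by rewrite divr_gt0// mulr_gt0.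
have [rho1 rho10 hF1] := cb_F cb eps10.
pose C1 := L * ((1 + d%:R) * (8 * (c1 * Mc))).
pose C := L + C1 + L * (c1 * Mc) + L * (S * (K * (1 + L) * C1 ^+ 2)).
pose Kd := K4 * ((1 + 2 * l%:R) * C ^+ l.+1).
(* The first two conditions keep truncated paths in the balls where the coefficient bounds and the
   smallness of [F] hold, the third is the share of the noise, and the fourth bounds the geometric
   sum of the errors. *)
have [mb|k [k0 k1 hk]] := @small_constant R [:: (L, rho); (L, rho1);
    (K * L ^+ 2 * (L * (1 + d%:R)), eps / 2); (Ms * Kd, 1 - expR (- beta) * expR del ^+ l)].
  rewrite !inE => /or4P[] /eqP -> /=; [exact: cb_rho cb|exact: rho10|exact: divr_gt0|by rewrite subr_gt0].
have {hk} [h1 h2 h3 h4] : [/\ L * k <= rho, L * k <= rho1,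
    K * L ^+ 2 * (L * (1 + d%:R)) * k <= eps / 2 &
    Ms * Kd * k <= 1 - expR (- beta) * expR del ^+ l].
  by split; [apply: (hk (_, _))|apply: (hk (_, _))|apply: (hk (_, _))|apply: (hk (_, _))];
    rewrite !inE eqxx ?orbT.
have den a b : 0 <= a -> 0 <= b -> 0 < (1 + a + b : R) ^+ (2 * l + 3).
  by move=> a0 b0; rewrite exprn_gt0// -addrA ltr_wpDr// addr_ge0.
exists (fun a b => (k / (1 + a + b) ^+ (2 * l + 3)) ^+ 2).
  by move=> a b a0 b0; rewrite exprn_gt0// divr_gt0// den.
move=> rad hrad dsp Om P theta W _ rc om Gam hGam xi cxi h happ.
have grp := rc_rough rc om.
pose a q := fine (holder_norm 0 1 gamma (incr (block (W om) q).1)).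
pose b q := fine (holder_norm 0 1 (2 * gamma) (block (W om) q).2).
have ab q : [/\ 0 <= a q, 0 <= b q & rough_on gamma (1 + a q + b q) (block (W om) q)].
  exact: block_rough grp.
have Rq q : 0 < Defs.radius gamma rad (block (W om) q) <= (k / (1 + a q + b q) ^+ (2 * l + 3)) ^+ 2.
  by have [a0 b0 _] := ab q; exact: hrad.
have fp := (hGam xi cxi).1.
have eps_small : (eps1 + K * L ^+ 2 * k) * (L * (1 + d%:R)) <= eps.
  have -> : (eps1 + K * L ^+ 2 * k) * (L * (1 + d%:R)) =
    eps / 2 + K * L ^+ 2 * (L * (1 + d%:R)) * k.
    by rewrite /eps1; move: (L * (1 + d%:R)) Ld => X X0; field; exact: lt0r_neq0.
  by rewrite [leRHS]splitr lerD2l.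
have rW q := let: And3 _ _ r := ab q in r.
have R0 q := (andP (Rq q)).1; have Rk q := (andP (Rq q)).2.
have kap0 q : 0 < k / (1 + a q + b q) ^+ (2 * l + 3).
  by have [a0 b0 _] := ab q; rewrite divr_gt0// den.
have wk q : (1 + a q + b q) ^+ (2 * l + 3) * (k / (1 + a q + b q) ^+ (2 * l + 3)) <= k.
  by have [a0 b0 _] := ab q; rewrite mulrC divfK// gt_eqF// den.
have cv := stable_series_Gam cb g3 g2 nu_ge0 Mc_ge1 Ms_ge1 spl dich L1 truncL
  (addr_ge0 Ka0 Kb0) flow_bound K20 hK2 c10 hc1 rW R0 kap0 Rk wk k1 h1 cxi fp x1 tx ty s0
  eps0 epsS (ltW eps10) hF1 h2 eps_small.
have kap_small : Ms * (Kd * k) <= 1 - expR (- beta) * expR del ^+ l by rewrite mulrA.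
have [cv0 bd] := stable_series_diff cb g3 g2 nu_ge0 Mc_ge1 Ms_ge1 spl dich L1 truncL
  (addr_ge0 Ka0 Kb0) flow_bound K20 hK2 c10 hc1 rW R0 kap0 Rk wk k1 h1 cxi fp x1 tx tx2 ty s0
  eps0 epsS (ltW eps10) hF1 h2 eps_small K40 hK4 dxl kap_small.
split => //; apply: le_trans (Dnorm_cst _ _ _) _.
by rewrite lee_fin mul1r.
Qed.
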